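(* Let $\theta>0$, let $\Lambda=\{(2\pi\tilde k,\,2\pi\tilde l\theta): \tilde k,\tilde l\in\mathbb{Z}\}\subset\mathbb{R}^2$, and let $T^2=\mathbb{R}^2/\Lambda$ with the flat metric induced from $\mathbb{R}^2$. Then $T^2$ admits a (full, isometric) proper-biharmonic immersion into the unit sphere $\mathbb{S}^n$ with constant mean curvature $h\in(0,1)$ if and only if $$\theta^2=\frac{q_1^2+q_2^2}{2}\quad\text{and}\quad n\in\{5,7\},$$ where $q_1,q_2\in\mathbb{N}$ and $q_1<q_2$. In this case $$h=\frac{q_2^2-q_1^2}{2(q_1^2+q_2^2)},$$ with $q_1\ge 0$ when $n=5$ and $q_1>0$ when $n=7$. Moreover, the CMC proper-biharmonic immersion $\phi$ of $T^2$ into $\mathbb{S}^n$ corresponds (i.e. $i\circ\phi$, lifted to $\mathbb{R}^2\cong\mathbb{C}$, $z=x+\i y$, where $i:\mathbb{S}^n\to\mathbb{R}^{n+1}$ is the inclusion) to a map $\psi:\mathbb{R}^2\to\mathbb{R}^{n+1}$ of the form $$\psi(z)=\tfrac{1}{\sqrt2}\sum_{k=1}^{m}\sqrt{R_k}\Big(e^{\frac{\sqrt{\lambda_1}}{2}(\mu_k z-\bar\mu_k\bar z)}Z_k+e^{\frac{\sqrt{\lambda_1}}{2}(-\mu_k z+\bar\mu_k\bar z)}\bar Z_k\Big)+\tfrac{1}{\sqrt2}\sum_{j=1}^{m'}\sqrt{R'_j}\Big(e^{\frac{\sqrt{\lambda_2}}{2}(\eta_j z-\bar\eta_j\bar z)}W_j+e^{\frac{\sqrt{\lambda_2}}{2}(-\eta_j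 z+\bar\eta_j\bar z)}\overline{W}_j\Big),$$ where $\{E_1,\dots,E_{2m+2m'}\}$ is an orthonormal basis of $\mathbb{R}^{n+1}$, $n=2m+2m'-1$, $Z_k=(E_{2k-1}-\i E_{2k})/2$, $W_j=(E_{2(m+j)-1}-\i E_{2(m+j)})/2$, $\lambda_1=2(1-h)$, $\lambda_2=2(1+h)$, and the data $(R_k,R'_j,\mu_k,\eta_j)$ are one of the following: - when $n=5$ ($m=1$, $m'=2$), with $h\in(0,1/2]$: $$R_1=1,\quad R'_1=\tfrac12\Big(1-\sqrt{\tfrac{1-2h}{1+2h}}\Big),\quad R'_2=\tfrac12\Big(1+\sqrt{\tfrac{1-2h}{1+2h}}\Big),$$ $$\mu_1=\sqrt{\tfrac{1-2h}{2(1-h)}}+\tfrac{\i}{\sqrt{2(1-h)}},\quad \eta_1=\sqrt{\tfrac{1+2h}{2(1+h)}}+\tfrac{\i}{\sqrt{2(1+h)}},\quad \eta_2=\bar\eta_1;$$ - when $n=7$ ($m=m'=2$), with $h\in(0,1/2)$ and $\omega\in(-\sqrt{1-2h},\sqrt{1-2h})$: $$R_{1,2}=\tfrac12\Big(1\pm\tfrac{\omega}{\sqrt{1-2h}}\Big),\quad R'_{1,2}=\tfrac12\Big(1\mp\tfrac{\omega}{\sqrt{1+2h}}\Big),$$ $$\mu_1=\sqrt{\tfrac{1-2h}{2(1-h)}}+\tfrac{\i}{\sqrt{2(1-h)}},\ \mu_2=\bar\mu_1,\quad \eta_1=\sqrt{\tfrac{1+2h}{2(1+h)}}+\tfrac{\i}{\sqrt{2(1+h)}},\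 \eta_2=\bar\eta_1.$$
   Context: A map $\phi:(M,g)\to(N,\tilde g)$ between Riemannian manifolds is biharmonic if it is a critical point of the bienergy $E_2(\phi)=\frac12\int_M|\tau(\phi)|^2v_g$, equivalently if its bitension field $\tau_2(\phi)=-\Delta\tau(\phi)-\operatorname{trace}R^N(d\phi,\tau(\phi))d\phi$ vanishes, where $\tau(\phi)$ is the tension field; it is proper-biharmonic if it is biharmonic but not harmonic. For an isometric immersion of a surface, the mean curvature is $h=|H|$, $H$ the mean curvature vector field; CMC means $h$ is constant. All immersions of the torus are isometric immersions of the flat torus and are full, i.e. their image does not lie in any totally geodesic sphere $\mathbb{S}^{n'}\subset\mathbb{S}^n$ with $n'<n$. $\mathbb{N}$ includes $0$.
   Formalization: ''Corresponds'' is taken up to a Euclidean isometry of the domain plane: the lift composed with some isometry of R^2 has the displayed form, because for n=5 and h<1/2 reflecting y to -y gives another valid immersion of the same torus that is not literally of that form. *)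

(* Defs.v *)
From Stdlib Require Import Reals Lra.
From Coquelicot Require Import Coquelicot.
Open Scope R_scope.

(** A map R^2 -> R^N is given by its components: [psi i x y] is the i-th
    coordinate (only the indices i < N are meaningful). *)
Definition map2 := nat -> R -> R -> R.

Fixpoint sumN (N : nat) (f : nat -> R) : R :=
  match N with O => 0 | S k => sumN k f + f k end.

Definition dx (f : R -> R -> R) : R -> R -> R := fun x y => Derive (fun t => f t y) x.
Definition dy (f : R -> R -> R) : R -> R -> R := fun x y => Derive (fun t => f x t) y.

Fixpoint pd (l : list bool) (f : R -> R -> R) : R -> R -> R :=
  match l with nil => f | cons b l' => (if b then dx else dy) (pd l' f) end.

Definition smooth2 (f : R -> R -> R) : Prop :=
  forall (l : list bool) (x y : R),
    ex_derive (fun t => pd l f t y) x /\ ex_derive (fun t => pd l f x t) y /\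
    continuous (fun p : R * R => pd l f (fst p) (snd p)) (x, y).

Definition dxV (V : map2) : map2 := fun i => dx (V i).
Definition dyV (V : map2) : map2 := fun i => dy (V i).
Definition dotF (N : nat) (U V : map2) (x y : R) : R := sumN N (fun i => U i x y * V i x y).
Definition Lap (V : map2) : map2 := fun i x y => dx (dx (V i)) x y + dy (dy (V i)) x y.

(** orthogonal projection onto T_{psi} S^n (= orthogonal complement of psi) *)
Definition proj_sph (N : nat) (psi W : map2) : map2 :=
  fun i x y => W i x y - dotF N W psi x y * psi i x y.

(** Domain = flat torus with global orthonormal coordinate frame (d/dx, d/dy).
    Tension field tau(phi) = trace nabla d phi, seen in R^N. *)
Definition tension (N : nat) (psi : map2) : map2 := proj_sph N psi (Lap psi).

(** Levi-Civita connection of the pull-back bundle phi^{-1} T S^n *)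
Definition nablax (N : nat) (psi V : map2) : map2 := proj_sph N psi (dxV V).
Definition nablay (N : nat) (psi V : map2) : map2 := proj_sph N psi (dyV V).

(** trace R^N(dphi, V) dphi for the unit sphere, with
    R(X,Y)Z = <Y,Z> X - <X,Z> Y  (R(X,Y) = [nabla_X,nabla_Y] - nabla_[X,Y]) *)
Definition curv_trace (N : nat) (psi V : map2) : map2 :=
  fun i x y =>
    (dotF N V (dxV psi) x y * dx (psi i) x y - dotF N (dxV psi) (dxV psi) x y * V i x y)
  + (dotF N V (dyV psi) x y * dy (psi i) x y - dotF N (dyV psi) (dyV psi) x y * V i x y).

(** bitension field tau_2 = - Delta tau - trace R(dphi,tau)dphi, where the rough
    Laplacian is Delta = - trace(nabla nabla - nabla_nabla); in the flat orthonormal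
    frame (d/dx,d/dy):  - Delta tau = nabla_x nabla_x tau + nabla_y nabla_y tau. *)
Definition bitension (N : nat) (psi : map2) : map2 :=
  let tau := tension N psi in
  fun i x y => nablax N psi (nablax N psi tau) i x y
             + nablay N psi (nablay N psi tau) i x y
             - curv_trace N psi tau i x y.

(** mean curvature vector of the surface in S^n: half the trace of the second
    fundamental form, i.e. half the component of psi_xx + psi_yy normal to
    psi, psi_x, psi_y (an orthonormal frame of T_psi R^N restricted to T(S^n)
    plus the tangent plane, for an isometric immersion into the unit sphere). *)
Definition meancurv (N : nat) (psi : map2) : map2 :=
  fun i x y =>
    / 2 * (Lap psi i x y
           - dotF N (Lap psi) psi x y * psi i x y
           - dotF N (Lap psi) (dxV psi) x y * dx (psi i) x y
           - dotF N (Lap psi) (dyV psi) x y * dy (psi i) x y).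

Definition meancurv_norm (N : nat) (psi : map2) (x y : R) : R :=
  sqrt (dotF N (meancurv N psi) (meancurv N psi) x y).

(** [psi] is the lift to R^2 of  i o phi, where phi : T^2 = R^2/Lambda -> S^n is a
    smooth full isometric immersion, Lambda = {(2 pi k, 2 pi l theta)}, N = n+1. *)
Definition torus_isom_immersion (N : nat) (theta : R) (psi : map2) : Prop :=
  (forall i, (i < N)%nat -> smooth2 (psi i)) /\
  (forall i x y, (i < N)%nat ->
      psi i (x + 2 * PI) y = psi i x y /\ psi i x (y + 2 * PI * theta) = psi i x y) /\
  (forall x y, dotF N psi psi x y = 1) /\
  (forall x y, dotF N (dxV psi) (dxV psi) x y = 1 /\
               dotF N (dxV psi) (dyV psi) x y = 0 /\
               dotF N (dyV psi) (dyV psi) x y = 1) /\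
  (* full: the image lies in no hyperplane through 0 (no totally geodesic S^{n'}, n'<n) *)
  (forall a : nat -> R, (forall x y, sumN N (fun i => a i * psi i x y) = 0) ->
      forall i, (i < N)%nat -> a i = 0).

Definition biharmonic (N : nat) (psi : map2) : Prop :=
  forall i x y, (i < N)%nat -> bitension N psi i x y = 0.

Definition harmonic (N : nat) (psi : map2) : Prop :=
  forall i x y, (i < N)%nat -> tension N psi i x y = 0.

Definition proper_biharmonic (N : nat) (psi : map2) : Prop :=
  biharmonic N psi /\ ~ harmonic N psi.

Definition cmc (N : nat) (psi : map2) (h : R) : Prop :=
  forall x y, meancurv_norm N psi x y = h.

Definition cmc_pbh_torus (n : nat) (theta : R) (psi : map2) (h : R) : Prop :=
  torus_isom_immersion (S n) theta psi /\ proper_biharmonic (S n) psi /\ cmc (S n) psi h.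

Definition cexp (w : Complex.C) : Complex.C :=
  (exp (fst w) * cos (snd w), exp (fst w) * sin (snd w)).

Fixpoint sumC1 (m : nat) (f : nat -> Complex.C) : Complex.C :=
  match m with O => RtoC 0 | S k => Cplus (sumC1 k f) (f (S k)) end.

Definition wave (s : R) (mu Zv z : Complex.C) : Complex.C :=
  let w := Cminus (Cmult mu z) (Cmult (Cconj mu) (Cconj z)) in
  Cplus (Cmult (cexp (Cmult (RtoC (s / 2)) w)) Zv)
        (Cmult (cexp (Cmult (RtoC (s / 2)) (Copp w))) (Cconj Zv)).

(** E : orthonormal basis E_1..E_N of R^N, [E j i] = i-th coordinate of E_j *)
Definition orthonormal_basis (N : nat) (E : nat -> nat -> R) : Prop :=
  forall j k, (1 <= j <= N)%nat -> (1 <= k <= N)%nat ->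
    sumN N (fun i => E j i * E k i) = if Nat.eqb j k then 1 else 0.

Definition Zvec (E : nat -> nat -> R) (a b i : nat) : Complex.C :=
  (E a i / 2, - E b i / 2).

Definition psi_form (E : nat -> nat -> R) (m m' : nat) (h : R)
    (Rk Rj' : nat -> R) (mu eta : nat -> Complex.C) (z : Complex.C) (i : nat) : Complex.C :=
  Cplus
    (Cmult (RtoC (/ sqrt 2))
       (sumC1 m (fun k => Cmult (RtoC (sqrt (Rk k)))
          (wave (sqrt (2 * (1 - h))) (mu k) (Zvec E (2 * k - 1) (2 * k) i) z))))
    (Cmult (RtoC (/ sqrt 2))
       (sumC1 m' (fun j => Cmult (RtoC (sqrt (Rj' j)))
          (wave (sqrt (2 * (1 + h))) (eta j) (Zvec E (2 * (m + j) - 1) (2 * (m + j)) i) z)))).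

Definition mu1 (h : R) : Complex.C := (sqrt ((1 - 2 * h) / (2 * (1 - h))), / sqrt (2 * (1 - h))).
Definition eta1 (h : R) : Complex.C := (sqrt ((1 + 2 * h) / (2 * (1 + h))), / sqrt (2 * (1 + h))).

Definition R5 (h : R) (k : nat) : R := 1.
Definition R5' (h : R) (j : nat) : R :=
  match j with
  | 1%nat => / 2 * (1 - sqrt ((1 - 2 * h) / (1 + 2 * h)))
  | _ => / 2 * (1 + sqrt ((1 - 2 * h) / (1 + 2 * h)))
  end.
Definition mu5 (h : R) (k : nat) : Complex.C := mu1 h.
Definition eta5 (h : R) (j : nat) : Complex.C :=
  match j with 1%nat => eta1 h | _ => Cconj (eta1 h) end.

Definition R7 (h w : R) (k : nat) : R :=
  match k with
  | 1%nat => / 2 * (1 + w / sqrt (1 - 2 * h))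
  | _ => / 2 * (1 - w / sqrt (1 - 2 * h))
  end.
Definition R7' (h w : R) (j : nat) : R :=
  match j with
  | 1%nat => / 2 * (1 - w / sqrt (1 + 2 * h))
  | _ => / 2 * (1 + w / sqrt (1 + 2 * h))
  end.
Definition mu7 (h : R) (k : nat) : Complex.C :=
  match k with 1%nat => mu1 h | _ => Cconj (mu1 h) end.
Definition eta7 (h : R) (j : nat) : Complex.C :=
  match j with 1%nat => eta1 h | _ => Cconj (eta1 h) end.

(** Euclidean isometry g(x,y) = (c1 + a x + b y, c2 + c x + d y) of R^2 *)
Definition rigid2 (a b c d : R) : Prop :=
  a * a + c * c = 1 /\ b * b + d * d = 1 /\ a * b + c * d = 0.

(* Main.v *)
Require Import Defs.
From Stdlib Require Import Reals Lra Lia ZArith List FunctionalExtensionality.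
From Coquelicot Require Import Coquelicot.
Open Scope R_scope.

(** Put [tau = Lap psi + 2 psi].  For an isometric immersion into the sphere this is the tension
    field, and for constant [|tau| = 2h] biharmonicity reads [Lap tau = 4 h^2 psi - 2 tau].  Hence
    [psi = f + g] with [f, g = psi/2 +- tau/(4h)], where [Lap f = - 2(1-h) f], [Lap g = - 2(1+h) g],
    [|f|^2 = |g|^2 = 1/2] and [f . g = 0].

    Both eigenvalues are below [4] while [psi] is [2 PI]-periodic in [x], so only the [x]-frequencies
    [0, 1, -1] survive.  Together with [|psi| = |psi_x| = 1] this excludes the frequency [0], that is
    [psi_xx = - psi]; then [f_yy = - (1-2h) f] and [g_yy = - (1+2h) g].  So [psi] is a sum of plane
    waves in [x +- s1 y] and [x +- s2 y] with [s1 = sqrt (1-2h)], [s2 = sqrt (1+2h)].  Differentiating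
    the constant scalar products shows that the wave vectors are pairwise orthogonal, fullness makes
    the nonzero ones a basis, and periodicity in [y] makes [s1 theta] and [s2 theta] integers. *)

(** * Smooth functions of two variables *)

(** No Fourier series is expanded; the cut-off of the [x]-frequencies is an energy argument. If on
    every line [y = const] an eigenfunction has an [x]-Dirichlet integral above its eigenvalue times
    its squared norm, then that squared norm is convex and periodic in [y], hence zero. Wirtinger's
    inequality, with a constant just below [4], supplies the gap for the part of [f] that is even
    under [x -> x + PI], and for the odd part once the frequencies [1, -1] are removed.

    The dimension is decided by four squared lengths: [r1, r2] for the waves in [x +- s1 y] and
    [r3, r4] for those in [x +- s2 y]. From [|f|^2 = |g|^2 = 1/2] come [r1 + r2 = r3 + r4 = 1/2],
    and [psi_x . psi_y = 0] becomes [s1 (r1 - r2) + s2 (r3 - r4) = 0]. Because [s1 < s2], both [r3]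
    and [r4] are positive. Each nonzero wave spans a plane, so [n + 1] is [8] when [r1, r2 > 0] and
    [6] when one of them vanishes. The parameter [w] is the freedom that the three equations leave.
    The bound [h <= 1/2] is [|f_y|^2 = (1 - 2h)/2 >= 0]. *)

Lemma fext2 (f g : R -> R -> R) : (forall x y, f x y = g x y) -> f = g.
Proof.
  intros H. apply functional_extensionality; intros x.
  apply functional_extensionality; intros y. apply H.
Qed.

Lemma fext3 (f g : map2) : (forall i x y, f i x y = g i x y) -> f = g.
Proof. intros H. apply functional_extensionality; intros i. apply fext2, H. Qed.

(** [pd] applies the head of the list last, so the derivative taken first sits at the end of the
    list; smoothness of [f] thereby passes to [dx f] and [dy f]. *)
Lemma pd_rcons (l : list bool) (b : bool) (f : R -> R -> R) :
  pd (l ++ b :: nil) f = pd l (if b then dx f else dy f).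
Proof. induction l as [|c l IH]; simpl; [now destruct b | now rewrite IH]. Qed.

Lemma smooth2_dx (f : R -> R -> R) : smooth2 f -> smooth2 (dx f).
Proof.
  intros H l x y. specialize (H (l ++ true :: nil) x y). now rewrite pd_rcons in H.
Qed.

Lemma smooth2_dy (f : R -> R -> R) : smooth2 f -> smooth2 (dy f).
Proof.
  intros H l x y. specialize (H (l ++ false :: nil) x y). now rewrite pd_rcons in H.
Qed.

Lemma smooth2_ex_x (f : R -> R -> R) (x y : R) : smooth2 f -> ex_derive (fun t => f t y) x.
Proof. intros H. exact (proj1 (H nil x y)). Qed.

Lemma smooth2_ex_y (f : R -> R -> R) (x y : R) : smooth2 f -> ex_derive (fun t => f x t) y.
Proof. intros H. exact (proj1 (proj2 (H nil x y))). Qed.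

Lemma smooth2_is_x (f : R -> R -> R) (x y : R) :
  smooth2 f -> is_derive (fun t => f t y) x (dx f x y).
Proof. intros H. apply Derive_correct, smooth2_ex_x, H. Qed.

Lemma smooth2_is_y (f : R -> R -> R) (x y : R) :
  smooth2 f -> is_derive (fun t => f x t) y (dy f x y).
Proof. intros H. apply Derive_correct, smooth2_ex_y, H. Qed.

Lemma smooth2_cont2 (f : R -> R -> R) (x y : R) : smooth2 f -> continuity_2d_pt f x y.
Proof. intros H. apply continuity_2d_pt_filterlim. exact (proj2 (proj2 (H nil x y))). Qed.

Lemma smooth2_cont_x (f : R -> R -> R) (x y : R) : smooth2 f -> continuous (fun t => f t y) x.
Proof. intros H. apply (@ex_derive_continuous R_AbsRing R_NormedModule), smooth2_ex_x, H. Qed.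

Lemma smooth2_cont_y (f : R -> R -> R) (x y : R) : smooth2 f -> continuous (fun t => f x t) y.
Proof. intros H. apply (@ex_derive_continuous R_AbsRing R_NormedModule), smooth2_ex_y, H. Qed.

Lemma dxdy_comm (f : R -> R -> R) : smooth2 f -> dx (dy f) = dy (dx f).
Proof.
  intros H. apply fext2; intros x y. apply (Schwarz f x y).
  - exists (mkposreal 1 Rlt_0_1). intros u v _ _. repeat split.
    + exact (smooth2_ex_x f u v H).
    + exact (smooth2_ex_y f u v H).
    + exact (smooth2_ex_x _ u v (smooth2_dy f H)).
    + exact (smooth2_ex_y _ u v (smooth2_dx f H)).
  - apply (smooth2_cont2 _ x y (smooth2_dx _ (smooth2_dy f H))).
  - apply (smooth2_cont2 _ x y (smooth2_dy _ (smooth2_dx f H))).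
Qed.

Lemma dx_lin_ex (f g : R -> R -> R) (a b : R) :
  (forall x y, ex_derive (fun t => f t y) x) -> (forall x y, ex_derive (fun t => g t y) x) ->
  dx (fun x y => a * f x y + b * g x y) = fun x y => a * dx f x y + b * dx g x y.
Proof.
  intros Hf Hg. apply fext2; intros x y. unfold dx.
  rewrite Derive_plus, !Derive_scal; auto; apply ex_derive_scal; auto.
Qed.

Lemma dy_lin_ex (f g : R -> R -> R) (a b : R) :
  (forall x y, ex_derive (fun t => f x t) y) -> (forall x y, ex_derive (fun t => g x t) y) ->
  dy (fun x y => a * f x y + b * g x y) = fun x y => a * dy f x y + b * dy g x y.
Proof.
  intros Hf Hg. apply fext2; intros x y. unfold dy.
  rewrite Derive_plus, !Derive_scal; auto; apply ex_derive_scal; auto.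
Qed.

Lemma pd_lin (f g : R -> R -> R) (a b : R) (l : list bool) :
  smooth2 f -> smooth2 g ->
  pd l (fun x y => a * f x y + b * g x y) = fun x y => a * pd l f x y + b * pd l g x y.
Proof.
  intros Hf Hg. induction l as [|c l IH]; simpl; [reflexivity|].
  rewrite IH. destruct c; [apply dx_lin_ex | apply dy_lin_ex]; intros x y;
    solve [exact (proj1 (Hf l x y)) | exact (proj1 (Hg l x y))
          | exact (proj1 (proj2 (Hf l x y))) | exact (proj1 (proj2 (Hg l x y)))].
Qed.

Lemma dx_lin (f g : R -> R -> R) (a b : R) :
  smooth2 f -> smooth2 g ->
  dx (fun x y => a * f x y + b * g x y) = fun x y => a * dx f x y + b * dx g x y.
Proof. intros Hf Hg. exact (pd_lin f g a b (true :: nil) Hf Hg). Qed.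

Lemma dy_lin (f g : R -> R -> R) (a b : R) :
  smooth2 f -> smooth2 g ->
  dy (fun x y => a * f x y + b * g x y) = fun x y => a * dy f x y + b * dy g x y.
Proof. intros Hf Hg. exact (pd_lin f g a b (false :: nil) Hf Hg). Qed.

Lemma smooth2_lin (f g : R -> R -> R) (a b : R) :
  smooth2 f -> smooth2 g -> smooth2 (fun x y => a * f x y + b * g x y).
Proof.
  intros Hf Hg l x y. rewrite (pd_lin f g a b l Hf Hg).
  destruct (Hf l x y) as (F1 & F2 & F3), (Hg l x y) as (G1 & G2 & G3).
  split; [|split].
  - apply @ex_derive_plus; apply ex_derive_scal; assumption.
  - apply @ex_derive_plus; apply ex_derive_scal; assumption.
  - apply @continuous_plus; apply @continuous_scal_r; assumption.
Qed.

Lemma pd_shift (f : R -> R -> R) (c : R) (l : list bool) :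
  smooth2 f -> pd l (fun x y => f (x + c) y) = fun x y => pd l f (x + c) y.
Proof.
  intros Hf. induction l as [|b l IH]; simpl; [reflexivity|].
  rewrite IH. apply fext2; intros x y. destruct b; unfold dx, dy; [|reflexivity].
  apply is_derive_unique.
  evar_last.
  - apply (is_derive_comp (fun t => pd l f t y) (fun t => t + c)).
    + apply Derive_correct. exact (proj1 (Hf l (x + c) y)).
    + auto_derive; [exact I | reflexivity].
  - unfold scal; simpl; unfold mult; simpl. ring.
Qed.

Lemma smooth2_shift (f : R -> R -> R) (c : R) : smooth2 f -> smooth2 (fun x y => f (x + c) y).
Proof.
  intros Hf l x y. rewrite (pd_shift f c l Hf).
  destruct (Hf l (x + c) y) as (F1 & F2 & F3). split; [|split].
  - apply (ex_derive_comp (fun t => pd l f t y) (fun t => t + c)); [exact F1|].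
    auto_derive; exact I.
  - exact F2.
  - apply (proj2 (continuity_2d_pt_filterlim (pd l f) (x + c) y)) in F3.
    apply (proj1 (continuity_2d_pt_filterlim (fun u v => pd l f (u + c) v) x y)).
    intros eps. destruct (F3 eps) as [del Hdel]. exists del. intros u v Hu Hv.
    apply Hdel; [|exact Hv]. now replace (u + c - (x + c)) with (u - x) by ring.
Qed.

Lemma dx_shift (f : R -> R -> R) (c : R) :
  smooth2 f -> dx (fun x y => f (x + c) y) = fun x y => dx f (x + c) y.
Proof. intros Hf. exact (pd_shift f c (true :: nil) Hf). Qed.

Lemma dy_shift (f : R -> R -> R) (c : R) :
  smooth2 f -> dy (fun x y => f (x + c) y) = fun x y => dy f (x + c) y.
Proof. intros Hf. exact (pd_shift f c (false :: nil) Hf). Qed.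

Lemma dy_periodic (f : R -> R -> R) (T : R) :
  smooth2 f -> (forall x y, f x (y + T) = f x y) -> forall x y, dy f x (y + T) = dy f x y.
Proof.
  intros Hf HT x y. symmetry. apply is_derive_unique.
  apply (is_derive_ext (fun t => f x (t + T))); [intros t; apply HT|].
  evar_last.
  - apply (is_derive_comp (fun t => f x t) (fun t => t + T)).
    + apply smooth2_is_y, Hf.
    + auto_derive; [exact I | reflexivity].
  - unfold scal; simpl; unfold mult; simpl. ring.
Qed.

Lemma dx_periodic (f : R -> R -> R) (T : R) :
  smooth2 f -> (forall x y, f x (y + T) = f x y) -> forall x y, dx f x (y + T) = dx f x y.
Proof. intros Hf HT x y. apply Derive_ext. intros t. apply HT. Qed.

(** * Wirtinger's inequality *)

Lemma ex_RInt_cont (f : R -> R) (a b : R) : (forall x, continuous f x) -> ex_RInt f a b.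
Proof. intros H. apply (@ex_RInt_continuous R_CompleteNormedModule). intros; apply H. Qed.

Lemma is_derive_cont (f df : R -> R) : (forall x, is_derive f x (df x)) -> forall x, continuous f x.
Proof.
  intros H x. apply (@ex_derive_continuous R_AbsRing R_NormedModule). exists (df x). apply H.
Qed.

Lemma RInt_Rplus (f g : R -> R) (a b : R) :
  ex_RInt f a b -> ex_RInt g a b -> RInt (fun x => f x + g x) a b = RInt f a b + RInt g a b.
Proof. exact (RInt_plus f g a b). Qed.

Lemma RInt_Rscal (f : R -> R) (c a b : R) :
  ex_RInt f a b -> RInt (fun x => c * f x) a b = c * RInt f a b.
Proof. exact (RInt_scal f a b c). Qed.

Lemma RInt_ext_all (f g : R -> R) (a b : R) : (forall x, f x = g x) -> RInt f a b = RInt g a b.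
Proof. intros H. apply RInt_ext. intros; apply H. Qed.

Lemma RInt_lin3 (f g h : R -> R) (u v w a b : R) :
  ex_RInt f a b -> ex_RInt g a b -> ex_RInt h a b ->
  RInt (fun x => u * f x + v * g x + w * h x) a b = u * RInt f a b + v * RInt g a b + w * RInt h a b.
Proof.
  intros Hf Hg Hh.
  pose proof (ex_RInt_scal f a b u Hf) as Ef. pose proof (ex_RInt_scal g a b v Hg) as Eg.
  pose proof (ex_RInt_scal h a b w Hh) as Eh.
  rewrite (RInt_Rplus (fun x => u * f x + v * g x) (fun x => w * h x) a b (ex_RInt_plus _ _ _ _ Ef Eg) Eh).
  rewrite (RInt_Rplus (fun x => u * f x) (fun x => v * g x) a b Ef Eg), !RInt_Rscal by assumption.
  reflexivity.
Qed.

Lemma RInt_FTC (f df : R -> R) (a b : R) :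
  (forall x, is_derive f x (df x)) -> (forall x, continuous df x) -> RInt df a b = f b - f a.
Proof.
  intros H Hc. apply is_RInt_unique. apply (is_RInt_derive f df); intros; auto.
Qed.

Lemma cont_mult (f g : R -> R) (x : R) :
  continuous f x -> continuous g x -> continuous (fun t => f t * g t) x.
Proof. intros. now apply (@continuous_mult R_UniformSpace R_AbsRing). Qed.

Lemma cont_plus (f g : R -> R) (x : R) :
  continuous f x -> continuous g x -> continuous (fun t => f t + g t) x.
Proof. intros. now apply (@continuous_plus R_UniformSpace R_AbsRing R_NormedModule). Qed.

Lemma cont_minus (f g : R -> R) (x : R) :
  continuous f x -> continuous g x -> continuous (fun t => f t - g t) x.
Proof. intros. now apply (@continuous_minus R_UniformSpace R_AbsRing R_NormedModule). Qed.

Lemma cont_scal (c : R) (f : R -> R) (x : R) :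
  continuous f x -> continuous (fun t => c * f t) x.
Proof. intros. apply cont_mult; [apply continuous_const | assumption]. Qed.

Lemma cont_sq (f : R -> R) (x : R) : continuous f x -> continuous (fun t => f t ^ 2) x.
Proof.
  intros H. simpl. apply cont_mult; [exact H|]. apply cont_mult; [exact H | apply continuous_const].
Qed.

Lemma cont_shift (f : R -> R) (c x : R) :
  (forall t, continuous f t) -> continuous (fun t => f (t + c)) x.
Proof.
  intros H. apply (continuous_comp (fun t => t + c) f); [|apply H].
  apply cont_plus; [apply continuous_id | apply continuous_const].
Qed.

Lemma is_derive_shift (f df : R -> R) (c x : R) :
  (forall t, is_derive f t (df t)) -> is_derive (fun t => f (t + c)) x (df (x + c)).
Proof.
  intros H. evar_last.
  - apply (is_derive_comp f (fun t => t + c)); [apply H|].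
    auto_derive; [exact I | reflexivity].
  - unfold scal; simpl; unfold mult; simpl. ring.
Qed.

Lemma RInt_shift (p : R -> R) (c a b : R) :
  (forall x, continuous p x) -> RInt (fun x => p (x + c)) a b = RInt p (a + c) (b + c).
Proof.
  intros H. replace (a + c) with (1 * a + c) by ring. replace (b + c) with (1 * b + c) by ring.
  rewrite <- (RInt_comp_lin p 1 c a b); [|now apply ex_RInt_cont].
  apply RInt_ext. intros x _. unfold scal; simpl; unfold mult; simpl.
  now rewrite !Rmult_1_l.
Qed.

Lemma RInt_period (p : R -> R) (l a : R) :
  (forall x, continuous p x) -> (forall x, p (x + l) = p x) ->
  RInt p a (a + l) = RInt p 0 l.
Proof.
  intros H Hp.
  assert (E : forall u v, ex_RInt p u v) by (intros; now apply ex_RInt_cont).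
  rewrite <- (RInt_Chasles p a 0 (a + l)), <- (RInt_Chasles p 0 l (a + l)); auto.
  assert (S : RInt p l (a + l) = RInt p 0 a).
  { rewrite <- (Rplus_0_l l) at 1. rewrite <- RInt_shift by exact H.
    apply RInt_ext. intros x _. apply Hp. }
  rewrite S, <- (opp_RInt_swap p 0 a); auto.
  unfold plus, opp; simpl. ring.
Qed.

(* The square [(v' + k tan(k (x - m)) v)^2], with [m] the midpoint, differs from
   [v'^2 - k^2 v^2] by the derivative of [k tan(k (x - m)) v^2], which vanishes at the ends. *)
Lemma poincare_zero_ends (v dv : R -> R) (a k : R) :
  (forall x, is_derive v x (dv x)) -> (forall x, continuous dv x) ->
  v a = 0 -> v (a + PI / 2) = 0 -> 0 < k < 2 ->
  k ^ 2 * RInt (fun x => v x ^ 2) a (a + PI / 2) <= RInt (fun x => dv x ^ 2) a (a + PI / 2).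
Proof.
  intros Hv Hdv Ha Hb Hk. pose proof PI_RGT_0 as HPI.
  pose proof (is_derive_cont v dv Hv) as Cv.
  set (b := a + PI / 2) in *. set (m := a + PI / 4).
  set (t := fun x => sin (k * (x - m)) / cos (k * (x - m))).
  (* Since [k < 2], the argument [k (x - m)] stays strictly inside [(-PI/2, PI/2)], so the tangent
     [t] is smooth up to both ends and solves the Riccati equation [t' = k (1 + t^2)]. *)
  assert (Hcos : forall x, a <= x <= b -> 0 < cos (k * (x - m))).
  { intros x Hx. unfold b, m in *. apply cos_gt_0; nra. }
  assert (Dt : forall x, a <= x <= b -> is_derive t x (k * (1 + t x ^ 2))).
  { intros x Hx. specialize (Hcos x Hx). unfold t.
    auto_derive; [apply Rgt_not_eq; exact Hcos |].
    change (x + - m) with (x - m). field; lra. }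
  clearbody t.
  set (F := fun x => k * t x * v x ^ 2).
  set (dF := fun x => k * (k * (1 + t x ^ 2)) * v x ^ 2 + k * t x * (2 * v x * dv x)).
  assert (IF : is_RInt dF a b (minus (F b) (F a))).
  { apply (is_RInt_derive F dF); rewrite Rmin_left, Rmax_right by (unfold b; lra); intros x Hx.
    - unfold F, dF. evar_last.
      + apply (is_derive_mult (fun x => k * t x) (fun x => v x ^ 2)); [| |intros; apply Rmult_comm].
        * apply is_derive_scal, Dt, Hx.
        * apply is_derive_pow, Hv.
      + unfold plus, mult; simpl. ring.
    - assert (Ct : continuous t x).
      { apply (@ex_derive_continuous R_AbsRing R_NormedModule). eexists; apply Dt, Hx. }
      unfold dF. apply cont_plus.
      + apply cont_mult; [|now apply cont_sq]. do 2 apply cont_scal.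
        apply cont_plus; [apply continuous_const | now apply cont_sq].
      + apply cont_mult; [now apply cont_scal|]. apply cont_mult; [now apply cont_scal | auto]. }
  assert (F0 : minus (F b) (F a) = 0).
  { unfold F, minus, plus, opp; simpl. rewrite Ha, Hb. ring. }
  rewrite F0 in IF.
  assert (I1 : is_RInt (fun x => v x ^ 2) a b (RInt (fun x => v x ^ 2) a b)).
  { apply (@RInt_correct R_CompleteNormedModule), ex_RInt_cont. intros x.
    now apply cont_sq. }
  assert (I2 : is_RInt (fun x => dv x ^ 2) a b (RInt (fun x => dv x ^ 2) a b)).
  { apply (@RInt_correct R_CompleteNormedModule), ex_RInt_cont. intros x.
    now apply cont_sq. }
  pose proof (is_RInt_plus _ _ _ _ _ _
    (is_RInt_minus _ _ _ _ _ _ I2 (is_RInt_scal _ _ _ (k ^ 2) _ I1)) IF) as I3.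
  assert (0 <= RInt (fun x => dv x ^ 2) a b - k ^ 2 * RInt (fun x => v x ^ 2) a b + 0); [|lra].
  apply (is_RInt_ge_0 _ a b _ ltac:(unfold b; lra) I3).
  intros x Hx. unfold dF, plus, minus, plus, opp, scal; simpl; unfold mult; simpl.
  replace (_ + _) with ((dv x + k * t x * v x) ^ 2) by ring. apply pow2_ge_0.
Qed.

(** The squares are [PI/2]-periodic, so the interval of integration may start at the zero [x0]; then
    [v] vanishes at its other end as well. *)
Lemma poincare_zero (v dv : R -> R) (x0 k : R) :
  (forall x, is_derive v x (dv x)) -> (forall x, continuous dv x) ->
  (forall x, v (x + PI / 2) ^ 2 = v x ^ 2) -> (forall x, dv (x + PI / 2) ^ 2 = dv x ^ 2) ->
  v x0 = 0 -> 0 < k < 2 ->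
  k ^ 2 * RInt (fun x => v x ^ 2) 0 (PI / 2) <= RInt (fun x => dv x ^ 2) 0 (PI / 2).
Proof.
  intros Hv Hdv P1 P2 H0 Hk.
  pose proof (is_derive_cont v dv Hv) as Cv.
  rewrite <- (RInt_period (fun x => v x ^ 2) (PI / 2) x0), <- (RInt_period (fun x => dv x ^ 2) (PI / 2) x0);
    auto; try (intros x; now apply cont_sq).
  apply poincare_zero_ends; auto. specialize (P1 x0). rewrite H0 in P1. nra.
Qed.

Lemma RInt_double (p : R -> R) :
  (forall x, continuous p x) -> RInt p 0 PI = RInt (fun x => p x + p (x + PI / 2)) 0 (PI / 2).
Proof.
  intros H. assert (E : forall u v, ex_RInt p u v) by (intros; now apply ex_RInt_cont).
  rewrite <- (RInt_Chasles p 0 (PI / 2) PI); auto.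
  assert (X : RInt (fun x => p (x + PI / 2)) 0 (PI / 2) = RInt p (PI / 2) PI).
  { rewrite RInt_shift by exact H. f_equal; lra. }
  rewrite <- X. symmetry. apply (RInt_plus p (fun x => p (x + PI / 2))); auto.
  apply ex_RInt_cont. intros; now apply cont_shift.
Qed.

Lemma mean_zero_root (v : R -> R) (a b : R) :
  a < b -> (forall x, continuous v x) -> @eq R (RInt v a b) 0 -> exists x, v x = 0.
Proof.
  intros Hab Cv H.
  assert (D : forall x, is_derive (fun z => RInt v a z) x (v x)).
  { intros x. apply (is_derive_RInt v (fun z => RInt v a z) a x); [|apply Cv].
    exists (mkposreal 1 Rlt_0_1). intros z _. now apply (@RInt_correct R_CompleteNormedModule), ex_RInt_cont. }
  destruct (MVT_gen (fun z => RInt v a z) a b v) as [c [_ Hc]].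
  - intros; apply D.
  - intros x _. apply continuity_pt_filterlim. exact (is_derive_cont _ _ D x).
  - exists c. rewrite H, RInt_point in Hc. unfold zero in Hc; simpl in Hc. nra.
Qed.

Lemma antiperiodic_root (v : R -> R) (l : R) :
  0 < l -> (forall x, continuous v x) -> v l = - v 0 -> exists x, v x = 0.
Proof.
  intros Hl Cv H.
  assert (CV : continuity v). { intros x. apply continuity_pt_filterlim, Cv. }
  destruct (IVT_gen v 0 l 0 CV) as [x [_ Hx]]; [|now exists x].
  rewrite H. unfold Rmin, Rmax; destruct (Rle_dec (v 0) (- v 0)); lra.
Qed.

(* Split [v] into its even and odd parts under the shift by half a period: each has a zero
   and its square is [PI/2]-periodic. *)
Lemma wirtinger (v dv : R -> R) (k : R) :
  (forall x, is_derive v x (dv x)) -> (forall x, continuous dv x) ->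
  (forall x, v (x + PI) = v x) -> (forall x, dv (x + PI) = dv x) ->
  @eq R (RInt v 0 PI) 0 -> 0 < k < 2 ->
  k ^ 2 * RInt (fun x => v x ^ 2) 0 PI <= RInt (fun x => dv x ^ 2) 0 PI.
Proof.
  intros Hv Cd P1 P2 M Hk. pose proof PI_RGT_0 as HPI.
  pose proof (is_derive_cont v dv Hv) as Cv.
  assert (Q1 : forall x, v (x + PI / 2 + PI / 2) = v x).
  { intros x. rewrite <- (P1 x). f_equal; lra. }
  assert (Q2 : forall x, dv (x + PI / 2 + PI / 2) = dv x).
  { intros x. rewrite <- (P2 x). f_equal; lra. }
  set (e := fun x => v x + v (x + PI / 2)). set (de := fun x => dv x + dv (x + PI / 2)).
  set (o := fun x => v x - v (x + PI / 2)). set (do_ := fun x => dv x - dv (x + PI / 2)).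
  assert (De : forall x, is_derive e x (de x)).
  { intros x. apply (is_derive_plus v (fun x => v (x + PI / 2))); [apply Hv | now apply is_derive_shift]. }
  assert (Do : forall x, is_derive o x (do_ x)).
  { intros x. apply (is_derive_minus v (fun x => v (x + PI / 2))); [apply Hv | now apply is_derive_shift]. }
  assert (Cde : forall x, continuous de x).
  { intros x. apply cont_plus; [apply Cd | now apply cont_shift]. }
  assert (Cdo : forall x, continuous do_ x).
  { intros x. apply cont_minus; [apply Cd | now apply cont_shift]. }
  (* The even part has a zero because its integral over [[0, PI/2]] is that of [v] over [[0, PI]];
     the odd part has one because the shift by [PI/2] changes its sign. *)
  destruct (mean_zero_root e 0 (PI / 2)) as [x0 Hx0].
  { lra. } { apply (is_derive_cont e de De). } { rewrite RInt_double in M; auto. }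
  destruct (antiperiodic_root o (PI / 2)) as [x1 Hx1].
  { lra. } { apply (is_derive_cont o do_ Do). }
  { unfold o. pose proof (Q1 0) as Q0. rewrite Rplus_0_l in *. lra. }
  assert (We := poincare_zero e de x0 k De Cde).
  assert (Wo := poincare_zero o do_ x1 k Do Cdo).
  specialize (We ltac:(intros x; unfold e; rewrite Q1; ring) ltac:(intros x; unfold de; rewrite Q2; ring) Hx0 Hk).
  specialize (Wo ltac:(intros x; unfold o; rewrite Q1; ring) ltac:(intros x; unfold do_; rewrite Q2; ring) Hx1 Hk).
  (* Parallelogram identity, by which the two inequalities for [e] and [o] recombine into one for
     [v]. *)
  assert (Sq : forall p : R -> R, (forall x, continuous p x) ->
     RInt (fun x => p x ^ 2) 0 PI =
     / 2 * (RInt (fun x => (p x + p (x + PI / 2)) ^ 2) 0 (PI / 2) +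
            RInt (fun x => (p x - p (x + PI / 2)) ^ 2) 0 (PI / 2))).
  { intros p Cp. pose proof (fun x => cont_shift p (PI / 2) x Cp) as Cs.
    rewrite RInt_double.
    2:{ intros x; now apply cont_sq. }
    assert (E : forall q : R -> R, (forall x, continuous q x) -> ex_RInt (fun x => q x ^ 2) 0 (PI / 2)).
    { intros q Cq. apply ex_RInt_cont. intros x; now apply cont_sq. }
    pose proof (E _ (fun x => cont_plus _ _ x (Cp x) (Cs x))) as E1.
    pose proof (E _ (fun x => cont_minus _ _ x (Cp x) (Cs x))) as E2.
    rewrite <- (RInt_Rplus _ _ _ _ E1 E2), <- (RInt_Rscal _ _ _ _ (ex_RInt_plus _ _ _ _ E1 E2)).
    apply RInt_ext. intros x _. unfold plus; simpl. field. }
  rewrite (Sq v Cv), (Sq dv Cd). fold e de o do_.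
  unfold e, de, o, do_ in *. nra.
Qed.

(** * Eigenfunctions on the torus with eigenvalue below 4 *)

Lemma derive_nonneg_mono (H dH : R -> R) (a b : R) :
  (forall x, is_derive H x (dH x)) -> (forall x, 0 <= dH x) -> a <= b -> H a <= H b.
Proof.
  intros D P Hab.
  destruct (MVT_gen H a b dH) as [c [_ Hc]].
  - intros; apply D.
  - intros x _. apply continuity_pt_filterlim. exact (is_derive_cont _ _ D x).
  - specialize (P c). nra.
Qed.

(** A monotone function with equal end values is constant in between; the midpoint has a whole
    neighbourhood inside the interval, so the derivative can be read off there. *)
Lemma mono_equal_ends (H dH : R -> R) (a T : R) :
  (forall x, is_derive H x (dH x)) -> (forall x, 0 <= dH x) -> 0 < T -> H (a + T) = H a ->
  dH (a + T / 2) = 0.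
Proof.
  intros D P HT E.
  assert (K : forall x, a <= x <= a + T -> H x = H a).
  { intros x Hx.
    pose proof (derive_nonneg_mono H dH a x D P ltac:(lra)).
    pose proof (derive_nonneg_mono H dH x (a + T) D P ltac:(lra)). lra. }
  rewrite <- (is_derive_unique _ _ _ (D (a + T / 2))).
  rewrite <- (Derive_const (H a) (a + T / 2)). apply Derive_ext_loc.
  assert (HT2 : 0 < T / 2) by lra. exists (mkposreal (T / 2) HT2).
  intros z Hz. apply K. unfold ball in Hz; simpl in Hz; unfold AbsRing_ball, abs, minus, plus, opp in Hz; simpl in Hz.
  apply Rabs_lt_between in Hz. lra.
Qed.

(** A periodic function with nonnegative derivative is constant, hence [ddG = 0], and
    [0 <= c * G <= ddG] forces [G = 0]. *)
Lemma periodic_superconvex_zero (G dG ddG : R -> R) (c T : R) :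
  (forall y, is_derive dG y (ddG y)) ->
  (forall y, 0 <= G y) -> (forall y, c * G y <= ddG y) -> 0 < c -> 0 < T ->
  (forall y, dG (y + T) = dG y) -> forall y, G y = 0.
Proof.
  intros D P Hc c0 T0 Per y.
  assert (Q : forall z, 0 <= ddG z). { intros z. specialize (P z); specialize (Hc z). nra. }
  pose proof (mono_equal_ends dG ddG (y - T / 2) T D Q T0 (Per _)) as E.
  replace (y - T / 2 + T / 2) with y in E by ring.
  specialize (P y); specialize (Hc y). nra.
Qed.

(** The period is moved so that [x] is its midpoint; the primitive of [v^2] is then monotone with
    equal end values. *)
Lemma RInt_sq_zero (v : R -> R) (x : R) :
  (forall x, continuous v x) -> (forall x, v (x + PI) ^ 2 = v x ^ 2) ->
  RInt (fun x : R => v x ^ 2) 0 PI = 0 -> v x = 0.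
Proof.
  intros Cv Per H. pose proof PI_RGT_0 as HPI.
  assert (C2 : forall x, continuous (fun x : R => v x ^ 2) x).
  { intros t; now apply cont_sq. }
  rewrite <- (RInt_period _ PI (x - PI / 2) C2 Per) in H.
  set (a := x - PI / 2) in *.
  assert (D : forall x, is_derive (fun z => RInt (fun x : R => v x ^ 2) a z) x (v x ^ 2)).
  { intros t. apply (is_derive_RInt (fun x : R => v x ^ 2) (fun z => RInt (fun x : R => v x ^ 2) a z) a t); [|apply C2].
    exists (mkposreal 1 Rlt_0_1). intros z _. now apply (@RInt_correct R_CompleteNormedModule), ex_RInt_cont. }
  pose proof (mono_equal_ends _ _ a PI D ltac:(intros; apply pow2_ge_0) HPI) as E.
  cbv beta in E. rewrite H, RInt_point in E. specialize (E eq_refl).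
  unfold a in E. replace (x - PI / 2 + PI / 2) with x in E by ring. nra.
Qed.

Definition eigen (lam : R) (f : R -> R -> R) : Prop :=
  forall x y, dx (dx f) x y + dy (dy f) x y = - lam * f x y.

Lemma eigen_lin (lam : R) (f g : R -> R -> R) (a b : R) :
  smooth2 f -> smooth2 g -> eigen lam f -> eigen lam g ->
  eigen lam (fun x y => a * f x y + b * g x y).
Proof.
  intros Sf Sg Hf Hg x y.
  rewrite !dx_lin, !dy_lin by auto using smooth2_dx, smooth2_dy.
  specialize (Hf x y); specialize (Hg x y). nra.
Qed.

Lemma eigen_shift (lam : R) (f : R -> R -> R) (c : R) :
  smooth2 f -> eigen lam f -> eigen lam (fun x y => f (x + c) y).
Proof.
  intros Sf Hf x y.
  rewrite (dx_shift f c Sf), (dy_shift f c Sf), (dx_shift (dx f) c), (dy_shift (dy f) c);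
    auto using smooth2_dx, smooth2_dy.
Qed.

Lemma eigen_dx (lam : R) (f : R -> R -> R) : smooth2 f -> eigen lam f -> eigen lam (dx f).
Proof.
  intros Sf Hf x y.
  assert (E : (fun x y => 1 * dx (dx f) x y + 1 * dy (dy f) x y) = (fun x y => - lam * f x y + 0 * f x y)).
  { apply fext2; intros u v. rewrite <- (Rplus_0_r (- lam * f u v)), <- (Hf u v) at 1. lra. }
  apply (f_equal dx) in E.
  rewrite !dx_lin in E by auto using smooth2_dx, smooth2_dy.
  apply (f_equal (fun F => F x y)) in E.
  rewrite (dxdy_comm (dy f)), (dxdy_comm f) in E by auto using smooth2_dy. lra.
Qed.

Lemma is_derive_RInt_y (F dF : R -> R -> R) (y : R) :
  (forall x y, is_derive (fun t => F x t) y (dF x y)) ->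
  (forall x y, continuity_2d_pt dF x y) -> (forall x y, continuous (fun t => F t y) x) ->
  is_derive (fun y => RInt (fun x => F x y) 0 PI) y (RInt (fun x => dF x y) 0 PI).
Proof.
  intros D C2 Cx.
  assert (E : forall t z, Derive (fun u => F t u) z = dF t z).
  { intros t z. apply is_derive_unique, D. }
  rewrite <- (RInt_ext (fun x => Derive (fun u => F x u) y) (fun x => dF x y) 0 PI)
    by (intros; apply E).
  apply (is_derive_RInt_param (fun y x => F x y) 0 PI y).
  - exists (mkposreal 1 Rlt_0_1). intros z _ t _. exists (dF t z). apply D.
  - intros t _. apply (continuity_2d_pt_ext (fun u v => dF v u)).
    { intros u v. symmetry. apply E. }
    intros eps. destruct (C2 t y eps) as [del Hd]. exists del. intros u v Hu Hv. now apply Hd.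
  - exists (mkposreal 1 Rlt_0_1). intros z _. apply ex_RInt_cont. intros t; apply Cx.
Qed.

(** The sign [s] treats periodic ([s = 1]) and antiperiodic ([s = -1]) functions at once: the
    boundary term carries the factor [s * s - 1]. *)
Lemma RInt_by_parts_periodic (v dv ddv : R -> R) (s : R) :
  (forall x, is_derive v x (dv x)) -> (forall x, is_derive dv x (ddv x)) ->
  (forall x, continuous ddv x) -> s * s = 1 -> v PI = s * v 0 -> dv PI = s * dv 0 ->
  RInt (fun x => v x * ddv x) 0 PI = - RInt (fun x => dv x ^ 2) 0 PI.
Proof.
  intros D1 D2 C S B1 B2.
  pose proof (is_derive_cont v dv D1) as Cv. pose proof (is_derive_cont dv ddv D2) as Cdv.
  assert (C1 : forall x, continuous (fun x => dv x ^ 2) x).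
  { intros x; now apply cont_sq. }
  assert (C2 : forall x, continuous (fun x => v x * ddv x) x).
  { intros x. apply cont_mult; auto. }
  assert (E : RInt (fun x => v x * ddv x + dv x ^ 2) 0 PI = v PI * dv PI - v 0 * dv 0).
  { apply (RInt_FTC (fun x => v x * dv x)).
    - intros x. evar_last.
      + apply (is_derive_mult v dv); [apply D1 | apply D2 | intros; apply Rmult_comm].
      + unfold plus, mult; simpl. ring.
    - intros x. apply cont_plus; auto. }
  rewrite RInt_Rplus in E by now apply ex_RInt_cont.
  rewrite B1, B2 in E.
  replace (s * v 0 * (s * dv 0) - v 0 * dv 0) with ((s * s - 1) * (v 0 * dv 0)) in E by ring.
  rewrite S in E. lra.
Qed.

(* [G(y) = int u(.,y)^2] satisfies [G'' = 2 int (u_x^2 + u_y^2) - 2 lam G >= 2 (c - lam) G]. *)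
Lemma spectral_gap_zero (u : R -> R -> R) (lam c s T : R) :
  smooth2 u -> eigen lam u -> s * s = 1 -> (forall x y, u (x + PI) y = s * u x y) ->
  0 < T -> (forall x y, u x (y + T) = u x y) -> lam < c ->
  (forall y, c * RInt (fun x => u x y ^ 2) 0 PI <= RInt (fun x => dx u x y ^ 2) 0 PI) ->
  forall x y, u x y = 0.
Proof.
  intros Su Eu Hs Px HT Py Hc Gap.
  pose proof (smooth2_dx u Su) as Sx. pose proof (smooth2_dy u Su) as Sy.
  pose proof (smooth2_dx _ Sx) as Sxx. pose proof (smooth2_dy _ Sy) as Syy.
  assert (Pdx : forall x y, dx u (x + PI) y = s * dx u x y).
  { intros x y. pose proof (dx_shift u PI Su) as E. apply (f_equal (fun F => F x y)) in E.
    rewrite <- E. unfold dx.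
    rewrite <- Derive_scal. apply Derive_ext. intros t; apply Px. }
  set (G := fun y => RInt (fun x => u x y ^ 2) 0 PI).
  set (dG := fun y => RInt (fun x => 2 * (u x y * dy u x y)) 0 PI).
  set (ddG := fun y => RInt (fun x => 2 * (dy u x y ^ 2 + u x y * dy (dy u) x y)) 0 PI).
  assert (D1 : forall y, is_derive dG y (ddG y)).
  { intros y. unfold dG, ddG.
    apply (is_derive_RInt_y (fun x y => 2 * (u x y * dy u x y))
             (fun x y => 2 * (dy u x y ^ 2 + u x y * dy (dy u) x y))).
    - intros x z. evar_last.
      + apply is_derive_scal.
        apply (is_derive_mult (fun t => u x t) (fun t => dy u x t));
          [exact (smooth2_is_y u x z Su) | exact (smooth2_is_y (dy u) x z Sy) | intros; apply Rmult_comm].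
      + unfold plus, mult; simpl. ring.
    - intros x z. apply continuity_2d_pt_mult; [apply continuity_2d_pt_const|].
      apply (continuity_2d_pt_plus (fun x y => dy u x y ^ 2) (fun x y => u x y * dy (dy u) x y)).
      + apply (continuity_2d_pt_ext (fun x y => dy u x y * dy u x y)); [intros; ring|].
        apply continuity_2d_pt_mult; exact (smooth2_cont2 (dy u) x z Sy).
      + apply continuity_2d_pt_mult; [exact (smooth2_cont2 u x z Su) | exact (smooth2_cont2 _ x z Syy)].
    - intros x z. apply cont_scal, cont_mult; [exact (smooth2_cont_x u x z Su) | exact (smooth2_cont_x _ x z Sy)]. }
  assert (G0 : forall y, G y = 0).
  { apply (periodic_superconvex_zero G dG ddG (2 * (c - lam)) T); auto.
    - intros y. unfold G. apply RInt_ge_0; [pose proof PI_RGT_0; lra | |].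
      + apply ex_RInt_cont. intros x. exact (cont_sq _ x (smooth2_cont_x u x y Su)).
      + intros; apply pow2_ge_0.
    - intros y. specialize (Gap y). fold (G y) in Gap.
      assert (C : forall f g : R -> R -> R, smooth2 f -> smooth2 g ->
                  ex_RInt (fun x => f x y * g x y) 0 PI).
      { intros f g Sf Sg. apply ex_RInt_cont. intros x. apply cont_mult; [exact (smooth2_cont_x f x y Sf) | exact (smooth2_cont_x g x y Sg)]. }
      (* The eigenvalue equation trades [u_yy] for [- lam u - u_xx], and integration by parts in [x]
         turns [- u u_xx] into [u_x^2]. *)
      assert (Eq : @eq R (ddG y) (2 * (RInt (fun x => dy u x y ^ 2) 0 PI) - 2 * lam * G y
                     + 2 * RInt (fun x => dx u x y ^ 2) 0 PI)).
      { assert (BP : RInt (fun x => u x y * dx (dx u) x y) 0 PI = - RInt (fun x => dx u x y ^ 2) 0 PI).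
        { apply (RInt_by_parts_periodic (fun x => u x y) (fun x => dx u x y) (fun x => dx (dx u) x y) s); auto.
          - intros x; exact (smooth2_is_x u x y Su).
          - intros x; exact (smooth2_is_x (dx u) x y Sx).
          - intros x; exact (smooth2_cont_x _ x y Sxx).
          - rewrite <- (Rplus_0_l PI) at 1. apply Px.
          - rewrite <- (Rplus_0_l PI) at 1. apply Pdx. }
        unfold ddG, G.
        rewrite (RInt_ext_all _ (fun x => 2 * (dy u x y * dy u x y)
            + (- 2 * lam) * (u x y * u x y) + (-2) * (u x y * dx (dx u) x y))).
        2:{ intros x. pose proof (Eu x y) as E.
            replace (dy (dy u) x y) with (- lam * u x y - dx (dx u) x y) by lra. ring. }
        rewrite (RInt_lin3 (fun x => dy u x y * dy u x y) (fun x => u x y * u x y)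
                   (fun x => u x y * dx (dx u) x y)) by auto.
        rewrite BP.
        rewrite (RInt_ext_all (fun x => dy u x y ^ 2) (fun x => dy u x y * dy u x y)) by (intros; ring).
        rewrite (RInt_ext_all (fun x => u x y ^ 2) (fun x => u x y * u x y)) by (intros; ring).
        ring. }
      assert (0 <= RInt (fun x => dy u x y ^ 2) 0 PI).
      { apply RInt_ge_0; [pose proof PI_RGT_0; lra | |].
        - apply ex_RInt_cont. intros x. exact (cont_sq _ x (smooth2_cont_x (dy u) x y Sy)).
        - intros; apply pow2_ge_0. }
      rewrite Eq. nra.
    - lra.
    - intros y. unfold dG. apply RInt_ext. intros x _.
      now rewrite Py, (dy_periodic u T Su Py). }
  intros x y. apply (RInt_sq_zero (fun x => u x y)).
  - intros t; exact (smooth2_cont_x u t y Su).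
  - intros t. rewrite Px. replace ((s * u t y) ^ 2) with (s * s * u t y ^ 2) by ring. rewrite Hs. ring.
  - apply G0.
Qed.

(** [k^2] is taken halfway between [lam] and [4]: above the eigenvalue, yet strictly below
    Wirtinger's constant. The bound [1 <= k^2] serves [antiperiodic_gap]. *)
Lemma gap_constant (lam : R) : 0 <= lam < 4 -> exists k, 0 < k < 2 /\ lam < k ^ 2 /\ 1 <= k ^ 2.
Proof.
  intros H. exists (sqrt ((lam + 4) / 2)).
  assert (E : sqrt ((lam + 4) / 2) ^ 2 = (lam + 4) / 2) by (apply pow2_sqrt; lra).
  assert (0 < sqrt ((lam + 4) / 2)) by (apply sqrt_lt_R0; lra).
  rewrite E. repeat split; nra.
Qed.

(** The even part [e] is [PI]-periodic in [x]. Its derivative [e_x] is again an eigenfunction and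
    has mean zero on each line, so Wirtinger gives it the gap [k^2 > lam] and it vanishes. *)
Lemma even_part_const (f : R -> R -> R) (lam T : R) :
  smooth2 f -> eigen lam f -> 0 <= lam < 4 -> 0 < T ->
  (forall x y, f (x + 2 * PI) y = f x y) -> (forall x y, f x (y + T) = f x y) ->
  forall x y, dx f x y + dx f (x + PI) y = 0.
Proof.
  intros Sf Ef Hlam HT Px Py.
  pose proof (smooth2_shift f PI Sf) as Ss.
  set (e := fun x y => 1 * f x y + 1 * f (x + PI) y).
  assert (Se : smooth2 e) by (apply smooth2_lin; auto).
  assert (Ee : eigen lam e) by (apply eigen_lin; auto using eigen_shift).
  assert (Pe : forall x y, e (x + PI) y = e x y).
  { intros x y. unfold e. replace (x + PI + PI) with (x + 2 * PI) by ring. rewrite Px. ring. }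
  assert (Pe' : forall x y, e x (y + T) = e x y) by (intros; unfold e; now rewrite !Py).
  assert (Pde : forall x y, dx e (x + PI) y = dx e x y).
  { intros x y. pose proof (dx_shift e PI Se) as E. apply (f_equal (fun F => F x y)) in E.
    rewrite <- E. apply Derive_ext. intros t; apply Pe. }
  assert (Pdde : forall x y, dx (dx e) (x + PI) y = dx (dx e) x y).
  { intros x y. pose proof (dx_shift (dx e) PI (smooth2_dx e Se)) as E. apply (f_equal (fun F => F x y)) in E.
    rewrite <- E. apply Derive_ext. intros t; apply Pde. }
  destruct (gap_constant lam Hlam) as (k & Hk & Hc & _).
  assert (Z : forall x y, dx e x y = 0).
  { apply (spectral_gap_zero (dx e) lam (k ^ 2) 1 T); auto using smooth2_dx, eigen_dx.
    - ring.
    - intros; rewrite Pde; ring.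
    - intros; now apply dx_periodic.
    - intros y. apply (wirtinger (fun x => dx e x y) (fun x => dx (dx e) x y)); auto.
      + intros x. exact (smooth2_is_x (dx e) x y (smooth2_dx e Se)).
      + intros x. exact (smooth2_cont_x _ x y (smooth2_dx _ (smooth2_dx e Se))).
      + rewrite (RInt_FTC (fun x => e x y)).
        * rewrite <- (Rplus_0_l PI), Pe. ring.
        * intros x. exact (smooth2_is_x e x y Se).
        * intros x. exact (smooth2_cont_x _ x y (smooth2_dx e Se)). }
  intros x y. rewrite <- (Z x y). unfold e.
  rewrite dx_lin, dx_shift by auto. ring.
Qed.

(** An antiperiodic function has odd frequencies, and [w = o + o''] loses the frequencies [1, -1].
    The rotated pair [a = w' sin - w cos], [b = w' cos + w sin] is [PI]-periodic with
    [a' = (w'' + w) sin] and [b' = (w'' + w) cos], so Wirtinger applies to both; since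
    [a^2 + b^2 = w'^2 + w^2], the sines and cosines disappear from the sum. *)
Lemma antiperiodic_gap (o o1 o2 w1 w2 : R -> R) (k : R) :
  (forall x, is_derive o x (o1 x)) -> (forall x, is_derive o1 x (o2 x)) ->
  (forall x, is_derive (fun t => o t + o2 t) x (w1 x)) ->
  (forall x, is_derive w1 x (w2 x)) -> (forall x, continuous w2 x) ->
  (forall x, o (x + PI) = - o x) -> (forall x, o1 (x + PI) = - o1 x) -> (forall x, o2 (x + PI) = - o2 x) ->
  (forall x, w1 (x + PI) = - w1 x) -> (forall x, w2 (x + PI) = - w2 x) ->
  0 < k < 2 -> 1 <= k ^ 2 ->
  (k ^ 2 + 2) * RInt (fun x => w1 x ^ 2) 0 PI <= RInt (fun x => w2 x ^ 2) 0 PI.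
Proof.
  intros D0 D1 D2 D3 C P0 P1 P2 P3 P4 Hk Hk1. pose proof PI_RGT_0 as HPI.
  set (w := fun t => o t + o2 t) in *.
  assert (Pw : forall x, w (x + PI) = - w x) by (intros; unfold w; rewrite P0, P2; ring).
  pose proof (is_derive_cont _ _ D0) as C0. pose proof (is_derive_cont _ _ D1) as C1.
  pose proof (is_derive_cont _ _ D2) as Cw. pose proof (is_derive_cont _ _ D3) as Cw1.
  assert (Cs : forall x, continuous sin x) by (intros; apply continuous_sin).
  assert (Cc : forall x, continuous cos x) by (intros; apply continuous_cos).
  assert (Ds : forall x, is_derive sin x (cos x)) by (intros; auto_derive; [exact I | ring]).
  assert (Dc : forall x, is_derive cos x (- sin x)) by (intros; auto_derive; [exact I | ring]).
  assert (DM : forall f g df dg x, is_derive f x df -> is_derive g x dg ->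
             is_derive (fun t => f t * g t) x (df * g x + f x * dg)).
  { intros f g df dg x Hf Hg. apply (is_derive_mult f g x df dg Hf Hg). intros; apply Rmult_comm. }
  set (a := fun x => w1 x * sin x - w x * cos x).
  set (b := fun x => w1 x * cos x + w x * sin x).
  assert (Da : forall x, is_derive a x ((w2 x + w x) * sin x)).
  { intros x. evar_last.
    - apply (is_derive_minus (fun x => w1 x * sin x) (fun x => w x * cos x)); apply DM; auto.
    - unfold minus, plus, opp; simpl. ring. }
  assert (Db : forall x, is_derive b x ((w2 x + w x) * cos x)).
  { intros x. evar_last.
    - apply (is_derive_plus (fun x => w1 x * cos x) (fun x => w x * sin x)); apply DM; auto.
    - unfold plus; simpl. ring. }
  assert (Ca : forall x, continuous (fun x => (w2 x + w x) * sin x) x).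
  { intros x. apply cont_mult; auto. apply cont_plus; auto. }
  assert (Cb : forall x, continuous (fun x => (w2 x + w x) * cos x) x).
  { intros x. apply cont_mult; auto. apply cont_plus; auto. }
  pose proof (is_derive_cont _ _ Da) as Ca0. pose proof (is_derive_cont _ _ Db) as Cb0.
  assert (Ma : @eq R (RInt a 0 PI) 0).
  (* The primitive rests on [(o' cos + o sin)' = (o + o'') cos = w cos]. Being built from products
     of two antiperiodic factors it is [PI]-periodic, so the mean is zero. *)
  { rewrite (RInt_FTC (fun x => w x * sin x + (-2) * (o1 x * cos x + o x * sin x))).
    - rewrite <- (Rplus_0_l PI), Pw, P0, P1, neg_sin, neg_cos. ring.
    - intros x. evar_last.
      + apply (is_derive_plus (fun x => w x * sin x) (fun x => (-2) * (o1 x * cos x + o x * sin x))).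
        * apply DM; auto.
        * apply is_derive_scal.
          apply (is_derive_plus (fun x => o1 x * cos x) (fun x => o x * sin x)); apply DM; auto.
      + unfold a, w, plus; simpl. ring.
    - apply (is_derive_cont _ _ Da). }
  assert (Mb : @eq R (RInt b 0 PI) 0).
  { rewrite (RInt_FTC (fun x => w x * cos x + 2 * (o1 x * sin x - o x * cos x))).
    - rewrite <- (Rplus_0_l PI), Pw, P0, P1, neg_sin, neg_cos. ring.
    - intros x. evar_last.
      + apply (is_derive_plus (fun x => w x * cos x) (fun x => 2 * (o1 x * sin x - o x * cos x))).
        * apply DM; auto.
        * apply is_derive_scal.
          apply (is_derive_minus (fun x => o1 x * sin x) (fun x => o x * cos x)); apply DM; auto.
      + unfold b, w, plus, minus, plus, opp; simpl. ring.
    - apply (is_derive_cont _ _ Db). }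
  pose proof (wirtinger a _ k Da Ca) as Wa. pose proof (wirtinger b _ k Db Cb) as Wb.
  specialize (Wa ltac:(intros x; unfold a; rewrite P3, Pw, neg_sin, neg_cos; ring)
                 ltac:(intros x; cbv beta; rewrite P4, Pw, neg_sin; ring) Ma Hk).
  specialize (Wb ltac:(intros x; unfold b; rewrite P3, Pw, neg_sin, neg_cos; ring)
                 ltac:(intros x; cbv beta; rewrite P4, Pw, neg_cos; ring) Mb Hk).
  cbv beta in Wa, Wb.
  assert (E2 : forall f g : R -> R, (forall x, continuous f x) -> (forall x, continuous g x) ->
     ex_RInt (fun x => f x * g x) 0 PI).
  { intros f g Hf Hg. apply ex_RInt_cont. intros; apply cont_mult; auto. }
  assert (ES : forall f : R -> R, (forall x, continuous f x) -> ex_RInt (fun x => f x ^ 2) 0 PI).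
  { intros f Hf. apply ex_RInt_cont. intros; now apply cont_sq. }
  assert (S1 : RInt (fun x => a x ^ 2) 0 PI + RInt (fun x => b x ^ 2) 0 PI =
     RInt (fun x => w1 x ^ 2) 0 PI + RInt (fun x => w x ^ 2) 0 PI).
  { rewrite <- (RInt_Rplus (fun x => a x ^ 2) (fun x => b x ^ 2)),
      <- (RInt_Rplus (fun x => w1 x ^ 2) (fun x => w x ^ 2));
      auto.
    apply RInt_ext_all. intros x. unfold a, b.
    pose proof (sin2_cos2 x) as SC. unfold Rsqr in SC.
    replace (w1 x ^ 2 + w x ^ 2) with ((w1 x ^ 2 + w x ^ 2) * (sin x * sin x + cos x * cos x)) by (rewrite SC; ring). ring. }
  assert (S2 : RInt (fun x => ((w2 x + w x) * sin x) ^ 2) 0 PI + RInt (fun x => ((w2 x + w x) * cos x) ^ 2) 0 PI =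
     RInt (fun x => w2 x ^ 2) 0 PI + 2 * RInt (fun x => w x * w2 x) 0 PI + RInt (fun x => w x ^ 2) 0 PI).
  { rewrite <- (RInt_Rplus (fun x => ((w2 x + w x) * sin x) ^ 2) (fun x => ((w2 x + w x) * cos x) ^ 2)) by auto.
    pose proof (RInt_lin3 (fun x => w2 x ^ 2) (fun x => w x * w2 x) (fun x => w x ^ 2) 1 2 1 0 PI
      (ES _ C) (E2 _ _ Cw C) (ES _ Cw)) as L3.
    rewrite !Rmult_1_l in L3. rewrite <- L3.
    apply RInt_ext_all. intros x.
    pose proof (sin2_cos2 x) as SC. unfold Rsqr in SC.
    transitivity ((w2 x + w x) * (w2 x + w x) * (sin x * sin x + cos x * cos x)); [ring | rewrite SC; ring]. }
  assert (BP : RInt (fun x => w x * w2 x) 0 PI = - RInt (fun x => w1 x ^ 2) 0 PI).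
  { apply (RInt_by_parts_periodic w w1 w2 (-1)); auto; try ring;
      rewrite <- (Rplus_0_l PI) at 1; [rewrite Pw | rewrite P3]; ring. }
  (* The two inequalities add up to [k^2 (I(w'^2) + I(w^2)) <= I(w''^2) - 2 I(w'^2) + I(w^2)], [I]
     being the integral; [1 <= k^2] allows the [w^2] terms to be dropped. *)
  assert (0 <= RInt (fun x => w x ^ 2) 0 PI).
  { apply RInt_ge_0; [lra | auto | intros; apply pow2_ge_0]. }
  nra.
Qed.

(** For the odd part [o], the function [w = o + o_xx] is an antiperiodic eigenfunction without the
    frequencies [1, -1]. Its derivative [w_x] has the gap [k^2 + 2 > lam] and vanishes. *)
Lemma odd_part_harmonic (f : R -> R -> R) (lam T : R) :
  smooth2 f -> eigen lam f -> 0 <= lam < 4 -> 0 < T ->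
  (forall x y, f (x + 2 * PI) y = f x y) -> (forall x y, f x (y + T) = f x y) ->
  forall x y, dx (dx f) x y - dx (dx f) (x + PI) y = - (f x y - f (x + PI) y).
Proof.
  intros Sf Ef Hlam HT Px Py.
  pose proof (smooth2_shift f PI Sf) as Ss.
  set (o := fun x y => 1 * f x y + (-1) * f (x + PI) y).
  assert (So : smooth2 o) by (apply smooth2_lin; auto).
  assert (Eo : eigen lam o) by (apply eigen_lin; auto using eigen_shift).
  assert (Pd : forall g, smooth2 g -> (forall x y, g (x + PI) y = - g x y) ->
            forall x y, dx g (x + PI) y = - dx g x y).
  { intros g Sg Pg x y. pose proof (dx_shift g PI Sg) as E. apply (f_equal (fun F => F x y)) in E.
    rewrite <- E. unfold dx. rewrite <- Derive_opp. apply Derive_ext. intros t; apply Pg. }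
  assert (Po : forall x y, o (x + PI) y = - o x y).
  { intros x y. unfold o. replace (x + PI + PI) with (x + 2 * PI) by ring. rewrite Px. ring. }
  assert (Po' : forall x y, o x (y + T) = o x y) by (intros; unfold o; now rewrite !Py).
  pose proof (smooth2_dx _ So) as S1. pose proof (smooth2_dx _ S1) as S2.
  set (w := fun x y => 1 * o x y + 1 * dx (dx o) x y).
  assert (Sw : smooth2 w) by (apply smooth2_lin; auto).
  assert (Ew : eigen lam w) by (apply eigen_lin; auto using eigen_dx).
  assert (Pw : forall x y, w (x + PI) y = - w x y).
  { intros x y. unfold w. rewrite Po, (Pd (dx o) S1 (Pd o So Po)). ring. }
  assert (Pw' : forall x y, w x (y + T) = w x y).
  { intros x y. unfold w. rewrite Po'. rewrite (dx_periodic (dx o)); auto.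
    intros; now apply dx_periodic. }
  pose proof (smooth2_dx _ Sw) as Sw1. pose proof (smooth2_dx _ Sw1) as Sw2.
  destruct (gap_constant lam Hlam) as (k & Hk & Hc & Hk1).
  assert (Z : forall x y, dx w x y = 0).
  { apply (spectral_gap_zero (dx w) lam (k ^ 2 + 2) (-1) T); auto using eigen_dx.
    - ring.
    - intros; rewrite Pd; auto; ring.
    - intros; now apply dx_periodic.
    - lra.
    - intros y.
      apply (antiperiodic_gap (fun x => o x y) (fun x => dx o x y) (fun x => dx (dx o) x y)
               (fun x => dx w x y) (fun x => dx (dx w) x y)); auto;
        intros x.
      + exact (smooth2_is_x o x y So).
      + exact (smooth2_is_x _ x y S1).
      + apply (is_derive_ext (fun t => w t y)); [intros t; unfold w; simpl; ring|].
        exact (smooth2_is_x w x y Sw).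
      + exact (smooth2_is_x _ x y Sw1).
      + exact (smooth2_cont_x _ x y Sw2). }
  intros x y.
  (* [w] does not depend on [x], yet it changes sign under the shift by [PI]. *)
  assert (W0 : w x y = 0).
  { assert (w (x + PI) y = w x y); [|rewrite Pw in *; lra].
    destruct (MVT_gen (fun t => w t y) x (x + PI) (fun t => dx w t y)) as [c [_ E]].
    - intros t _. exact (smooth2_is_x w t y Sw).
    - intros t _. apply continuity_pt_filterlim. exact (smooth2_cont_x w t y Sw).
    - rewrite Z in E. lra. }
  unfold w, o in W0. rewrite (dx_lin f _ 1 (-1) Sf Ss), dx_shift in W0 by exact Sf.
  rewrite (dx_lin (dx f) (fun x y => dx f (x + PI) y)), dx_shift in W0
    by auto using smooth2_dx, smooth2_shift.
  lra.
Qed.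

(** * The tension and bitension fields *)

Lemma sumN_ext (N : nat) (f g : nat -> R) :
  (forall i, (i < N)%nat -> f i = g i) -> sumN N f = sumN N g.
Proof.
  induction N as [|N IH]; intros H; simpl; [reflexivity|].
  rewrite IH, H; auto.
Qed.

Lemma sumN_lin (N : nat) (f g : nat -> R) (a b : R) :
  sumN N (fun i => a * f i + b * g i) = a * sumN N f + b * sumN N g.
Proof. induction N as [|N IH]; simpl; [ring | rewrite IH; ring]. Qed.

Lemma sumN_nonneg (N : nat) (f : nat -> R) : (forall i, 0 <= f i) -> 0 <= sumN N f.
Proof. intros H. induction N as [|N IH]; simpl; [lra | specialize (H N); lra]. Qed.

Lemma sumN_sq_zero (N : nat) (f : nat -> R) :
  sumN N (fun i => f i * f i) = 0 -> forall i, (i < N)%nat -> f i = 0.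
Proof.
  induction N as [|N IH]; intros H i Hi; [lia|]. simpl in H.
  pose proof (sumN_nonneg N (fun i => f i * f i) (fun i => Rle_0_sqr (f i))).
  pose proof (Rle_0_sqr (f N)) as H1. unfold Rsqr in H1.
  destruct (Nat.eq_dec i N) as [->|]; [nra | apply IH; [lra | lia]].
Qed.

Lemma sumN_derive (N : nat) (f df : nat -> R -> R) (x : R) :
  (forall i, (i < N)%nat -> is_derive (f i) x (df i x)) ->
  is_derive (fun t => sumN N (fun i => f i t)) x (sumN N (fun i => df i x)).
Proof.
  induction N as [|N IH]; intros H; simpl.
  - apply @is_derive_const.
  - apply (is_derive_plus (fun t => sumN N (fun i => f i t)) (f N)); auto.
Qed.

Definition smoothV (N : nat) (V : map2) : Prop := forall i, (i < N)%nat -> smooth2 (V i).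

Lemma smoothV_dx (N : nat) (V : map2) : smoothV N V -> smoothV N (dxV V).
Proof. intros H i Hi. apply smooth2_dx, H, Hi. Qed.

Lemma smoothV_dy (N : nat) (V : map2) : smoothV N V -> smoothV N (dyV V).
Proof. intros H i Hi. apply smooth2_dy, H, Hi. Qed.

Definition linV (a : R) (U : map2) (b : R) (V : map2) : map2 :=
  fun i x y => a * U i x y + b * V i x y.

Lemma smoothV_lin (N : nat) (a b : R) (U V : map2) :
  smoothV N U -> smoothV N V -> smoothV N (linV a U b V).
Proof. intros HU HV i Hi. apply smooth2_lin; auto. Qed.

Lemma dotF_comm (N : nat) (U V : map2) (x y : R) : dotF N U V x y = dotF N V U x y.
Proof. apply sumN_ext. intros; ring. Qed.

Lemma dotF_ext (N : nat) (U U' V V' : map2) (x y : R) :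
  (forall i, (i < N)%nat -> U i x y = U' i x y) -> (forall i, (i < N)%nat -> V i x y = V' i x y) ->
  dotF N U V x y = dotF N U' V' x y.
Proof. intros HU HV. apply sumN_ext. intros i Hi. now rewrite HU, HV. Qed.

Lemma dotF_linl (N : nat) (a b : R) (U V W : map2) (x y : R) :
  dotF N (linV a U b V) W x y = a * dotF N U W x y + b * dotF N V W x y.
Proof.
  unfold dotF. rewrite <- sumN_lin. apply sumN_ext. intros; unfold linV; ring.
Qed.

Lemma dotF_linr (N : nat) (a b : R) (U V W : map2) (x y : R) :
  dotF N W (linV a U b V) x y = a * dotF N W U x y + b * dotF N W V x y.
Proof. now rewrite dotF_comm, dotF_linl, !(dotF_comm N _ W). Qed.

Lemma dotF_derive_x (N : nat) (U V : map2) (x y : R) :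
  smoothV N U -> smoothV N V ->
  is_derive (fun t => dotF N U V t y) x (dotF N (dxV U) V x y + dotF N U (dxV V) x y).
Proof.
  intros HU HV.
  replace (dotF N (dxV U) V x y + dotF N U (dxV V) x y)
    with (sumN N (fun i => dx (U i) x y * V i x y + U i x y * dx (V i) x y)).
  - apply (sumN_derive N (fun i t => U i t y * V i t y)
             (fun i t => dx (U i) t y * V i t y + U i t y * dx (V i) t y)).
    intros i Hi. apply (is_derive_mult (fun t => U i t y) (fun t => V i t y));
      [exact (smooth2_is_x _ x y (HU i Hi)) | exact (smooth2_is_x _ x y (HV i Hi)) | intros; apply Rmult_comm].
  - unfold dotF, dxV. rewrite <- (Rmult_1_l (sumN N (fun i => dx (U i) x y * V i x y))).
    rewrite <- (Rmult_1_l (sumN N (fun i => U i x y * dx (V i) x y))), <- sumN_lin.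
    apply sumN_ext; intros; ring.
Qed.

Lemma dotF_derive_y (N : nat) (U V : map2) (x y : R) :
  smoothV N U -> smoothV N V ->
  is_derive (fun t => dotF N U V x t) y (dotF N (dyV U) V x y + dotF N U (dyV V) x y).
Proof.
  intros HU HV.
  replace (dotF N (dyV U) V x y + dotF N U (dyV V) x y)
    with (sumN N (fun i => dy (U i) x y * V i x y + U i x y * dy (V i) x y)).
  - apply (sumN_derive N (fun i t => U i x t * V i x t)
             (fun i t => dy (U i) x t * V i x t + U i x t * dy (V i) x t)).
    intros i Hi. apply (is_derive_mult (fun t => U i x t) (fun t => V i x t));
      [exact (smooth2_is_y _ x y (HU i Hi)) | exact (smooth2_is_y _ x y (HV i Hi)) | intros; apply Rmult_comm].
  - unfold dotF, dyV. rewrite <- (Rmult_1_l (sumN N (fun i => dy (U i) x y * V i x y))).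
    rewrite <- (Rmult_1_l (sumN N (fun i => U i x y * dy (V i) x y))), <- sumN_lin.
    apply sumN_ext; intros; ring.
Qed.

Lemma dotF_const_dx (N : nat) (U V : map2) (c : R) :
  smoothV N U -> smoothV N V -> (forall x y, dotF N U V x y = c) ->
  forall x y, dotF N (dxV U) V x y + dotF N U (dxV V) x y = 0.
Proof.
  intros HU HV H x y.
  rewrite <- (is_derive_unique _ _ _ (dotF_derive_x N U V x y HU HV)).
  rewrite <- (Derive_const c x). apply Derive_ext. intros; apply H.
Qed.

Lemma dotF_const_dy (N : nat) (U V : map2) (c : R) :
  smoothV N U -> smoothV N V -> (forall x y, dotF N U V x y = c) ->
  forall x y, dotF N (dyV U) V x y + dotF N U (dyV V) x y = 0.
Proof.
  intros HU HV H x y.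
  rewrite <- (is_derive_unique _ _ _ (dotF_derive_y N U V x y HU HV)).
  rewrite <- (Derive_const c y). apply Derive_ext. intros; apply H.
Qed.

Lemma dotF_schwarz (N : nat) (U V : map2) (x y : R) :
  smoothV N U -> dotF N (dxV (dyV U)) V x y = dotF N (dyV (dxV U)) V x y.
Proof.
  intros HU. apply dotF_ext; [|reflexivity].
  intros i Hi. unfold dxV, dyV. now rewrite dxdy_comm by auto.
Qed.

Lemma dotF_Lap (N : nat) (U V : map2) (x y : R) :
  dotF N (Lap U) V x y = dotF N (dxV (dxV U)) V x y + dotF N (dyV (dyV U)) V x y.
Proof.
  transitivity (dotF N (linV 1 (dxV (dxV U)) 1 (dyV (dyV U))) V x y).
  - apply dotF_ext; intros; [unfold Lap, linV, dxV, dyV; ring | reflexivity].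
  - rewrite dotF_linl. ring.
Qed.

Definition sphere_isometric (N : nat) (psi : map2) : Prop :=
  smoothV N psi /\ (forall x y, dotF N psi psi x y = 1) /\
  (forall x y, dotF N (dxV psi) (dxV psi) x y = 1 /\
               dotF N (dxV psi) (dyV psi) x y = 0 /\
               dotF N (dyV psi) (dyV psi) x y = 1).

Definition tau (psi : map2) : map2 := linV 1 (Lap psi) 2 psi.

Lemma smoothV_Lap (N : nat) (U : map2) : smoothV N U -> smoothV N (Lap U).
Proof.
  intros H i Hi.
  replace (Lap U i) with (linV 1 (dxV (dxV U)) 1 (dyV (dyV U)) i).
  - exact (smoothV_lin N 1 1 _ _ (smoothV_dx _ _ (smoothV_dx _ _ H)) (smoothV_dy _ _ (smoothV_dy _ _ H)) i Hi).
  - apply fext2; intros; unfold Lap, linV, dxV, dyV; ring.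
Qed.

Lemma smoothV_tau (N : nat) (psi : map2) : smoothV N psi -> smoothV N (tau psi).
Proof. intros H. apply smoothV_lin; [now apply smoothV_Lap | exact H]. Qed.

(** Differentiating [|psi|^2 = 1] twice gives [Lap psi . psi = - |psi_x|^2 - |psi_y|^2]. The
    tangential parts vanish because the metric is constant: for instance
    [psi_yy . psi_x = - psi_y . psi_xy], which is minus half the [x]-derivative of [|psi_y|^2]. *)
Lemma sphere_isometric_Lap (N : nat) (psi : map2) (x y : R) :
  sphere_isometric N psi ->
  dotF N (Lap psi) psi x y = -2 /\ dotF N (Lap psi) (dxV psi) x y = 0 /\
  dotF N (Lap psi) (dyV psi) x y = 0.
Proof.
  intros (S & U & M).
  assert (A1 : forall x y, dotF N (dxV psi) psi x y = 0).
  { intros u v. pose proof (dotF_const_dx N psi psi 1 S S U u v) as E.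
    rewrite (dotF_comm N psi (dxV psi)) in E. lra. }
  assert (A2 : forall x y, dotF N (dyV psi) psi x y = 0).
  { intros u v. pose proof (dotF_const_dy N psi psi 1 S S U u v) as E.
    rewrite (dotF_comm N psi (dyV psi)) in E. lra. }
  pose proof (dotF_const_dx N _ _ 0 (smoothV_dx N psi S) S A1 x y) as B1.
  pose proof (dotF_const_dy N _ _ 0 (smoothV_dy N psi S) S A2 x y) as B2.
  pose proof (smoothV_dx N psi S) as Sx. pose proof (smoothV_dy N psi S) as Sy.
  pose proof (dotF_const_dx N _ _ 1 Sx Sx (fun x y => proj1 (M x y)) x y) as Exx.
  pose proof (dotF_const_dy N _ _ 1 Sx Sx (fun x y => proj1 (M x y)) x y) as Exy.
  pose proof (dotF_const_dx N _ _ 1 Sy Sy (fun x y => proj2 (proj2 (M x y))) x y) as Eyx.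
  pose proof (dotF_const_dy N _ _ 1 Sy Sy (fun x y => proj2 (proj2 (M x y))) x y) as Eyy.
  pose proof (dotF_const_dx N _ _ 0 Sx Sy (fun x y => proj1 (proj2 (M x y))) x y) as Fx.
  pose proof (dotF_const_dy N _ _ 0 Sx Sy (fun x y => proj1 (proj2 (M x y))) x y) as Fy.
  rewrite (dotF_comm N (dxV psi) (dxV (dxV psi))) in Exx.
  rewrite (dotF_comm N (dxV psi) (dyV (dxV psi))) in Exy.
  rewrite (dotF_comm N (dyV psi) (dxV (dyV psi))), (dotF_schwarz N psi (dyV psi)) in Eyx by exact S.
  rewrite (dotF_comm N (dyV psi) (dyV (dyV psi))) in Eyy.
  rewrite (dotF_comm N (dxV psi) (dxV (dyV psi))), (dotF_schwarz N psi (dxV psi)) in Fx by exact S.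
  rewrite (dotF_comm N (dxV psi) (dyV (dyV psi))) in Fy.
  destruct (M x y) as (M1 & M2 & M3).
  rewrite !dotF_Lap. repeat split; lra.
Qed.

Lemma tension_tau (N : nat) (psi : map2) : sphere_isometric N psi -> tension N psi = tau psi.
Proof.
  intros H. apply fext3; intros i x y. unfold tension, proj_sph, tau, linV.
  rewrite (proj1 (sphere_isometric_Lap N psi x y H)). ring.
Qed.

Lemma meancurv_tau (N : nat) (psi : map2) (i : nat) (x y : R) :
  sphere_isometric N psi -> meancurv N psi i x y = / 2 * tau psi i x y.
Proof.
  intros H. destruct (sphere_isometric_Lap N psi x y H) as (E1 & E2 & E3).
  unfold meancurv, tau, linV. rewrite E1, E2, E3. ring.
Qed.

Lemma tau_normal (N : nat) (psi : map2) (x y : R) :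
  sphere_isometric N psi ->
  dotF N (tau psi) psi x y = 0 /\ dotF N (tau psi) (dxV psi) x y = 0 /\
  dotF N (tau psi) (dyV psi) x y = 0.
Proof.
  intros H. destruct (sphere_isometric_Lap N psi x y H) as (E1 & E2 & E3).
  destruct H as (S & U & M). unfold tau. rewrite !dotF_linl, E1, E2, E3, U.
  pose proof (dotF_const_dx N psi psi 1 S S U x y) as F1.
  pose proof (dotF_const_dy N psi psi 1 S S U x y) as F2.
  rewrite (dotF_comm N (dxV psi) psi) in F1. rewrite (dotF_comm N (dyV psi) psi) in F2.
  repeat split; lra.
Qed.

(** As [tau] is orthogonal to [psi], [psi_x] and [psi_y], its first derivatives stay orthogonal to
    [psi], so the first covariant derivative is the plain one. In the second, the projection removes
    [(Lap tau . psi) psi], where [Lap tau . psi = tau . Lap psi = |tau|^2]. The curvature trace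
    reduces to [- 2 tau]. *)
Lemma bitension_tau (N : nat) (psi : map2) (i : nat) (x y : R) :
  sphere_isometric N psi ->
  bitension N psi i x y =
  Lap (tau psi) i x y - dotF N (tau psi) (tau psi) x y * psi i x y + 2 * tau psi i x y.
Proof.
  intros H. pose proof H as (S & U & M).
  pose proof (smoothV_tau N psi S) as St.
  pose proof (smoothV_dx N psi S) as Sx. pose proof (smoothV_dy N psi S) as Sy.
  pose proof (fun x y => proj1 (tau_normal N psi x y H)) as T0.
  pose proof (fun x y => proj1 (proj2 (tau_normal N psi x y H))) as Tx.
  pose proof (fun x y => proj2 (proj2 (tau_normal N psi x y H))) as Ty.
  assert (T1 : forall x y, dotF N (dxV (tau psi)) psi x y = 0).
  { intros u v. pose proof (dotF_const_dx N _ _ 0 St S T0 u v). specialize (Tx u v). lra. }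
  assert (T2 : forall x y, dotF N (dyV (tau psi)) psi x y = 0).
  { intros u v. pose proof (dotF_const_dy N _ _ 0 St S T0 u v). specialize (Ty u v). lra. }
  assert (Nx : nablax N psi (tau psi) = dxV (tau psi)).
  { apply fext3; intros j u v. unfold nablax, proj_sph. rewrite T1. ring. }
  assert (Ny : nablay N psi (tau psi) = dyV (tau psi)).
  { apply fext3; intros j u v. unfold nablay, proj_sph. rewrite T2. ring. }
  pose proof (dotF_const_dx N _ _ 0 (smoothV_dx _ _ St) S T1 x y) as D1.
  pose proof (dotF_const_dy N _ _ 0 (smoothV_dy _ _ St) S T2 x y) as D2.
  pose proof (dotF_const_dx N _ _ 0 St Sx Tx x y) as D3.
  pose proof (dotF_const_dy N _ _ 0 St Sy Ty x y) as D4.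
  assert (E : dotF N (dxV (dxV (tau psi))) psi x y + dotF N (dyV (dyV (tau psi))) psi x y
              = dotF N (tau psi) (tau psi) x y).
  { unfold tau at 4. rewrite dotF_linr, T0, (dotF_comm N (tau psi) (Lap psi)), dotF_Lap,
      (dotF_comm N _ (tau psi)), (dotF_comm N (dyV (dyV psi))). lra. }
  unfold bitension. rewrite (tension_tau N psi H), Nx, Ny. unfold nablax, nablay, proj_sph, curv_trace.
  rewrite Tx, Ty. destruct (M x y) as (M1 & _ & M3). rewrite M1, M3.
  rewrite <- E. unfold Lap, dxV, dyV. ring.
Qed.

Lemma meancurv_norm_tau (N : nat) (psi : map2) (x y : R) :
  sphere_isometric N psi ->
  meancurv_norm N psi x y = sqrt (/ 4 * dotF N (tau psi) (tau psi) x y).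
Proof.
  intros H. unfold meancurv_norm. f_equal.
  transitivity (dotF N (linV (/ 2) (tau psi) 0 psi) (linV (/ 2) (tau psi) 0 psi) x y).
  - apply dotF_ext; intros; rewrite meancurv_tau by exact H; unfold linV; ring.
  - rewrite dotF_linl, !dotF_linr. field.
Qed.

Lemma dotF_nonneg (N : nat) (U : map2) (x y : R) : 0 <= dotF N U U x y.
Proof. apply sumN_nonneg. intros i. apply Rle_0_sqr. Qed.

(** * Scalar products of the jets *)

(** Smoothness at every index, not only below [N], so that differential equations can be stated and
    rewritten as equalities of maps. *)
Definition smoothA (V : map2) : Prop := forall i, smooth2 (V i).

Lemma smoothA_V (N : nat) (V : map2) : smoothA V -> smoothV N V.
Proof. intros H i _. apply H. Qed.

Lemma smoothA_dx (V : map2) : smoothA V -> smoothA (dxV V).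
Proof. intros H i. apply smooth2_dx, H. Qed.

Lemma smoothA_dy (V : map2) : smoothA V -> smoothA (dyV V).
Proof. intros H i. apply smooth2_dy, H. Qed.

Lemma dxV_lin (a b : R) (U V : map2) :
  smoothA U -> smoothA V -> dxV (linV a U b V) = linV a (dxV U) b (dxV V).
Proof. intros HU HV. apply functional_extensionality; intros i. exact (dx_lin (U i) (V i) a b (HU i) (HV i)). Qed.

Lemma dyV_lin (a b : R) (U V : map2) :
  smoothA U -> smoothA V -> dyV (linV a U b V) = linV a (dyV U) b (dyV V).
Proof. intros HU HV. apply functional_extensionality; intros i. exact (dy_lin (U i) (V i) a b (HU i) (HV i)). Qed.

Lemma dxV_dyV (U : map2) : smoothA U -> dxV (dyV U) = dyV (dxV U).
Proof. intros HU. apply functional_extensionality; intros i. exact (dxdy_comm (U i) (HU i)). Qed.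

Lemma dot2_const_dx (N : nat) (U V U' V' : map2) :
  smoothA U -> smoothA V -> smoothA U' -> smoothA V' ->
  (forall x y, dotF N U V x y + dotF N U' V' x y = 0) ->
  forall x y, dotF N (dxV U) V x y + dotF N U (dxV V) x y
              + (dotF N (dxV U') V' x y + dotF N U' (dxV V') x y) = 0.
Proof.
  intros HU HV HU' HV' H x y.
  pose proof (is_derive_plus (fun t => dotF N U V t y) (fun t => dotF N U' V' t y) x _ _
    (dotF_derive_x N U V x y (smoothA_V N U HU) (smoothA_V N V HV))
    (dotF_derive_x N U' V' x y (smoothA_V N U' HU') (smoothA_V N V' HV'))) as D.
  apply is_derive_unique in D.
  assert (Z : Derive (fun t => plus (dotF N U V t y) (dotF N U' V' t y)) x = 0).
  { rewrite <- (Derive_const 0 x). apply Derive_ext. intros; apply H. }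
  exact (eq_trans (eq_sym D) Z).
Qed.

Lemma dot2_const_dy (N : nat) (U V U' V' : map2) :
  smoothA U -> smoothA V -> smoothA U' -> smoothA V' ->
  (forall x y, dotF N U V x y + dotF N U' V' x y = 0) ->
  forall x y, dotF N (dyV U) V x y + dotF N U (dyV V) x y
              + (dotF N (dyV U') V' x y + dotF N U' (dyV V') x y) = 0.
Proof.
  intros HU HV HU' HV' H x y.
  pose proof (is_derive_plus (fun t => dotF N U V x t) (fun t => dotF N U' V' x t) y _ _
    (dotF_derive_y N U V x y (smoothA_V N U HU) (smoothA_V N V HV))
    (dotF_derive_y N U' V' x y (smoothA_V N U' HU') (smoothA_V N V' HV'))) as D.
  apply is_derive_unique in D.
  assert (Z : Derive (fun t => plus (dotF N U V x t) (dotF N U' V' x t)) y = 0).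
  { rewrite <- (Derive_const 0 y). apply Derive_ext. intros; apply H. }
  exact (eq_trans (eq_sym D) Z).
Qed.

Definition scaV (c : R) (U : map2) : map2 := linV c U 0 U.

Lemma dotF_scal (N : nat) (c : R) (U V : map2) (x y : R) :
  dotF N (scaV c U) V x y = c * dotF N U V x y.
Proof. unfold scaV. rewrite dotF_linl. ring. Qed.

Lemma dotF_scar (N : nat) (c : R) (U V : map2) (x y : R) :
  dotF N U (scaV c V) x y = c * dotF N U V x y.
Proof. unfold scaV. rewrite dotF_linr. ring. Qed.

Definition wave_eq (sg : R) (f : map2) : Prop :=
  smoothA f /\ dxV (dxV f) = scaV (-1) f /\ dyV (dyV f) = scaV (- sg) f.

Lemma wave_eq_xy (sg : R) (f : map2) :
  wave_eq sg f ->
  dxV (dyV (dxV f)) = scaV (-1) (dyV f) /\ dyV (dyV (dxV f)) = scaV (- sg) (dxV f).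
Proof.
  intros (S & X & Y). split.
  - rewrite dxV_dyV, X by now apply smoothA_dx. unfold scaV. now rewrite dyV_lin.
  - rewrite <- (dxV_dyV f S). rewrite <- (dxV_dyV (dyV f)) by now apply smoothA_dy.
    rewrite Y. unfold scaV. now rewrite dxV_lin.
Qed.

(** Each product arises by differentiating one already known to be constant and replacing second
    derivatives by the wave equations. Only [f_x . f_y] stays undetermined; it measures the
    imbalance between the two wave directions. *)
Lemma gram_self (N : nat) (sg : R) (f : map2) :
  wave_eq sg f -> (forall x y, dotF N f f x y = / 2) ->
  forall x y,
    dotF N f (dxV f) x y = 0 /\ dotF N f (dyV f) x y = 0 /\
    dotF N (dxV f) (dxV f) x y = / 2 /\ dotF N (dyV f) (dyV f) x y = sg / 2 /\
    dotF N (dyV (dxV f)) (dxV f) x y = 0 /\ dotF N (dyV (dxV f)) (dyV f) x y = 0 /\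
    dotF N (dyV (dxV f)) (dyV (dxV f)) x y = sg / 2 /\
    dotF N (dyV (dxV f)) f x y = - dotF N (dxV f) (dyV f) x y.
Proof.
  intros W H. destruct (wave_eq_xy sg f W) as [X3 Y3]. destruct W as (S & X & Y).
  assert (S0 := smoothA_V N f S).
  assert (Sx := smoothV_dx N f S0). assert (Sy := smoothV_dy N f S0).
  assert (Sxy := smoothV_dy N _ Sx).
  assert (A1 : forall x y, dotF N (dxV f) f x y = 0).
  { intros x y. pose proof (dotF_const_dx N f f _ S0 S0 H x y) as E.
    rewrite (dotF_comm N f) in E. lra. }
  assert (A2 : forall x y, dotF N (dyV f) f x y = 0).
  { intros x y. pose proof (dotF_const_dy N f f _ S0 S0 H x y) as E.
    rewrite (dotF_comm N f) in E. lra. }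
  assert (B1 : forall x y, dotF N (dxV f) (dxV f) x y = / 2).
  { intros x y. pose proof (dotF_const_dx N _ _ _ Sx S0 A1 x y) as E.
    rewrite X, dotF_scal, H in E. lra. }
  assert (B2 : forall x y, dotF N (dyV f) (dyV f) x y = sg / 2).
  { intros x y. pose proof (dotF_const_dy N _ _ _ Sy S0 A2 x y) as E.
    rewrite Y, dotF_scal, H in E. lra. }
  assert (C1 : forall x y, dotF N (dyV (dxV f)) (dxV f) x y = 0).
  { intros x y. pose proof (dotF_const_dy N _ _ _ Sx Sx B1 x y) as E.
    rewrite (dotF_comm N (dxV f)) in E. lra. }
  assert (C2 : forall x y, dotF N (dyV (dxV f)) (dyV f) x y = 0).
  { intros x y. pose proof (dotF_const_dx N _ _ _ Sy Sy B2 x y) as E.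
    rewrite (dotF_comm N (dyV f)), (dxV_dyV f S) in E. lra. }
  intros x y.
  pose proof (dotF_const_dx N _ _ _ Sxy Sy C2 x y) as D.
  rewrite X3, (dxV_dyV f S), dotF_scal, B2 in D.
  pose proof (dotF_const_dy N _ _ _ Sx S0 A1 x y) as E.
  rewrite !(dotF_comm N f), A1, A2, B1, B2, C1, C2. repeat split; lra.
Qed.

(** The constants [sf <> sg] separate [f] from [g] through [y]-derivatives. In [x] both satisfy the
    same equation, so for [f_x . g] the condition [psi_x . psi_y = 0] must be used. *)
Lemma gram_mixed (N : nat) (sf sg : R) (f g : map2) :
  sf <> sg -> wave_eq sf f -> wave_eq sg g ->
  (forall x y, dotF N f f x y = / 2) -> (forall x y, dotF N g g x y = / 2) ->
  (forall x y, dotF N f g x y = 0) ->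
  (forall x y, dotF N (dxV (linV 1 f 1 g)) (dyV (linV 1 f 1 g)) x y = 0) ->
  (forall x y, dotF N (dxV f) (dyV f) x y + dotF N (dxV g) (dyV g) x y = 0) /\
  forall x y,
    (dotF N f (dxV g) x y = 0 /\ dotF N f (dyV g) x y = 0 /\ dotF N f (dyV (dxV g)) x y = 0) /\
    (dotF N (dxV f) g x y = 0 /\ dotF N (dxV f) (dxV g) x y = 0 /\
     dotF N (dxV f) (dyV g) x y = 0 /\ dotF N (dxV f) (dyV (dxV g)) x y = 0) /\
    (dotF N (dyV f) g x y = 0 /\ dotF N (dyV f) (dxV g) x y = 0 /\
     dotF N (dyV f) (dyV g) x y = 0 /\ dotF N (dyV f) (dyV (dxV g)) x y = 0) /\
    (dotF N (dyV (dxV f)) g x y = 0 /\ dotF N (dyV (dxV f)) (dxV g) x y = 0 /\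
     dotF N (dyV (dxV f)) (dyV g) x y = 0 /\ dotF N (dyV (dxV f)) (dyV (dxV g)) x y = 0).
Proof.
  intros Hne Wf Wg Hf Hg H M.
  pose proof (gram_self N sf f Wf Hf) as Gf. pose proof (gram_self N sg g Wg Hg) as Gg.
  destruct (wave_eq_xy sf f Wf) as [Xf3 Yf3]. destruct (wave_eq_xy sg g Wg) as [Xg3 Yg3].
  destruct Wf as (Sf & Xf & Yf). destruct Wg as (Sg & Xg & Yg).
  assert (Sfx := smoothA_dx f Sf). assert (Sfy := smoothA_dy f Sf). assert (Sfxy := smoothA_dy _ Sfx).
  assert (Sgx := smoothA_dx g Sg). assert (Sgy := smoothA_dy g Sg). assert (Sgxy := smoothA_dy _ Sgx).
  pose proof (dotF_const_dx N f g 0 (smoothA_V N f Sf) (smoothA_V N g Sg) H) as H1.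
  pose proof (dotF_const_dy N f g 0 (smoothA_V N f Sf) (smoothA_V N g Sg) H) as H2.
  assert (XX : forall x y, dotF N (dxV f) (dxV g) x y = 0).
  { intros x y. pose proof (dot2_const_dx N _ _ _ _ Sfx Sg Sf Sgx H1 x y) as E.
    rewrite Xf, Xg, dotF_scal, dotF_scar, H in E. lra. }
  assert (YY : forall x y, dotF N (dyV f) (dyV g) x y = 0).
  { intros x y. pose proof (dot2_const_dy N _ _ _ _ Sfy Sg Sf Sgy H2 x y) as E.
    rewrite Yf, Yg, dotF_scal, dotF_scar, H in E. lra. }
  (* The [y]-derivative of [f_y . g_y = 0] is [sf f . g_y + sg f_y . g = 0], whereas
     [f . g_y = - f_y . g]. *)
  assert (Y0 : forall x y, dotF N (dyV f) g x y = 0).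
  { intros x y. pose proof (dotF_const_dy N _ _ 0 (smoothA_V N _ Sfy) (smoothA_V N _ Sgy) YY x y) as E.
    rewrite Yf, Yg, dotF_scal, dotF_scar in E. specialize (H2 x y).
    assert (E2 : (sg - sf) * dotF N (dyV f) g x y = 0) by nra.
    apply Rmult_integral in E2. destruct E2 as [E2|E2]; [lra | exact E2]. }
  assert (Z0 : forall x y, dotF N f (dyV g) x y = 0).
  { intros x y. specialize (H2 x y). rewrite Y0 in H2. lra. }
  pose proof (dotF_const_dx N _ _ 0 (smoothA_V N _ Sfy) (smoothA_V N _ Sgy) YY) as R1.
  rewrite (dxV_dyV f Sf), (dxV_dyV g Sg) in R1.
  (* The [y]-derivative of [psi_x . psi_y = 0] loses its self-products by [gram_self] and its mixed
     third-order part by [R1]; what remains is [sg f_x . g + sf f . g_x = 0]. *)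
  assert (K : forall x y, dotF N (dxV f) g x y = 0).
  { intros x y.
    rewrite (dxV_lin 1 1 f g Sf Sg), (dyV_lin 1 1 f g Sf Sg) in M.
    pose proof (dotF_const_dy N (linV 1 (dxV f) 1 (dxV g)) (linV 1 (dyV f) 1 (dyV g)) 0
      (smoothV_lin N 1 1 _ _ (smoothA_V N _ Sfx) (smoothA_V N _ Sgx))
      (smoothV_lin N 1 1 _ _ (smoothA_V N _ Sfy) (smoothA_V N _ Sgy)) M x y) as E.
    rewrite !dyV_lin in E by assumption.
    rewrite Yf, Yg, !dotF_linl, !dotF_linr, !dotF_scar in E.
    destruct (Gf x y) as (f1 & f2 & f3 & f4 & f5 & f6 & f7 & f8).
    destruct (Gg x y) as (g1 & g2 & g3 & g4 & g5 & g6 & g7 & g8).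
    rewrite (dotF_comm N (dxV f) f), (dotF_comm N (dxV g) g), (dotF_comm N (dxV g) f), f6, g6, f1, g1 in E.
    specialize (H1 x y). specialize (R1 x y).
    rewrite (dotF_comm N (dyV (dxV g)) (dyV f)) in E.
    assert (E2 : (sf - sg) * dotF N (dxV f) g x y = 0) by nra.
    apply Rmult_integral in E2. destruct E2 as [E2|E2]; [lra | exact E2]. }
  assert (K' : forall x y, dotF N f (dxV g) x y = 0).
  { intros x y. specialize (H1 x y). rewrite K in H1. lra. }
  pose proof (dotF_const_dy N _ _ 0 (smoothA_V N _ Sfx) (smoothA_V N _ Sg) K) as Q1.
  pose proof (dotF_const_dx N _ _ 0 (smoothA_V N _ Sfy) (smoothA_V N _ Sg) Y0) as Q2.
  pose proof (dotF_const_dx N _ _ 0 (smoothA_V N _ Sf) (smoothA_V N _ Sgy) Z0) as Q3.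
  rewrite (dxV_dyV f Sf) in Q2. rewrite (dxV_dyV g Sg) in Q3.
  assert (R0 : forall x y, dotF N (dyV (dxV f)) (dyV g) x y = 0).
  { intros x y. pose proof (dot2_const_dy N _ _ _ _ Sfxy Sg Sfx Sgy Q1 x y) as E.
    rewrite Yf3, Yg, dotF_scal, dotF_scar, K in E. lra. }
  assert (Q0 : forall x y, dotF N (dxV f) (dyV g) x y = 0).
  { intros x y. pose proof (dotF_const_dy N _ _ 0 (smoothA_V N _ Sfxy) (smoothA_V N _ Sgy) R0 x y) as E.
    rewrite Yf3, Yg, dotF_scal, dotF_scar in E. specialize (Q1 x y).
    assert (E2 : (sg - sf) * dotF N (dxV f) (dyV g) x y = 0) by nra.
    apply Rmult_integral in E2. destruct E2 as [E2|E2]; [lra | exact E2]. }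
  assert (XYX : forall x y, dotF N (dyV (dxV f)) (dxV g) x y = 0).
  { intros x y. pose proof (dot2_const_dx N _ _ _ _ Sfxy Sg Sfy Sgx Q2 x y) as E.
    rewrite Xf3, Xg, (dxV_dyV f Sf), dotF_scal, dotF_scar, Y0 in E. lra. }
  pose proof (dotF_const_dy N _ _ 0 (smoothA_V N _ Sfx) (smoothA_V N _ Sgx) XX) as T1.
  pose proof (dotF_const_dx N _ _ 0 (smoothA_V N _ Sfxy) (smoothA_V N _ Sgy) R0) as T2.
  rewrite Xf3, (dxV_dyV g Sg) in T2.
  assert (P0 : forall x y, dotF N (dyV f) (dxV g) x y = 0).
  { intros x y. specialize (Q1 x y). specialize (Q2 x y). rewrite Q0 in Q1. lra. }
  split.
  - intros x y. specialize (M x y).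
    rewrite (dxV_lin 1 1 f g Sf Sg), (dyV_lin 1 1 f g Sf Sg), !dotF_linl, !dotF_linr in M.
    rewrite (dotF_comm N (dxV g) (dyV f)), P0, Q0 in M. lra.
  - intros x y. specialize (Q1 x y). specialize (Q2 x y). specialize (Q3 x y).
    specialize (T1 x y). specialize (T2 x y). specialize (R1 x y).
    rewrite dotF_scal in T2. rewrite XX, YY, Y0, Z0, K, K', R0, Q0, XYX, P0 in *.
    repeat split; lra.
Qed.

(** * Splitting into eigenfunctions *)

Lemma pd_zero (l : list bool) : pd l (fun _ _ => 0) = fun _ _ => 0.
Proof.
  induction l as [|b l IH]; simpl; [reflexivity|]. rewrite IH.
  apply fext2; intros x y. destruct b; [exact (Derive_const 0 x) | exact (Derive_const 0 y)].
Qed.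

Lemma smooth2_zero : smooth2 (fun _ _ => 0).
Proof.
  intros l x y. rewrite pd_zero. repeat split.
  - apply @ex_derive_const.
  - apply @ex_derive_const.
  - apply continuous_const.
Qed.

(** Nothing is known about the components of index at least [N]; replacing them by zero turns
    identities valid below [N] into equalities of maps. *)
Definition trunc (N : nat) (V : map2) : map2 :=
  fun i => if Nat.ltb i N then V i else fun _ _ => 0.

Lemma trunc_lt (N i : nat) (V : map2) : (i < N)%nat -> trunc N V i = V i.
Proof. intros H. unfold trunc. apply Nat.ltb_lt in H. now rewrite H. Qed.

Lemma trunc_ge (N i : nat) (V : map2) : ~ (i < N)%nat -> trunc N V i = fun _ _ => 0.
Proof. intros H. unfold trunc. apply Nat.ltb_nlt in H. now rewrite H. Qed.

Lemma smoothA_trunc (N : nat) (V : map2) : smoothV N V -> smoothA (trunc N V).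
Proof.
  intros H i. destruct (Nat.lt_decidable i N) as [L|L].
  - rewrite trunc_lt by exact L. now apply H.
  - rewrite trunc_ge by exact L. exact smooth2_zero.
Qed.

Lemma dotF_trunc (N : nat) (U V : map2) (x y : R) :
  dotF N (trunc N U) (trunc N V) x y = dotF N U V x y.
Proof. apply dotF_ext; intros i Hi; now rewrite trunc_lt. Qed.

Lemma dxV_trunc (N : nat) (V : map2) : dxV (trunc N V) = trunc N (dxV V).
Proof.
  apply functional_extensionality; intros i. unfold dxV, trunc.
  destruct (Nat.ltb i N); [reflexivity | exact (pd_zero (true :: nil))].
Qed.

Lemma dyV_trunc (N : nat) (V : map2) : dyV (trunc N V) = trunc N (dyV V).
Proof.
  apply functional_extensionality; intros i. unfold dyV, trunc.
  destruct (Nat.ltb i N); [reflexivity | exact (pd_zero (false :: nil))].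
Qed.

Lemma Lap_dxdy (V : map2) : Lap V = linV 1 (dxV (dxV V)) 1 (dyV (dyV V)).
Proof. apply fext3; intros. unfold Lap, linV, dxV, dyV. ring. Qed.

Lemma linV_trunc (N : nat) (a b : R) (U V : map2) :
  linV a (trunc N U) b (trunc N V) = trunc N (linV a U b V).
Proof.
  apply fext3; intros i x y. unfold linV, trunc. destruct (Nat.ltb i N); [reflexivity | ring].
Qed.

Lemma Lap_trunc (N : nat) (V : map2) : Lap (trunc N V) = trunc N (Lap V).
Proof. now rewrite !Lap_dxdy, !dxV_trunc, !dyV_trunc, linV_trunc. Qed.

Lemma tau_trunc (N : nat) (V : map2) : tau (trunc N V) = trunc N (tau V).
Proof. unfold tau. now rewrite Lap_trunc, linV_trunc. Qed.

Lemma sphere_isometric_trunc (N : nat) (psi : map2) :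
  sphere_isometric N psi -> sphere_isometric N (trunc N psi).
Proof.
  intros (S & U & M). split; [|split].
  - exact (smoothA_V N _ (smoothA_trunc N psi S)).
  - intros. rewrite dotF_trunc. apply U.
  - intros x y. rewrite dxV_trunc, dyV_trunc, !dotF_trunc. apply M.
Qed.

Lemma xperiodic_dx (f : R -> R -> R) (c : R) :
  smooth2 f -> (forall x y, f (x + c) y = f x y) -> forall x y, dx f (x + c) y = dx f x y.
Proof.
  intros Sf P x y. pose proof (dx_shift f c Sf) as E. apply (f_equal (fun F => F x y)) in E.
  rewrite <- E. apply Derive_ext. intros; apply P.
Qed.

Lemma xperiodic_dy (f : R -> R -> R) (c : R) :
  (forall x y, f (x + c) y = f x y) -> forall x y, dy f (x + c) y = dy f x y.
Proof. intros P x y. apply Derive_ext. intros; apply P. Qed.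

(** Half the sum of the differentiated even-part identity and the odd-part identity. The formula is
    free of [lam], so it can be added over eigenfunctions with different eigenvalues. *)
Lemma periodic_dxx (f : R -> R -> R) (lam T : R) :
  smooth2 f -> eigen lam f -> 0 <= lam < 4 -> 0 < T ->
  (forall x y, f (x + 2 * PI) y = f x y) -> (forall x y, f x (y + T) = f x y) ->
  forall x y, dx (dx f) x y = - / 2 * (f x y - f (x + PI) y).
Proof.
  intros Sf Ef Hl HT Px Py x y.
  pose proof (even_part_const f lam T Sf Ef Hl HT Px Py) as E.
  pose proof (odd_part_harmonic f lam T Sf Ef Hl HT Px Py x y) as O.
  assert (F : (fun x y => 1 * dx f x y + 1 * dx f (x + PI) y) = fun _ _ => 0).
  { apply fext2; intros u v. specialize (E u v). lra. }
  apply (f_equal dx) in F.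
  pose proof (smooth2_dx f Sf) as S1.
  rewrite (dx_lin (dx f) (fun x y => dx f (x + PI) y) 1 1 S1 (smooth2_shift _ PI S1)) in F.
  rewrite (dx_shift (dx f) PI S1) in F.
  rewrite (pd_zero (true :: nil) : dx (fun _ _ => 0) = _) in F.
  apply (f_equal (fun G => G x y)) in F. lra.
Qed.

Definition shV (V : map2) : map2 := fun i x y => V i (x + PI) y.

(* [psi_xx = - (psi - psi(. + PI)) / 2], and pairing with [psi] forces [psi(. + PI) = - psi]. *)
Lemma sphere_isometric_dxx (N : nat) (psi : map2) :
  sphere_isometric N psi ->
  (forall i x y, dx (dx (psi i)) x y = - / 2 * (psi i x y - psi i (x + PI) y)) ->
  forall i x y, (i < N)%nat -> dx (dx (psi i)) x y = - psi i x y.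
Proof.
  intros (S & U & M) H i x y Hi.
  pose proof (dotF_const_dx N psi psi 1 S S U) as A1.
  assert (A2 : forall x y, dotF N (dxV psi) psi x y = 0).
  { intros u v. specialize (A1 u v). rewrite (dotF_comm N psi) in A1. lra. }
  pose proof (dotF_const_dx N _ _ 0 (smoothV_dx N psi S) S A2 x y) as B.
  rewrite (proj1 (M x y)) in B.
  assert (E : dotF N (dxV (dxV psi)) psi x y = - / 2 * (1 - dotF N (shV psi) psi x y)).
  { rewrite <- (U x y).
    transitivity (dotF N (linV (- / 2) psi (/ 2) (shV psi)) psi x y).
    - apply dotF_ext; [|reflexivity]. intros j Hj. unfold dxV, linV, shV. rewrite H. lra.
    - rewrite dotF_linl. lra. }
  assert (Z : dotF N (linV 1 psi 1 (shV psi)) (linV 1 psi 1 (shV psi)) x y = 0).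
  { rewrite dotF_linl, !dotF_linr, (dotF_comm N psi (shV psi)), (U x y).
    replace (dotF N (shV psi) (shV psi) x y) with 1 by (symmetry; apply (U (x + PI) y)). lra. }
  pose proof (sumN_sq_zero N _ Z i Hi) as Z'. unfold linV, shV in Z'. rewrite H. lra.
Qed.

(** On the span of [psi] and [tau] the Laplacian has constant coefficients,
    [Lap psi = - 2 psi + tau] and [Lap tau = 4 h^2 psi - 2 tau], with eigenvalues [- 2 +- 2h]; [f]
    and [g] are the eigencomponents of [psi]. *)
Lemma eigen_split (n : nat) (theta h : R) (psi : map2) :
  cmc_pbh_torus n theta psi h -> 0 < theta -> 0 < h < 1 ->
  exists f g : map2,
    (forall i x y, (i < S n)%nat -> psi i x y = f i x y + g i x y) /\
    wave_eq (1 - 2 * h) f /\ wave_eq (1 + 2 * h) g /\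
    (forall x y, dotF (S n) f f x y = / 2) /\ (forall x y, dotF (S n) g g x y = / 2) /\
    (forall x y, dotF (S n) f g x y = 0) /\
    (forall x y, dotF (S n) (dxV (linV 1 f 1 g)) (dyV (linV 1 f 1 g)) x y = 0) /\
    (forall i x y, f i x (y + 2 * PI * theta) = f i x y) /\
    (forall i x y, g i x (y + 2 * PI * theta) = g i x y).
Proof.
  intros ((S0 & Per & U0 & M0 & _) & (BH & _) & CMC) Hth Hh. set (N := S n) in *.
  assert (I0 : sphere_isometric N psi) by (split; [exact S0 | split; [exact U0 | exact M0]]).
  pose proof (sphere_isometric_trunc N psi I0) as I1.
  set (P := trunc N psi) in *. set (t := tau P).
  assert (SP : smoothA P) by exact (smoothA_trunc N psi S0).
  assert (Et : t = trunc N (tau psi)) by apply tau_trunc.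
  assert (St : smoothA t) by (rewrite Et; exact (smoothA_trunc N _ (smoothV_tau N psi S0))).
  assert (TT0 : forall x y, dotF N (tau psi) (tau psi) x y = 4 * h ^ 2).
  { intros x y. specialize (CMC x y). rewrite (meancurv_norm_tau N psi x y I0) in CMC.
    pose proof (dotF_nonneg N (tau psi) x y) as P0.
    rewrite <- CMC, pow2_sqrt by lra. field. }
  assert (TT : forall x y, dotF N t t x y = 4 * h ^ 2).
  { intros. rewrite Et, dotF_trunc. apply TT0. }
  assert (Lt : Lap t = linV (4 * h ^ 2) P (-2) t).
  { rewrite Et, Lap_trunc. unfold P. rewrite linV_trunc. apply fext3; intros i x y.
    destruct (Nat.lt_decidable i N) as [L|L]; [|now rewrite !trunc_ge].
    rewrite !trunc_lt by exact L. unfold linV.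
    specialize (BH i x y L). rewrite (bitension_tau N psi i x y I0), TT0 in BH. lra. }
  assert (LP : Lap P = linV (-2) P 1 t).
  { apply fext3; intros. unfold t, tau, linV. ring. }
  assert (TP : forall x y, dotF N t P x y = 0) by (intros; apply (tau_normal N P x y I1)).
  assert (PP : forall x y, dotF N P P x y = 1) by apply I1.
  assert (PerPx : forall i x y, P i (x + 2 * PI) y = P i x y).
  { intros i x y. destruct (Nat.lt_decidable i N) as [L|L].
    - unfold P. rewrite trunc_lt by exact L. now apply Per.
    - unfold P. now rewrite trunc_ge. }
  assert (PerPy : forall i x y, P i x (y + 2 * PI * theta) = P i x y).
  { intros i x y. destruct (Nat.lt_decidable i N) as [L|L].
    - unfold P. rewrite trunc_lt by exact L. now apply Per.
    - unfold P. now rewrite trunc_ge. }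
  assert (PertX : forall i x y, t i (x + 2 * PI) y = t i x y).
  { intros i x y. unfold t, tau, linV, Lap. rewrite PerPx.
    rewrite (xperiodic_dx (dx (P i)) (2 * PI)) by
      (solve [apply smooth2_dx, SP | intros; apply xperiodic_dx; [apply SP | apply PerPx]]).
    rewrite (xperiodic_dy (dy (P i)) (2 * PI)) by (intros; apply xperiodic_dy; apply PerPx).
    reflexivity. }
  assert (PertY : forall i x y, t i x (y + 2 * PI * theta) = t i x y).
  { intros i x y. unfold t, tau, linV, Lap. rewrite PerPy.
    rewrite (dx_periodic (dx (P i)) (2 * PI * theta)) by
      (solve [apply smooth2_dx, SP | intros; apply dx_periodic; [apply SP | apply PerPy]]).
    rewrite (dy_periodic (dy (P i)) (2 * PI * theta)) by
      (solve [apply smooth2_dy, SP | intros; apply dy_periodic; [apply SP | apply PerPy]]).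
    reflexivity. }
  set (f := linV (/ 2) P (/ (4 * h)) t). set (g := linV (/ 2) P (- / (4 * h)) t).
  assert (Sf : smoothA f) by (intros i; apply smooth2_lin; [apply SP | apply St]).
  assert (Sg : smoothA g) by (intros i; apply smooth2_lin; [apply SP | apply St]).
  assert (Llin : forall a b, Lap (linV a P b t) = linV a (Lap P) b (Lap t)).
  { intros a b. rewrite !Lap_dxdy.
    rewrite (dxV_lin a b P t SP St), (dyV_lin a b P t SP St).
    rewrite (dxV_lin a b _ _ (smoothA_dx P SP) (smoothA_dx t St)).
    rewrite (dyV_lin a b _ _ (smoothA_dy P SP) (smoothA_dy t St)).
    apply fext3; intros; unfold linV; ring. }
  assert (Ef : forall i, eigen (2 * (1 - h)) (f i)).
  { intros i x y. change (Lap f i x y = - (2 * (1 - h)) * f i x y).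
    unfold f at 1. rewrite Llin, LP, Lt. unfold f, linV. field. lra. }
  assert (Eg : forall i, eigen (2 * (1 + h)) (g i)).
  { intros i x y. change (Lap g i x y = - (2 * (1 + h)) * g i x y).
    unfold g at 1. rewrite Llin, LP, Lt. unfold g, linV. field. lra. }
  assert (HT : 0 < 2 * PI * theta) by (pose proof PI_RGT_0; nra).
  assert (PfY : forall i x y, f i x (y + 2 * PI * theta) = f i x y).
  { intros. unfold f, linV. now rewrite PerPy, PertY. }
  assert (PgY : forall i x y, g i x (y + 2 * PI * theta) = g i x y).
  { intros. unfold g, linV. now rewrite PerPy, PertY. }
  assert (PfX : forall i x y, f i (x + 2 * PI) y = f i x y).
  { intros. unfold f, linV. now rewrite PerPx, PertX. }
  assert (PgX : forall i x y, g i (x + 2 * PI) y = g i x y).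
  { intros. unfold g, linV. now rewrite PerPx, PertX. }
  assert (Pfg : P = linV 1 f 1 g).
  { apply fext3; intros. unfold f, g, linV. field. lra. }
  assert (Pxx : dxV (dxV P) = scaV (-1) P).
  { apply fext3; intros i x y. unfold scaV, linV.
    destruct (Nat.lt_decidable i N) as [L|L].
    2:{ unfold P. rewrite !dxV_trunc, !trunc_ge by exact L. ring. }
    assert (Hh2 : forall j u v, dx (dx (P j)) u v = - / 2 * (P j u v - P j (u + PI) v)).
    { intros j u v.
      assert (EP : P j = fun x y => 1 * f j x y + 1 * g j x y) by exact (f_equal (fun V : map2 => V j) Pfg).
      rewrite EP.
      rewrite (dx_lin (f j) (g j) 1 1 (Sf j) (Sg j)).
      rewrite (dx_lin (dx (f j)) (dx (g j)) 1 1 (smooth2_dx _ (Sf j)) (smooth2_dx _ (Sg j))).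
      rewrite (periodic_dxx (f j) _ _ (Sf j) (Ef j) ltac:(lra) HT (PfX j) (PfY j)).
      rewrite (periodic_dxx (g j) _ _ (Sg j) (Eg j) ltac:(lra) HT (PgX j) (PgY j)).
      ring. }
    change (dx (dx (P i)) x y = -1 * P i x y + 0 * P i x y).
    rewrite (sphere_isometric_dxx N P I1 Hh2 i x y L). ring. }
  (* From [P_xx = - P] one gets [t = P_yy + P], and the [x]- and [y]-derivatives commute. The
     equation then passes to every combination of [P] and [t], in particular to [f] and [g]. *)
  assert (txx : dxV (dxV t) = scaV (-1) t).
  { assert (E : t = linV 1 (dyV (dyV P)) 1 P).
    { unfold t, tau. rewrite Lap_dxdy, Pxx. apply fext3; intros; unfold scaV, linV; ring. }
    assert (SPx := smoothA_dx P SP). assert (SPy := smoothA_dy P SP). assert (SPyy := smoothA_dy _ SPy).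
    rewrite E. rewrite (dxV_lin 1 1 _ _ SPyy SP).
    rewrite (dxV_lin 1 1 _ _ (smoothA_dx _ SPyy) SPx).
    rewrite (dxV_dyV _ SPy), (dxV_dyV _ SP), (dxV_dyV _ (smoothA_dy _ SPx)), (dxV_dyV _ SPx), Pxx.
    unfold scaV. rewrite (dyV_lin (-1) 0 P P SP SP), (dyV_lin (-1) 0 _ _ SPy SPy).
    apply fext3; intros; unfold linV; ring. }
  assert (XX : forall a b, dxV (dxV (linV a P b t)) = scaV (-1) (linV a P b t)).
  { intros a b. rewrite (dxV_lin a b P t SP St), (dxV_lin a b _ _ (smoothA_dx P SP) (smoothA_dx t St)).
    rewrite Pxx, txx. apply fext3; intros; unfold scaV, linV; ring. }
  exists f, g. split; [|split; [|split; [|split; [|split; [|split; [|split; [|split]]]]]]]; try assumption.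
  - intros i x y Hi. transitivity (P i x y); [unfold P; now rewrite trunc_lt |].
    rewrite (f_equal (fun V : map2 => V i x y) Pfg). unfold linV. ring.
  - split; [exact Sf|]. split; [apply XX|].
    apply fext3; intros i x y. specialize (Ef i x y).
    pose proof (f_equal (fun F : map2 => F i x y) (XX (/ 2) (/ (4 * h)))) as X. cbv beta in X. fold f in X.
    unfold dxV, dyV, scaV, linV in *. lra.
  - split; [exact Sg|]. split; [apply XX|].
    apply fext3; intros i x y. specialize (Eg i x y).
    pose proof (f_equal (fun F : map2 => F i x y) (XX (/ 2) (- / (4 * h)))) as X. cbv beta in X. fold g in X.
    unfold dxV, dyV, scaV, linV in *. lra.
  - intros x y. unfold f. rewrite dotF_linl, !dotF_linr, (dotF_comm N P t), TP, TT, PP. field. lra.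
  - intros x y. unfold g. rewrite dotF_linl, !dotF_linr, (dotF_comm N P t), TP, TT, PP. field. lra.
  - intros x y. unfold f, g. rewrite dotF_linl, !dotF_linr, (dotF_comm N P t), TP, TT, PP. field. lra.
  - rewrite <- Pfg. intros x y. apply (proj2 (proj2 I1)).
Qed.

(** * Plane waves *)

(** The energy [u'^2 + s^2 u^2] is conserved and starts at zero. *)
Lemma harmonic_ode_zero (u du : R -> R) (s : R) :
  0 < s -> (forall t, is_derive u t (du t)) -> (forall t, is_derive du t (- s ^ 2 * u t)) ->
  u 0 = 0 -> du 0 = 0 -> forall t, u t = 0.
Proof.
  intros Hs D1 D2 U0 V0 t.
  set (e := fun t => du t ^ 2 + s ^ 2 * u t ^ 2).
  assert (De : forall t, is_derive e t 0).
  { intros z. unfold e. evar_last.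
    - apply (is_derive_plus (fun t => du t ^ 2) (fun t => s ^ 2 * u t ^ 2)).
      + apply (is_derive_pow du 2 z _ (D2 z)).
      + apply is_derive_scal. apply (is_derive_pow u 2 z _ (D1 z)).
    - unfold plus; simpl. ring. }
  assert (E : e t = 0).
  { destruct (MVT_gen e 0 t (fun _ => 0)) as [c [_ Hc]].
    - intros; apply De.
    - intros x _. apply continuity_pt_filterlim. exact (is_derive_cont _ _ De x).
    - unfold e at 2 in Hc. rewrite U0, V0 in Hc. lra. }
  unfold e in E. pose proof (pow2_ge_0 (du t)) as A. pose proof (pow2_ge_0 (u t)) as B.
  pose proof (pow_lt s 2 Hs) as Hs2. pose proof (Rmult_le_pos _ _ (Rlt_le _ _ Hs2) B) as C.
  assert (Z : s ^ 2 * u t ^ 2 = 0) by lra.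
  apply Rmult_integral in Z. destruct Z as [Z|Z]; [lra | nra].
Qed.

Lemma harmonic_ode (u du : R -> R) (s : R) :
  0 < s -> (forall t, is_derive u t (du t)) -> (forall t, is_derive du t (- s ^ 2 * u t)) ->
  forall t, u t = u 0 * cos (s * t) + du 0 / s * sin (s * t).
Proof.
  intros Hs D1 D2 t.
  assert (Z : u t - (u 0 * cos (s * t) + du 0 / s * sin (s * t)) = 0); [|lra].
  apply (harmonic_ode_zero (fun t => u t - (u 0 * cos (s * t) + du 0 / s * sin (s * t)))
    (fun t => du t - (- u 0 * s * sin (s * t) + du 0 * cos (s * t))) s Hs).
  - intros z. apply (is_derive_minus u (fun t => u 0 * cos (s * t) + du 0 / s * sin (s * t))); [apply D1|].
    auto_derive; [exact I|]. field. lra.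
  - intros z. evar_last.
    + apply (is_derive_minus du (fun t => - u 0 * s * sin (s * t) + du 0 * cos (s * t))); [apply D2|].
      auto_derive; [exact I|]. reflexivity.
    + unfold minus, plus, opp; simpl. field. lra.
  - rewrite Rmult_0_r, cos_0, sin_0. ring.
  - rewrite Rmult_0_r, cos_0, sin_0. ring.
Qed.

Lemma wave_solution_x (sg : R) (f : map2) (i : nat) (x y : R) :
  wave_eq sg f -> f i x y = f i 0 y * cos x + dxV f i 0 y * sin x.
Proof.
  intros (S & X & Y).
  pose proof (harmonic_ode (fun t => f i t y) (fun t => dx (f i) t y) 1 Rlt_0_1) as H.
  rewrite (H (fun t => smooth2_is_x (f i) t y (S i))); clear H.
  - rewrite Rmult_1_l. unfold dxV. field.
  - intros t. pose proof (smooth2_is_x (dx (f i)) t y (smooth2_dx _ (S i))) as D.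
    replace (- 1 ^ 2 * f i t y) with (dx (dx (f i)) t y); [exact D|].
    rewrite (f_equal (fun V : map2 => V i t y) X : dx (dx (f i)) t y = _). unfold scaV, linV. ring.
Qed.

Lemma wave_solution_y (s : R) (f : map2) (i : nat) (x y : R) :
  0 < s -> smoothA f -> dyV (dyV f) = scaV (- s ^ 2) f ->
  f i x y = f i x 0 * cos (s * y) + dyV f i x 0 / s * sin (s * y).
Proof.
  intros Hs S Y.
  apply (harmonic_ode (fun t => f i x t) (fun t => dy (f i) x t) s Hs (fun t => smooth2_is_y (f i) x t (S i))).
  intros t. pose proof (smooth2_is_y (dy (f i)) x t (smooth2_dy _ (S i))) as D.
  replace (- s ^ 2 * f i x t) with (dy (dy (f i)) x t); [exact D|].
  rewrite (f_equal (fun V : map2 => V i x t) Y : dy (dy (f i)) x t = _). unfold scaV, linV. ring.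
Qed.

Definition dotv (N : nat) (a b : nat -> R) : R := sumN N (fun i => a i * b i).

Lemma dotv_comm (N : nat) (a b : nat -> R) : dotv N a b = dotv N b a.
Proof. apply sumN_ext. intros; ring. Qed.

Lemma dotv_ext (N : nat) (a a' b b' : nat -> R) :
  (forall i, (i < N)%nat -> a i = a' i) -> (forall i, (i < N)%nat -> b i = b' i) ->
  dotv N a b = dotv N a' b'.
Proof. intros H H'. apply sumN_ext. intros. now rewrite H, H'. Qed.

Lemma dotv_linl (N : nat) (a b c : nat -> R) (u v : R) :
  dotv N (fun i => u * a i + v * b i) c = u * dotv N a c + v * dotv N b c.
Proof. unfold dotv. rewrite <- sumN_lin. apply sumN_ext; intros; ring. Qed.

Lemma dotv_linr (N : nat) (a b c : nat -> R) (u v : R) :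
  dotv N c (fun i => u * a i + v * b i) = u * dotv N c a + v * dotv N c b.
Proof. now rewrite dotv_comm, dotv_linl, !(dotv_comm N _ c). Qed.

(** All wave vectors of [f] are combinations of [f, f_x, f_y, f_xy] at the origin, so their
    orthogonality to those of [g] follows from the sixteen products in [gram_mixed]. The factors
    [1 *] match the shape of [dotv_linl]. *)
Definition jet_comb (f : map2) (v : nat -> R) : Prop :=
  exists a b c d : R, forall i,
    v i = 1 * (a * f i 0 0 + b * dxV f i 0 0) + 1 * (c * dyV f i 0 0 + d * dyV (dxV f) i 0 0).

Lemma dotv_jet (N : nat) (f : map2) (v w : nat -> R) :
  jet_comb f v ->
  dotv N (fun i => f i 0 0) w = 0 -> dotv N (fun i => dxV f i 0 0) w = 0 ->
  dotv N (fun i => dyV f i 0 0) w = 0 -> dotv N (fun i => dyV (dxV f) i 0 0) w = 0 ->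
  dotv N v w = 0.
Proof.
  intros (a & b & c & d & E) H0 H1 H2 H3.
  rewrite (dotv_ext N v _ w w (fun i _ => E i) (fun i _ => eq_refl)).
  rewrite dotv_linl, (dotv_linl N (fun i => f i 0 0)), (dotv_linl N (fun i => dyV f i 0 0)).
  rewrite H0, H1, H2, H3. ring.
Qed.

(** The second phase is [s y - x] rather than [x - s y] because it is the phase produced by a
    conjugated wave number. *)
Definition wave_sum (s : R) (A : nat -> nat -> R) (i : nat) (x y : R) : R :=
  A 1%nat i * cos (x + s * y) + A 2%nat i * sin (x + s * y) +
  A 3%nat i * cos (s * y - x) + A 4%nat i * sin (s * y - x).

(** Solving in [x] and then in [y] and regrouping by addition formulas yields the vectors. With
    [c = f_x . f_y] at the origin, the squared lengths are [1/4 +- c/(2s)], so [s (r1 - r2) = c].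
    For [s = 0] the two directions coincide, and the second pair is set to zero. *)
Lemma wave_vectors (N : nat) (s : R) (f : map2) :
  0 <= s -> wave_eq (s ^ 2) f -> (forall x y, dotF N f f x y = / 2) ->
  exists (A : nat -> nat -> R) (r1 r2 : R),
    (forall i x y, (i < N)%nat -> f i x y = wave_sum s A i x y) /\
    (forall j, jet_comb f (A j)) /\
    (forall j k, (1 <= j <= 4)%nat -> (1 <= k <= 4)%nat ->
       dotv N (A j) (A k) = if Nat.eqb j k then (if Nat.leb j 2 then r1 else r2) else 0) /\
    r1 + r2 = / 2 /\ 0 <= r1 /\ 0 <= r2 /\ (s = 0 -> r2 = 0) /\
    s * (r1 - r2) = dotF N (dxV f) (dyV f) 0 0 /\
    (forall T, (forall i, f i 0 T = f i 0 0) -> cos (s * T) = 1).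
Proof.
  intros Hs W H. pose proof (gram_self N _ f W H) as G.
  pose proof (fun i x y => wave_solution_x (s ^ 2) f i x y W) as SX.
  destruct (wave_eq_xy _ f W) as [_ Y3]. destruct W as (Sf & X & Y).
  destruct (Rle_lt_or_eq_dec 0 s Hs) as [Hp|Hz].
  - destruct (G 0 0) as (g1 & g2 & g3 & g4 & g5 & g6 & g7 & g8).
    set (c := dotF N (dxV f) (dyV f) 0 0) in *.
    set (F := fun i => f i 0 0). set (Fx := fun i => dxV f i 0 0).
    set (Fy := fun i => dyV f i 0 0). set (Fz := fun i => dyV (dxV f) i 0 0).
    set (A := fun j : nat => match j with
       | 1%nat => fun i => / 2 * F i + (- / (2 * s)) * Fz i
       | 2%nat => fun i => / 2 * Fx i + / (2 * s) * Fy i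
       | 3%nat => fun i => / 2 * F i + / (2 * s) * Fz i
       | _ => fun i => / (2 * s) * Fy i + (- / 2) * Fx i end).
    assert (SY : forall i y, f i 0 y = F i * cos (s * y) + Fy i / s * sin (s * y)).
    { intros i y. now apply wave_solution_y. }
    assert (SYx : forall i y, dxV f i 0 y = Fx i * cos (s * y) + Fz i / s * sin (s * y)).
    { intros i y. apply wave_solution_y; [exact Hp | now apply smoothA_dx | exact Y3]. }
    assert (h0 : dotv N F F = / 2) by apply H.
    change (dotv N F Fx = 0) in g1. change (dotv N F Fy = 0) in g2.
    change (dotv N Fx Fx = / 2) in g3. change (dotv N Fy Fy = s ^ 2 / 2) in g4.
    change (dotv N Fz Fx = 0) in g5. change (dotv N Fz Fy = 0) in g6.
    change (dotv N Fz Fz = s ^ 2 / 2) in g7. change (dotv N Fz F = - c) in g8.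
    assert (hc : dotv N Fx Fy = c) by reflexivity.
    assert (Gr : forall j k, (1 <= j <= 4)%nat -> (1 <= k <= 4)%nat ->
       dotv N (A j) (A k) = if Nat.eqb j k then (if Nat.leb j 2 then / 4 + c / (2 * s) else / 4 - c / (2 * s)) else 0).
    { intros j k Hj Hk.
      destruct j as [|[|[|[|[|j]]]]]; try lia; destruct k as [|[|[|[|[|k]]]]]; try lia; unfold A; simpl;
      rewrite dotv_linl, !dotv_linr, ?(dotv_comm N Fx F), ?(dotv_comm N Fy F), ?(dotv_comm N F Fz),
        ?(dotv_comm N Fy Fx), ?(dotv_comm N Fx Fz), ?(dotv_comm N Fy Fz),
        ?h0, ?g1, ?g2, ?g3, ?g4, ?g5, ?g6, ?g7, ?g8, ?hc; field; lra. }
    assert (Gp : forall j, 0 <= dotv N (A j) (A j)).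
    { intros j. apply sumN_nonneg. intros; apply Rle_0_sqr. }
    exists A, (/ 4 + c / (2 * s)), (/ 4 - c / (2 * s)).
    split; [|split; [|split; [exact Gr|split; [|split; [|split; [|split; [|split]]]]]]].
    + intros i x y _. rewrite SX, SY, SYx. unfold wave_sum, A.
      rewrite cos_plus, sin_plus, cos_minus, sin_minus. field. lra.
    + intros [|[|[|[|j]]]]; unfold A, jet_comb, F, Fx, Fy, Fz.
      * exists 0, (- / 2), (/ (2 * s)), 0. intros; ring.
      * exists (/ 2), 0, 0, (- / (2 * s)). intros; ring.
      * exists 0, (/ 2), (/ (2 * s)), 0. intros; ring.
      * exists (/ 2), 0, 0, (/ (2 * s)). intros; ring.
      * exists 0, (- / 2), (/ (2 * s)), 0. intros; ring.
    + field. lra.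
    + pose proof (Gp 1%nat) as P. now rewrite (Gr 1%nat 1%nat) in P by lia.
    + pose proof (Gp 3%nat) as P. now rewrite (Gr 3%nat 3%nat) in P by lia.
    + intros; lra.
    + field. lra.
    (* Pairing [f(0,T) = f(0,0)] with [F] isolates [cos (s * T)], because [Fy] is orthogonal to [F]
       and [|F|^2 = 1/2]. *)
    + intros T HT.
      assert (E : dotv N (fun i => cos (s * T) * F i + (/ s * sin (s * T)) * Fy i) F = dotv N F F).
      { apply dotv_ext; [|reflexivity]. intros i _. unfold F at 2. rewrite <- HT, SY. field. lra. }
      rewrite dotv_linl, h0, (dotv_comm N Fy F), g2 in E. lra.
  (* Here [|f_y|^2 = 0], so [f] depends on [x] alone and [F], [F_x] are the only wave vectors. *)
  - subst s.
    assert (Yz : forall i x y, (i < N)%nat -> dyV f i x y = 0).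
    { intros i x y Hi. destruct (G x y) as (_ & _ & _ & g4 & _).
      apply (sumN_sq_zero N (fun i => dyV f i x y)); [|exact Hi].
      transitivity (dotF N (dyV f) (dyV f) x y); [reflexivity | rewrite g4; field]. }
    assert (Yc : forall i x y, (i < N)%nat -> f i x y = f i x 0).
    { intros i x y Hi.
      destruct (MVT_gen (fun t => f i x t) 0 y (fun t => dy (f i) x t)) as [c [_ Hc]].
      - intros t _. exact (smooth2_is_y (f i) x t (Sf i)).
      - intros t _. apply continuity_pt_filterlim. exact (smooth2_cont_y (f i) x t (Sf i)).
      - rewrite (Yz i x c Hi : dy (f i) x c = 0) in Hc. lra. }
    destruct (G 0 0) as (g1 & g2 & g3 & _).
    exists (fun j : nat => match j with
       | 1%nat => fun i => f i 0 0 | 2%nat => fun i => dxV f i 0 0 | _ => fun i => 0 end), (/ 2), 0.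
    split; [|split; [|split; [|split; [|split; [|split; [|split; [|split]]]]]]].
    + intros i x y Hi. rewrite (Yc i x y Hi), SX. unfold wave_sum.
      rewrite Rmult_0_l, Rplus_0_r. ring.
    + intros [|[|[|j]]]; unfold jet_comb.
      * exists 0, 0, 0, 0. intros; ring.
      * exists 1, 0, 0, 0. intros; ring.
      * exists 0, 1, 0, 0. intros; ring.
      * exists 0, 0, 0, 0. intros; ring.
    + assert (Z1 : forall a, dotv N a (fun _ => 0) = 0).
      { intros a. transitivity (dotv N a (fun i => 0 * a i + 0 * a i)).
        - apply dotv_ext; intros; ring.
        - rewrite dotv_linr. ring. }
      intros j k Hj Hk.
      destruct j as [|[|[|[|[|j]]]]]; try lia; destruct k as [|[|[|[|[|k]]]]]; try lia; simpl;
        rewrite ?Z1, ?(dotv_comm N (fun _ => 0)), ?Z1; try reflexivity; try apply H; try apply g1; try apply g3.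
      rewrite dotv_comm. apply g1.
    + lra.
    + lra.
    + lra.
    + reflexivity.
    + rewrite Rmult_0_l. symmetry. unfold dotF.
      transitivity (dotv N (fun i => dxV f i 0 0) (fun i => 0 * f i 0 0 + 0 * f i 0 0)).
      * apply dotv_ext; [reflexivity|]. intros i Hi. rewrite (Yz i 0 0 Hi). ring.
      * rewrite dotv_linr. ring.
    + intros. now rewrite Rmult_0_l, cos_0.
Qed.

(** * Orthogonal families and wave data *)

Lemma sumN_zero (N : nat) : sumN N (fun _ => 0) = 0.
Proof. induction N as [|N IH]; simpl; [reflexivity | rewrite IH; ring]. Qed.

Lemma sumN_one (N : nat) : sumN N (fun _ => 1) = INR N.
Proof. induction N as [|N IH]; [reflexivity|]. rewrite S_INR. simpl. rewrite IH. ring. Qed.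

Lemma sumN_plus (N : nat) (f g : nat -> R) : sumN N (fun i => f i + g i) = sumN N f + sumN N g.
Proof. induction N as [|N IH]; simpl; [ring | rewrite IH; ring]. Qed.

Lemma sumN_scal (N : nat) (c : R) (f : nat -> R) : sumN N (fun i => c * f i) = c * sumN N f.
Proof. induction N as [|N IH]; simpl; [ring | rewrite IH; ring]. Qed.

Lemma sumN_swap (N K : nat) (F : nat -> nat -> R) :
  sumN N (fun i => sumN K (fun j => F i j)) = sumN K (fun j => sumN N (fun i => F i j)).
Proof.
  induction N as [|N IH]; simpl; [now rewrite sumN_zero|].
  now rewrite IH, <- sumN_plus.
Qed.

Lemma sumN_delta (N k : nat) (f : nat -> R) :
  (k < N)%nat -> sumN N (fun i => (if Nat.eqb i k then 1 else 0) * f i) = f k.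
Proof.
  induction N as [|N IH]; intros H; [lia|]. simpl.
  destruct (Nat.eq_dec k N) as [->|Hne].
  - rewrite Nat.eqb_refl. rewrite (sumN_ext N _ (fun _ => 0)); [rewrite sumN_zero; ring|].
    intros i Hi. replace (Nat.eqb i N) with false by (symmetry; apply Nat.eqb_neq; lia). ring.
  - rewrite IH by lia. replace (Nat.eqb N k) with false by (symmetry; apply Nat.eqb_neq; lia). ring.
Qed.

(* Summing Parseval's identity for the coordinate vectors counts the family twice. *)
Lemma complete_orthonormal_card (N K : nat) (E : nat -> nat -> R) :
  (forall j k, (1 <= j <= K)%nat -> (1 <= k <= K)%nat ->
     dotv N (E j) (E k) = if Nat.eqb j k then 1 else 0) ->
  (forall a, (forall j, (1 <= j <= K)%nat -> dotv N a (E j) = 0) -> forall i, (i < N)%nat -> a i = 0) ->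
  N = K.
Proof.
  intros G F.
  assert (P : forall i, (i < N)%nat -> sumN K (fun j => E (S j) i * E (S j) i) = 1).
  { intros i0 H0.
    (* The [i0]-th coordinate vector minus its projection onto the family; it is orthogonal to the
       family, hence zero. [S j] bridges sums counted from [0] and vectors counted from [1]. *)
    set (a := fun i => 1 * (if Nat.eqb i i0 then 1 else 0) + (-1) * sumN K (fun j => E (S j) i0 * E (S j) i)).
    assert (Z : a i0 = 0).
    { apply F; [|exact H0]. intros k Hk. unfold a. rewrite dotv_linl. unfold dotv.
      rewrite sumN_delta by exact H0.
      rewrite (sumN_ext N _ (fun i => sumN K (fun j => E (S j) i0 * (E (S j) i * E k i)))).
      2:{ intros i _. rewrite Rmult_comm, <- sumN_scal. apply sumN_ext; intros; ring. }
      rewrite sumN_swap.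
      rewrite (sumN_ext K _ (fun j => (if Nat.eqb j (k - 1) then 1 else 0) * E (S j) i0)).
      2:{ intros j Hj. rewrite sumN_scal. change (sumN N (fun i => E (S j) i * E k i)) with (dotv N (E (S j)) (E k)).
          rewrite G by lia.
          destruct (Nat.eqb_spec (S j) k), (Nat.eqb_spec j (k - 1)); try lia; ring. }
      rewrite (sumN_delta K (k - 1) (fun j => E (S j) i0)) by lia.
      replace (S (k - 1)) with k by lia. ring. }
    unfold a in Z. rewrite Nat.eqb_refl in Z. lra. }
  apply INR_eq. rewrite <- !sumN_one.
  rewrite <- (sumN_ext N _ _ P), sumN_swap. apply sumN_ext. intros j Hj.
  change (dotv N (E (S j)) (E (S j)) = 1). now rewrite G, Nat.eqb_refl by lia.
Qed.

Lemma orthogonal_normalize (N K : nat) (V : nat -> nat -> R) (r : nat -> R) :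
  (forall j k, (1 <= j <= K)%nat -> (1 <= k <= K)%nat ->
     dotv N (V j) (V k) = if Nat.eqb j k then r j else 0) ->
  (forall j, (1 <= j <= K)%nat -> 0 < r j) ->
  forall j k, (1 <= j <= K)%nat -> (1 <= k <= K)%nat ->
     dotv N (fun i => V j i / sqrt (r j)) (fun i => V k i / sqrt (r k)) = if Nat.eqb j k then 1 else 0.
Proof.
  intros G P j k Hj Hk.
  transitivity (/ (sqrt (r j) * sqrt (r k)) * dotv N (V j) (V k)).
  { unfold dotv. rewrite <- sumN_scal. apply sumN_ext. intros. field.
    split; apply Rgt_not_eq, sqrt_lt_R0; auto. }
  rewrite G by assumption. destruct (Nat.eqb_spec j k) as [->|]; [|ring].
  rewrite sqrt_sqrt by (apply Rlt_le; auto). apply Rinv_l. specialize (P k Hk). lra.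
Qed.

Lemma orthogonal_complete_basis (N K : nat) (V : nat -> nat -> R) (r : nat -> R) :
  (forall j k, (1 <= j <= K)%nat -> (1 <= k <= K)%nat ->
     dotv N (V j) (V k) = if Nat.eqb j k then r j else 0) ->
  (forall j, (1 <= j <= K)%nat -> 0 < r j) ->
  (forall a, (forall j, (1 <= j <= K)%nat -> dotv N a (V j) = 0) -> forall i, (i < N)%nat -> a i = 0) ->
  N = K /\ orthonormal_basis N (fun j i => V j i / sqrt (r j)).
Proof.
  intros G P F.
  pose proof (orthogonal_normalize N K V r G P) as O.
  assert (E : N = K).
  { apply (complete_orthonormal_card N K (fun j i => V j i / sqrt (r j)) O).
    intros a Ha. apply F. intros j Hj. specialize (Ha j Hj).
    pose proof (sqrt_lt_R0 _ (P j Hj)) as Q.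
    assert (E : dotv N a (V j) = sqrt (r j) * dotv N a (fun i => V j i / sqrt (r j))).
    { unfold dotv. rewrite <- sumN_scal. apply sumN_ext; intros. field. lra. }
    rewrite E, Ha. ring. }
  split; [exact E|]. intros j k Hj Hk. rewrite E in Hj, Hk. exact (O j k Hj Hk).
Qed.

(** The cosine and sine vectors of one plane wave have the same length, so eight vectors have four
    squared lengths. *)
Definition rho (r1 r2 r3 r4 : R) (j : nat) : R :=
  match j with 1%nat | 2%nat => r1 | 3%nat | 4%nat => r2 | 5%nat | 6%nat => r3 | _ => r4 end.

(** Vectors [1] to [4] belong to [s1], vectors [5] to [8] to [s2]. The third clause is fullness, the
    last equation is [psi_x . psi_y = 0]. Only [r1] and [r2] may vanish. *)
Definition wave_data (N : nat) (h : R) (phi : map2) (W : nat -> nat -> R) (r1 r2 r3 r4 : R) : Prop :=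
  (forall i x y, (i < N)%nat ->
     phi i x y = wave_sum (sqrt (1 - 2 * h)) W i x y
               + wave_sum (sqrt (1 + 2 * h)) (fun j => W (4 + j)%nat) i x y) /\
  (forall j k, (1 <= j <= 8)%nat -> (1 <= k <= 8)%nat ->
     dotv N (W j) (W k) = if Nat.eqb j k then rho r1 r2 r3 r4 j else 0) /\
  (forall a, (forall j, (1 <= j <= 8)%nat -> dotv N a (W j) = 0) -> forall i, (i < N)%nat -> a i = 0) /\
  (r1 + r2 = / 2 /\ r3 + r4 = / 2 /\ 0 <= r1 /\ 0 <= r2 /\ 0 < r3 /\ 0 < r4 /\
   sqrt (1 - 2 * h) * (r1 - r2) + sqrt (1 + 2 * h) * (r3 - r4) = 0).

Lemma dotv_wave_sum (N : nat) (a : nat -> R) (s : R) (A : nat -> nat -> R) (x y : R) :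
  (forall j, (1 <= j <= 4)%nat -> dotv N a (A j) = 0) ->
  sumN N (fun i => a i * wave_sum s A i x y) = 0.
Proof.
  intros H.
  transitivity (cos (x + s * y) * dotv N a (A 1%nat) + sin (x + s * y) * dotv N a (A 2%nat)
    + cos (s * y - x) * dotv N a (A 3%nat) + sin (s * y - x) * dotv N a (A 4%nat)).
  - unfold dotv. rewrite <- !sumN_scal, <- !sumN_plus. apply sumN_ext. intros. unfold wave_sum. ring.
  - rewrite !H by lia. ring.
Qed.

Lemma cos_eq_1_nat (s theta : R) :
  0 <= s -> 0 < theta -> cos (s * (2 * PI * theta)) = 1 -> exists q : nat, s * theta = INR q.
Proof.
  intros Hs Ht H. pose proof PI_RGT_0 as HPI.
  replace (s * (2 * PI * theta)) with (2 * (s * theta * PI)) in H by ring.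
  rewrite cos_2a_sin in H.
  assert (Z : sin (s * theta * PI) = 0) by nra.
  apply sin_eq_0_0 in Z. destruct Z as [k Hk].
  assert (E : s * theta = IZR k) by (apply (Rmult_eq_reg_r PI); lra).
  assert (K0 : (0 <= k)%Z) by (apply le_IZR; rewrite <- E; nra).
  exists (Z.to_nat k). now rewrite INR_IZR_INZ, Z2Nat.id.
Qed.

Lemma torus_structure (n : nat) (theta h : R) (psi : map2) :
  cmc_pbh_torus n theta psi h -> 0 < theta -> 0 < h < 1 ->
  h <= / 2 /\
  (exists W r1 r2 r3 r4, wave_data (S n) h psi W r1 r2 r3 r4 /\ (sqrt (1 - 2 * h) = 0 -> r2 = 0)) /\
  (exists q1 q2 : nat, sqrt (1 - 2 * h) * theta = INR q1 /\ sqrt (1 + 2 * h) * theta = INR q2).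
Proof.
  intros C Ht Hh.
  destruct (eigen_split n theta h psi C Ht Hh)
    as (f & g & Efg & Wf & Wg & Hf & Hg & Hfg & M & Pf & Pg).
  set (N := S n) in *.
  assert (Hh2 : h <= / 2).
  { pose proof (gram_self N _ f Wf Hf 0 0) as (_ & _ & _ & g4 & _).
    pose proof (dotF_nonneg N (dyV f) 0 0). lra. }
  destruct (gram_mixed N (1 - 2 * h) (1 + 2 * h) f g ltac:(lra) Wf Wg Hf Hg Hfg M) as [Bal Mix].
  set (s1 := sqrt (1 - 2 * h)) in *. set (s2 := sqrt (1 + 2 * h)) in *.
  assert (Es1 : s1 ^ 2 = 1 - 2 * h) by (apply pow2_sqrt; lra).
  assert (Es2 : s2 ^ 2 = 1 + 2 * h) by (apply pow2_sqrt; lra).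
  assert (Hs1 : 0 <= s1) by apply sqrt_pos.
  assert (Hs12 : s1 < s2) by (apply sqrt_lt_1; lra).
  rewrite <- Es1 in Wf. rewrite <- Es2 in Wg.
  destruct (wave_vectors N s1 f Hs1 Wf Hf) as (A & r1 & r2 & EA & JA & GA & SA & PA1 & PA2 & ZA & BA & TA).
  destruct (wave_vectors N s2 g ltac:(lra) Wg Hg) as (B & r3 & r4 & EB & JB & GB & SB & PB1 & PB2 & ZB & BB & TB).
  split; [exact Hh2|]. split.
  2:{ destruct (cos_eq_1_nat s1 theta Hs1 Ht) as [q1 H1].
      { apply TA. intros i. rewrite <- (Pf i 0 0). f_equal. ring. }
      destruct (cos_eq_1_nat s2 theta ltac:(lra) Ht) as [q2 H2].
      { apply TB. intros i. rewrite <- (Pg i 0 0). f_equal. ring. }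
      now exists q1, q2. }
  assert (AB : forall j k, dotv N (A j) (B k) = 0).
  { intros j k. destruct (Mix 0 0) as ((a1 & a2 & a3) & (b1 & b2 & b3 & b4) & (c1 & c2 & c3 & c4) & (d1 & d2 & d3 & d4)).
    apply (dotv_jet N f); [apply JA | | | |]; rewrite dotv_comm; apply (dotv_jet N g); try apply JB;
      rewrite dotv_comm; try assumption. apply Hfg. }
  set (W := fun j => if Nat.leb j 4 then A j else B (j - 4)%nat).
  assert (Exp : forall i x y, (i < N)%nat ->
     psi i x y = wave_sum s1 W i x y + wave_sum s2 (fun j => W (4 + j)%nat) i x y).
  { intros i x y Hi. rewrite (Efg i x y Hi), (EA i x y Hi), (EB i x y Hi). reflexivity. }
  exists W, r1, r2, r3, r4. split; [|exact ZA].
  split; [exact Exp|]. split; [|split].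
  - intros j k Hj Hk. unfold W.
    destruct (Nat.leb_spec j 4), (Nat.leb_spec k 4).
    + rewrite GA by lia. destruct (Nat.eqb_spec j k); [|reflexivity].
      destruct j as [|[|[|[|[|j]]]]]; try lia; reflexivity.
    + rewrite AB. destruct (Nat.eqb_spec j k); [lia | reflexivity].
    + rewrite dotv_comm, AB. destruct (Nat.eqb_spec j k); [lia | reflexivity].
    + rewrite GB by lia. destruct (Nat.eqb_spec j k), (Nat.eqb_spec (j - 4) (k - 4)); try lia; [|reflexivity].
      destruct j as [|[|[|[|[|[|[|[|[|j]]]]]]]]]; try lia; reflexivity.
  - intros a Ha. destruct C as ((_ & _ & _ & _ & Full) & _). apply Full. intros x y. fold N.
    rewrite (sumN_ext N _ (fun i => a i * wave_sum s1 W i x y + a i * wave_sum s2 (fun j => W (4 + j)%nat) i x y)).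
    + rewrite sumN_plus, !dotv_wave_sum; [ring | |]; intros j Hj; apply Ha; lia.
    + intros i Hi. rewrite (Exp i x y Hi). ring.
  - assert (E : s1 * (r1 - r2) + s2 * (r3 - r4) = 0) by (rewrite BA, BB; apply Bal).
    (* If [r3] or [r4] were zero, then [s2 |r3 - r4| = s2 / 2], which exceeds
       [s1 |r1 - r2| <= s1 / 2] and contradicts the balance [E]. *)
    repeat split; try assumption; apply Rnot_le_lt; intros L.
    + assert (r3 = 0) by lra. assert (r4 = / 2) by lra. nra.
    + assert (r4 = 0) by lra. assert (r3 = / 2) by lra. nra.
Qed.

(** The reflection [y -> - y] exchanges the phases [x + s y] and [s y - x] up to sign: cosine
    vectors are permuted, sine vectors are also negated. It reduces the case [r1 = 0] to
    [r2 = 0]. *)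
Lemma wave_data_swap (N : nat) (h : R) (phi : map2) (W : nat -> nat -> R) (r1 r2 r3 r4 : R) :
  wave_data N h phi W r1 r2 r3 r4 ->
  exists W', wave_data N h (fun i x y => phi i x (- y)) W' r2 r1 r4 r3.
Proof.
  intros (E & G & F & B).
  set (sw := fun j : nat => match j with 1%nat => 3%nat | 2%nat => 4%nat | 3%nat => 1%nat | 4%nat => 2%nat
     | 5%nat => 7%nat | 6%nat => 8%nat | 7%nat => 5%nat | _ => 6%nat end).
  set (sg := fun j : nat => if Nat.even j then -1 else 1).
  exists (fun j i => sg j * W (sw j) i). split; [|split; [|split]].
  - intros i x y Hi. rewrite E by exact Hi. unfold wave_sum, sg, sw; simpl.
    replace (x + sqrt (1 - 2 * h) * - y) with (- (sqrt (1 - 2 * h) * y - x)) by ring.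
    replace (sqrt (1 - 2 * h) * - y - x) with (- (x + sqrt (1 - 2 * h) * y)) by ring.
    replace (x + sqrt (1 + 2 * h) * - y) with (- (sqrt (1 + 2 * h) * y - x)) by ring.
    replace (sqrt (1 + 2 * h) * - y - x) with (- (x + sqrt (1 + 2 * h) * y)) by ring.
    rewrite !cos_neg, !sin_neg. ring.
  - intros j k Hj Hk.
    transitivity (sg j * sg k * dotv N (W (sw j)) (W (sw k))).
    { unfold dotv. rewrite <- sumN_scal. apply sumN_ext; intros; ring. }
    destruct j as [|[|[|[|[|[|[|[|[|j]]]]]]]]]; try lia;
      destruct k as [|[|[|[|[|[|[|[|[|k]]]]]]]]]; try lia; unfold sw, sg; rewrite G by lia; simpl; ring.
  - intros a Ha. apply F. intros j Hj.
    assert (K : forall k, (1 <= k <= 8)%nat -> dotv N a (W (sw k)) = 0).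
    { intros k Hk. specialize (Ha k Hk).
      assert (X : dotv N a (fun i => sg k * W (sw k) i) = sg k * dotv N a (W (sw k))).
      { unfold dotv. rewrite <- sumN_scal. apply sumN_ext; intros; ring. }
      rewrite X in Ha. unfold sg in Ha. destruct (Nat.even k); lra. }
    destruct j as [|[|[|[|[|[|[|[|[|j]]]]]]]]]; try lia;
      [apply (K 3%nat) | apply (K 4%nat) | apply (K 1%nat) | apply (K 2%nat)
      | apply (K 7%nat) | apply (K 8%nat) | apply (K 5%nat) | apply (K 6%nat)]; lia.
  - repeat split; lra.
Qed.

(** * Explicit form *)

(** [mu z] minus its conjugate is [2 i Im(mu z)], so the exponentials are unimodular with phase
    [s Im(mu z)]. The two summands are conjugate, and the halves in [Zvec] absorb the factor [2] of
    the real part. *)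
Lemma wave_real (s : R) (mu : Complex.C) (E : nat -> nat -> R) (a b i : nat) (x y : R) :
  wave s mu (Zvec E a b i) (x, y) =
  (cos (s * (fst mu * y + snd mu * x)) * E a i + sin (s * (fst mu * y + snd mu * x)) * E b i, 0).
Proof.
  destruct mu as [m1 m2].
  unfold wave, Zvec, cexp, Cplus, Cminus, Copp, Cmult, Cconj, RtoC; simpl.
  replace (s / 2 * (m1 * x - m2 * y + - (m1 * x - - m2 * - y)) -
      0 * (m1 * y + m2 * x + - (m1 * - y + - m2 * x))) with 0 by field.
  replace (s / 2 * - (m1 * x - m2 * y + - (m1 * x - - m2 * - y)) -
      0 * - (m1 * y + m2 * x + - (m1 * - y + - m2 * x))) with 0 by field.
  replace (s / 2 * (m1 * y + m2 * x + - (m1 * - y + - m2 * x)) +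
      0 * (m1 * x - m2 * y + - (m1 * x - - m2 * - y))) with (s * (m1 * y + m2 * x)) by field.
  replace (s / 2 * - (m1 * y + m2 * x + - (m1 * - y + - m2 * x)) +
      0 * - (m1 * x - m2 * y + - (m1 * x - - m2 * - y))) with (- (s * (m1 * y + m2 * x))) by field.
  rewrite exp_0, cos_neg, sin_neg. f_equal; field.
Qed.

(** [sqrt (2 * (1 - h))] times [mu1 h] equals [s1 + i]; conjugation flips the sign of [x]. *)
Lemma mu1_phase (h x y : R) :
  h <= / 2 ->
  sqrt (2 * (1 - h)) * (fst (mu1 h) * y + snd (mu1 h) * x) = x + sqrt (1 - 2 * h) * y /\
  sqrt (2 * (1 - h)) * (fst (Cconj (mu1 h)) * y + snd (Cconj (mu1 h)) * x) = sqrt (1 - 2 * h) * y - x.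
Proof.
  intros Hh. unfold mu1; simpl. rewrite sqrt_div_alt by lra.
  pose proof (sqrt_lt_R0 (2 * (1 - h)) ltac:(lra)). split; field; lra.
Qed.

Lemma eta1_phase (h x y : R) :
  0 < h ->
  sqrt (2 * (1 + h)) * (fst (eta1 h) * y + snd (eta1 h) * x) = x + sqrt (1 + 2 * h) * y /\
  sqrt (2 * (1 + h)) * (fst (Cconj (eta1 h)) * y + snd (Cconj (eta1 h)) * x) = sqrt (1 + 2 * h) * y - x.
Proof.
  intros Hh. unfold eta1; simpl. rewrite sqrt_div_alt by lra.
  pose proof (sqrt_lt_R0 (2 * (1 + h)) ltac:(lra)). split; field; lra.
Qed.

(** The coefficients [R_k] and [R'_j] are twice the squared lengths of the wave vectors; this
    absorbs the factor [1 / sqrt 2] in front. *)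
Lemma amplitude (r q v : R) : 0 < r -> q = 2 * r -> / sqrt 2 * (sqrt q * (v / sqrt r)) = v.
Proof.
  intros Hr ->. rewrite sqrt_mult by lra.
  pose proof (sqrt_lt_R0 2 ltac:(lra)). pose proof (sqrt_lt_R0 r Hr). field. lra.
Qed.

Lemma wave_data_n5 (n : nat) (h : R) (phi : map2) (W : nat -> nat -> R) (r1 r3 r4 : R) :
  0 < h <= / 2 -> wave_data (S n) h phi W r1 0 r3 r4 ->
  n = 5%nat /\ exists E, orthonormal_basis (S n) E /\
    forall x y i, (i < S n)%nat ->
      (phi i x y, 0) = psi_form E 1 2 h (R5 h) (R5' h) (mu5 h) (eta5 h) (x, y) i.
Proof.
  intros Hh (Ex & G & F & Sa & Sb & _ & _ & P3 & P4 & Bal).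
  assert (Hr1 : r1 = / 2) by lra. subst r1. set (N := S n) in *.
  (* Skips the vectors [3] and [4], which vanish because their squared length is [r2 = 0]. *)
  set (sel := fun j : nat => if Nat.leb j 2 then j else (j + 2)%nat).
  assert (W0 : forall j i, (j = 3%nat \/ j = 4%nat) -> (i < N)%nat -> W j i = 0).
  { intros j i Hj Hi. apply (sumN_sq_zero N (W j)); [|exact Hi].
    change (dotv N (W j) (W j) = 0). rewrite G, Nat.eqb_refl by lia. destruct Hj as [->| ->]; reflexivity. }
  destruct (orthogonal_complete_basis N 6 (fun j => W (sel j)) (fun j => rho (/ 2) 0 r3 r4 (sel j)))
    as [HN HE].
  { intros j k Hj Hk. rewrite G.
    - destruct (Nat.eqb_spec (sel j) (sel k)) as [e|ne], (Nat.eqb_spec j k) as [e'|ne']; try reflexivity.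
      + exfalso; apply ne'. revert e. unfold sel. destruct (Nat.leb_spec j 2), (Nat.leb_spec k 2); lia.
      + exfalso; apply ne. now rewrite e'.
    - unfold sel. destruct (Nat.leb_spec j 2); lia.
    - unfold sel. destruct (Nat.leb_spec k 2); lia. }
  { intros j Hj. destruct j as [|[|[|[|[|[|[|j]]]]]]]; try lia; simpl; lra. }
  { intros a Ha. apply F. intros j Hj.
    destruct (Nat.le_gt_cases j 2) as [L|L]; [|destruct (Nat.le_gt_cases j 4) as [L'|L']].
    - specialize (Ha j ltac:(lia)). unfold sel in Ha. destruct (Nat.leb_spec j 2); [exact Ha | lia].
    - unfold dotv. rewrite (sumN_ext N _ (fun _ => 0)); [apply sumN_zero|].
      intros i Hi. rewrite (W0 j i) by lia. ring.
    - specialize (Ha (j - 2)%nat ltac:(lia)). unfold sel in Ha.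
      destruct (Nat.leb_spec (j - 2) 2); [lia|]. now replace (j - 2 + 2)%nat with j in Ha by lia. }
  split; [unfold N in HN; lia|].
  eexists. split; [exact HE|].
  intros x y i Hi. unfold psi_form, sumC1. rewrite !wave_real.
  unfold mu5, eta5. destruct (mu1_phase h x y ltac:(lra)) as [p1 _].
  destruct (eta1_phase h x y ltac:(lra)) as [p2 p3]. rewrite p1, p2, p3.
  rewrite Ex by exact Hi. unfold wave_sum. rewrite (W0 3%nat i), (W0 4%nat i) by auto.
  unfold R5, R5', Cplus, Cmult, RtoC; simpl.
  pose proof (sqrt_lt_R0 (1 + 2 * h) ltac:(lra)) as Hs2.
  rewrite !(sqrt_div_alt (1 - 2 * h) (1 + 2 * h)) by lra.
  set (s1 := sqrt (1 - 2 * h)) in *. set (s2 := sqrt (1 + 2 * h)) in *.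
  (* The balance with [r1 - r2 = 1/2]; together with [r3 + r4 = 1/2] it identifies [2 r3] and [2 r4]
     with the values of [R5']. *)
  assert (B3 : s1 / s2 = -2 * (r3 - r4)) by (apply (Rmult_eq_reg_r s2); [field_simplify; lra | lra]).
  f_equal; [|ring].
  rewrite B3.
  transitivity (cos (x + s1 * y) * (/ sqrt 2 * (sqrt (1) * (W 1%nat i / sqrt (/ 2))))
      + sin (x + s1 * y) * (/ sqrt 2 * (sqrt (1) * (W 2%nat i / sqrt (/ 2))))
    + cos (x + s2 * y) * (/ sqrt 2 * (sqrt (/ 2 * (1 - -2 * (r3 - r4))) * (W 5%nat i / sqrt (r3))))
      + sin (x + s2 * y) * (/ sqrt 2 * (sqrt (/ 2 * (1 - -2 * (r3 - r4))) * (W 6%nat i / sqrt (r3))))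
    + cos (s2 * y - x) * (/ sqrt 2 * (sqrt (/ 2 * (1 + -2 * (r3 - r4))) * (W 7%nat i / sqrt (r4))))
      + sin (s2 * y - x) * (/ sqrt 2 * (sqrt (/ 2 * (1 + -2 * (r3 - r4))) * (W 8%nat i / sqrt (r4))))).
  - rewrite !amplitude by lra. ring.
  - unfold sel; simpl. ring.
Qed.

Lemma wave_data_n7 (n : nat) (h : R) (phi : map2) (W : nat -> nat -> R) (r1 r2 r3 r4 : R) :
  0 < h < / 2 -> wave_data (S n) h phi W r1 r2 r3 r4 -> 0 < r1 -> 0 < r2 ->
  n = 7%nat /\ exists E, orthonormal_basis (S n) E /\
    exists w, - sqrt (1 - 2 * h) < w < sqrt (1 - 2 * h) /\
    forall x y i, (i < S n)%nat ->
      (phi i x y, 0) = psi_form E 2 2 h (R7 h w) (R7' h w) (mu7 h) (eta7 h) (x, y) i.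
Proof.
  intros Hh (Ex & G & F & Sa & Sb & _ & _ & P3 & P4 & Bal) P1 P2. set (N := S n) in *.
  destruct (orthogonal_complete_basis N 8 W (rho r1 r2 r3 r4) G) as [HN HE].
  { intros j Hj. destruct j as [|[|[|[|[|[|[|[|[|j]]]]]]]]]; try lia; simpl; lra. }
  { exact F. }
  split; [unfold N in HN; lia|].
  eexists. split; [exact HE|].
  pose proof (sqrt_lt_R0 (1 - 2 * h) ltac:(lra)) as Hs1.
  pose proof (sqrt_lt_R0 (1 + 2 * h) ltac:(lra)) as Hs2.
  (* Read off from [R_1 = 2 r1 = (1 + w / s1) / 2]; by the balance it also equals
     [- 2 s2 (r3 - r4)], as [R7'] requires. Positivity of [r1] and [r2] gives the strict bounds. *)
  exists (2 * sqrt (1 - 2 * h) * (r1 - r2)). split; [split; nra|].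
  intros x y i Hi. unfold psi_form, sumC1. rewrite !wave_real.
  unfold mu7, eta7. destruct (mu1_phase h x y ltac:(lra)) as [p1 p2].
  destruct (eta1_phase h x y ltac:(lra)) as [p3 p4]. rewrite p1, p2, p3, p4.
  rewrite Ex by exact Hi. unfold wave_sum.
  unfold R7, R7', Cplus, Cmult, RtoC; simpl.
  set (s1 := sqrt (1 - 2 * h)) in *. set (s2 := sqrt (1 + 2 * h)) in *.
  assert (B1 : 2 * s1 * (r1 - r2) / s1 = 2 * (r1 - r2)) by (field; lra).
  assert (B3 : 2 * s1 * (r1 - r2) / s2 = -2 * (r3 - r4)) by (apply (Rmult_eq_reg_r s2); [field_simplify; lra | lra]).
  f_equal; [|ring].
  rewrite B1, B3.
  transitivity (cos (x + s1 * y) * (/ sqrt 2 * (sqrt (/ 2 * (1 + 2 * (r1 - r2))) * (W 1%nat i / sqrt (r1))))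
      + sin (x + s1 * y) * (/ sqrt 2 * (sqrt (/ 2 * (1 + 2 * (r1 - r2))) * (W 2%nat i / sqrt (r1))))
    + cos (s1 * y - x) * (/ sqrt 2 * (sqrt (/ 2 * (1 - 2 * (r1 - r2))) * (W 3%nat i / sqrt (r2))))
      + sin (s1 * y - x) * (/ sqrt 2 * (sqrt (/ 2 * (1 - 2 * (r1 - r2))) * (W 4%nat i / sqrt (r2))))
    + cos (x + s2 * y) * (/ sqrt 2 * (sqrt (/ 2 * (1 - -2 * (r3 - r4))) * (W 5%nat i / sqrt (r3))))
      + sin (x + s2 * y) * (/ sqrt 2 * (sqrt (/ 2 * (1 - -2 * (r3 - r4))) * (W 6%nat i / sqrt (r3))))
    + cos (s2 * y - x) * (/ sqrt 2 * (sqrt (/ 2 * (1 + -2 * (r3 - r4))) * (W 7%nat i / sqrt (r4))))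
      + sin (s2 * y - x) * (/ sqrt 2 * (sqrt (/ 2 * (1 + -2 * (r3 - r4))) * (W 8%nat i / sqrt (r4))))).
  - rewrite !amplitude by lra. ring.
  - ring.
Qed.

Lemma torus_explicit (n : nat) (theta h : R) (psi : map2) :
  0 < theta -> cmc_pbh_torus n theta psi h -> 0 < h < 1 ->
  exists (E : nat -> nat -> R) (a b c d c1 c2 : R),
    orthonormal_basis (S n) E /\ rigid2 a b c d /\
    ((n = 5%nat /\ 0 < h <= / 2 /\
      forall x y i, (i < S n)%nat ->
        (psi i (c1 + a * x + b * y) (c2 + c * x + d * y), 0) =
        psi_form E 1 2 h (R5 h) (R5' h) (mu5 h) (eta5 h) (x, y) i)
     \/
     (n = 7%nat /\ 0 < h < / 2 /\
      exists w : R, - sqrt (1 - 2 * h) < w < sqrt (1 - 2 * h) /\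
      forall x y i, (i < S n)%nat ->
        (psi i (c1 + a * x + b * y) (c2 + c * x + d * y), 0) =
        psi_form E 2 2 h (R7 h w) (R7' h w) (mu7 h) (eta7 h) (x, y) i)).
Proof.
  intros Ht C Hh. destruct (torus_structure n theta h psi C Ht Hh) as (Hh2 & (W & r1 & r2 & r3 & r4 & D & Z) & _).
  pose proof D as (_ & _ & _ & Sa & _ & P1 & P2 & _).
  destruct (Rle_lt_or_eq_dec 0 r2 P2) as [L2|<-]; [destruct (Rle_lt_or_eq_dec 0 r1 P1) as [L1|<-]|].
  (* At [h = 1/2] one has [s1 = 0], where the two directions coincide and [r2 = 0]. *)
  - assert (Hh3 : h < / 2).
    { destruct (Rle_lt_or_eq_dec h (/ 2) Hh2) as [L|E]; [exact L|].
      rewrite E in Z. replace (1 - 2 * / 2) with 0 in Z by field. rewrite sqrt_0 in Z. specialize (Z eq_refl). lra. }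
    destruct (wave_data_n7 n h psi W r1 r2 r3 r4 ltac:(lra) D L1 L2) as (Hn & E & OE & w & Hw & Hp).
    exists E, 1, 0, 0, 1, 0, 0. split; [exact OE|]. split; [unfold rigid2; lra|]. right.
    split; [exact Hn|]. split; [lra|]. exists w. split; [exact Hw|]. intros x y i Hi.
    rewrite <- Hp by exact Hi. repeat f_equal; ring.
  (* Only this case needs a nontrivial isometry of the plane, namely the reflection with
     [d = -1]. *)
  - destruct (wave_data_swap _ _ _ _ _ _ _ _ D) as [W' D'].
    destruct (wave_data_n5 n h _ W' r2 r4 r3 ltac:(lra) D') as (Hn & E & OE & Hp).
    exists E, 1, 0, 0, (-1), 0, 0. split; [exact OE|]. split; [unfold rigid2; lra|]. left.
    split; [exact Hn|]. split; [lra|]. intros x y i Hi.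
    rewrite <- Hp by exact Hi. repeat f_equal; ring.
  - destruct (wave_data_n5 n h psi W r1 r3 r4 ltac:(lra) D) as (Hn & E & OE & Hp).
    exists E, 1, 0, 0, 1, 0, 0. split; [exact OE|]. split; [unfold rigid2; lra|]. left.
    split; [exact Hn|]. split; [lra|]. intros x y i Hi.
    rewrite <- Hp by exact Hi. repeat f_equal; ring.
Qed.

(** With [q1 = s1 theta] and [q2 = s2 theta], [q1^2 + q2^2 = 2 theta^2] and
    [q2^2 - q1^2 = 4 h theta^2]. For [n = 7] the strict bound [h < 1/2] makes [q1] positive. *)
Lemma torus_quantization (n : nat) (theta h : R) (psi : map2) :
  0 < theta -> cmc_pbh_torus n theta psi h -> 0 < h < 1 ->
  exists q1 q2 : nat, (q1 < q2)%nat /\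
    theta ^ 2 = (INR q1 ^ 2 + INR q2 ^ 2) / 2 /\
    h = (INR q2 ^ 2 - INR q1 ^ 2) / (2 * (INR q1 ^ 2 + INR q2 ^ 2)) /\
    (n = 5%nat \/ (n = 7%nat /\ (0 < q1)%nat)).
Proof.
  intros Ht C Hh.
  destruct (torus_structure n theta h psi C Ht Hh) as (Hh2 & _ & q1 & q2 & E1 & E2).
  destruct (torus_explicit n theta h psi Ht C Hh) as (E & a & b & c & d & c1 & c2 & _ & _ & Cases).
  assert (Q1 : INR q1 ^ 2 = (1 - 2 * h) * theta ^ 2).
  { rewrite <- E1, Rpow_mult_distr, pow2_sqrt by lra. reflexivity. }
  assert (Q2 : INR q2 ^ 2 = (1 + 2 * h) * theta ^ 2).
  { rewrite <- E2, Rpow_mult_distr, pow2_sqrt by lra. reflexivity. }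
  pose proof (pow_lt theta 2 Ht) as Ht2.
  exists q1, q2. split; [|split; [|split]].
  - apply INR_lt. rewrite <- E1, <- E2. apply Rmult_lt_compat_r; [exact Ht | apply sqrt_lt_1; lra].
  - rewrite Q1, Q2. field.
  - rewrite Q1, Q2. field; nra.
  - destruct Cases as [[Hn _]|[Hn [Hh3 _]]]; [now left | right]. split; [exact Hn|].
    apply INR_lt. rewrite <- E1. simpl. apply Rmult_lt_0_compat; [apply sqrt_lt_R0; lra | exact Ht].
Qed.

(** * Existence *)

(** The free phase [d] makes the family closed under both derivatives, each adding [PI/2];
    smoothness follows by induction. *)
Definition trig (c b d : R) : R -> R -> R := fun x y => c * cos (x + b * y + d).

Lemma trig_is_x (c b d x y : R) : is_derive (fun t => trig c b d t y) x (trig c b (d + PI / 2) x y).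
Proof.
  unfold trig. replace (x + b * y + (d + PI / 2)) with (PI / 2 + (x + b * y + d)) by ring.
  replace (cos (PI / 2 + (x + b * y + d))) with (- sin (x + b * y + d)) by (rewrite sin_cos; ring).
  auto_derive; [exact I | ring].
Qed.

Lemma trig_is_y (c b d x y : R) :
  is_derive (fun t => trig c b d x t) y (trig (c * b) b (d + PI / 2) x y).
Proof.
  unfold trig. replace (x + b * y + (d + PI / 2)) with (PI / 2 + (x + b * y + d)) by ring.
  replace (cos (PI / 2 + (x + b * y + d))) with (- sin (x + b * y + d)) by (rewrite sin_cos; ring).
  auto_derive; [exact I | ring].
Qed.

Lemma dx_trig (c b d : R) : dx (trig c b d) = trig c b (d + PI / 2).
Proof. apply fext2; intros x y. exact (is_derive_unique _ _ _ (trig_is_x c b d x y)). Qed.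

Lemma dy_trig (c b d : R) : dy (trig c b d) = trig (c * b) b (d + PI / 2).
Proof. apply fext2; intros x y. exact (is_derive_unique _ _ _ (trig_is_y c b d x y)). Qed.

Lemma pd_trig (l : list bool) (c b d : R) : exists c' d', pd l (trig c b d) = trig c' b d'.
Proof.
  induction l as [|e l (c' & d' & IH)]; simpl; [now exists c, d|]. rewrite IH.
  destruct e; [rewrite dx_trig | rewrite dy_trig]; eexists; eexists; reflexivity.
Qed.

Lemma smooth2_trig (c b d : R) : smooth2 (trig c b d).
Proof.
  intros l x y. destruct (pd_trig l c b d) as (c' & d' & ->). split; [|split].
  - eexists. apply trig_is_x.
  - eexists. apply trig_is_y.
  - unfold trig.
    apply (continuous_comp (fun p : R * R => fst p + b * snd p + d') (fun t => c' * cos t)).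
    + apply (continuous_plus (U := prod_UniformSpace R_UniformSpace R_UniformSpace) (V := R_NormedModule)
        (fun p : R * R => fst p + b * snd p) (fun _ => d')); [|apply continuous_const].
      apply (continuous_plus (U := prod_UniformSpace R_UniformSpace R_UniformSpace) (V := R_NormedModule)
        (fun p : R * R => fst p) (fun p => b * snd p)); [apply continuous_fst|].
      apply (continuous_scal_r (U := prod_UniformSpace R_UniformSpace R_UniformSpace) (V := R_NormedModule)
        b (fun p : R * R => snd p)). apply continuous_snd.
    + apply cont_scal, continuous_cos.
Qed.

(* Coordinates [2k] and [2k+1] carry [c_k cos] and [c_k sin] of [x + b_k y + d]. *)
Definition tw (c b : nat -> R) (d : R) : map2 :=
  fun i => trig (c (i / 2)%nat) (b (i / 2)%nat) (if Nat.even i then d else d - PI / 2).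

Lemma dxV_tw (c b : nat -> R) (d : R) : dxV (tw c b d) = tw c b (d + PI / 2).
Proof.
  apply functional_extensionality; intros i. unfold dxV, tw. rewrite dx_trig.
  destruct (Nat.even i); f_equal; ring.
Qed.

Lemma dyV_tw (c b : nat -> R) (d : R) : dyV (tw c b d) = tw (fun k => c k * b k) b (d + PI / 2).
Proof.
  apply functional_extensionality; intros i. unfold dyV, tw. rewrite dy_trig.
  destruct (Nat.even i); f_equal; ring.
Qed.

Lemma sumN_pairs (K : nat) (F : nat -> R) :
  sumN (2 * K) F = sumN K (fun k => F (2 * k)%nat + F (2 * k + 1)%nat).
Proof.
  induction K as [|K IH]; [reflexivity|].
  replace (2 * S K)%nat with (S (S (2 * K))) by lia. simpl sumN. simpl in IH. rewrite IH.
  replace (K + (K + 0) + 1)%nat with (S (K + (K + 0))) by lia. ring.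
Qed.

Lemma tw_even (c b : nat -> R) (d x y : R) (k : nat) :
  tw c b d (2 * k)%nat x y = c k * cos (x + b k * y + d).
Proof.
  unfold tw, trig. rewrite Nat.even_mul. simpl orb. cbv iota.
  replace (2 * k / 2)%nat with k by (rewrite Nat.mul_comm, Nat.div_mul; lia). reflexivity.
Qed.

Lemma tw_odd (c b : nat -> R) (d x y : R) (k : nat) :
  tw c b d (2 * k + 1)%nat x y = c k * sin (x + b k * y + d).
Proof.
  unfold tw, trig. replace ((2 * k + 1) / 2)%nat with k by (apply (Nat.div_unique _ 2 k 1); lia).
  rewrite Nat.even_add, Nat.even_mul. cbn [Nat.even orb Bool.eqb].
  f_equal. rewrite <- cos_shift, <- cos_neg. f_equal. ring.
Qed.

Lemma dotF_tw (K : nat) (c c' b : nat -> R) (d x y : R) :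
  dotF (2 * K) (tw c b d) (tw c' b d) x y = sumN K (fun k => c k * c' k).
Proof.
  unfold dotF. rewrite sumN_pairs. apply sumN_ext. intros k _. rewrite !tw_even, !tw_odd.
  pose proof (sin2_cos2 (x + b k * y + d)) as E. unfold Rsqr in E.
  transitivity (c k * c' k * (sin (x + b k * y + d) * sin (x + b k * y + d)
    + cos (x + b k * y + d) * cos (x + b k * y + d))); [ring | rewrite E; ring].
Qed.

Lemma smoothA_tw (c b : nat -> R) (d : R) : smoothA (tw c b d).
Proof. intros i. apply smooth2_trig. Qed.

Lemma Lap_tw (c b : nat -> R) (d : R) :
  Lap (tw c b d) = tw (fun k => - (1 + b k ^ 2) * c k) b d.
Proof.
  rewrite Lap_dxdy, !dxV_tw, !dyV_tw. apply fext3; intros i x y. unfold linV, tw, trig.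
  destruct (Nat.even i);
  [ replace (x + b (i / 2)%nat * y + (d + PI / 2 + PI / 2)) with (x + b (i / 2)%nat * y + d + PI) by field
  | replace (x + b (i / 2)%nat * y + (d + PI / 2 + PI / 2 - PI / 2)) with (x + b (i / 2)%nat * y + (d - PI / 2) + PI) by field ];
  rewrite neg_cos; ring.
Qed.

Lemma tau_tw (c b : nat -> R) (d : R) : tau (tw c b d) = tw (fun k => (1 - b k ^ 2) * c k) b d.
Proof.
  unfold tau. rewrite Lap_tw. apply fext3; intros i x y. unfold linV, tw, trig. ring.
Qed.

Lemma cos_period_signed (t u : R) (q : nat) :
  u = INR q \/ u = - INR q -> cos (t + 2 * PI * u) = cos t.
Proof.
  intros [->| ->].
  - rewrite <- (cos_period t q). f_equal. ring.
  - rewrite <- (cos_period (t + 2 * PI * - INR q) q). f_equal. ring.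
Qed.

(** The [y]-derivative turns every phase by a quarter; taking it at [x - PI/2] undoes the turn, and
    what is left is multiplication of the coefficients by [b k]. *)
Lemma trig_sum_moment (K : nat) (b p q : nat -> R) :
  (forall x y, sumN K (fun k => p k * cos (x + b k * y) + q k * sin (x + b k * y)) = 0) ->
  forall x y, sumN K (fun k => (b k * p k) * cos (x + b k * y) + (b k * q k) * sin (x + b k * y)) = 0.
Proof.
  intros H x y.
  assert (D : is_derive (fun t => sumN K (fun k => p k * cos (x - PI / 2 + b k * t) + q k * sin (x - PI / 2 + b k * t))) y
     (sumN K (fun k => (b k * p k) * cos (x + b k * y) + (b k * q k) * sin (x + b k * y)))).
  { apply (sumN_derive K (fun k t => p k * cos (x - PI / 2 + b k * t) + q k * sin (x - PI / 2 + b k * t))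
      (fun k t => (b k * p k) * cos (x + b k * t) + (b k * q k) * sin (x + b k * t))).
    intros k _. evar_last; [auto_derive; [exact I | reflexivity]|].
    change (x + - (PI * / 2)) with (x - PI / 2).
    replace (x - PI / 2 + b k * y) with (- (PI / 2 - (x + b k * y))) by ring.
    rewrite cos_neg, sin_neg, cos_shift, sin_shift. ring. }
  rewrite <- (is_derive_unique _ _ _ D), <- (Derive_const 0 y). apply Derive_ext. intros; apply H.
Qed.

(** Evaluation at [(0,0)] and [(PI/2,0)] separates cosine from sine coefficients, which reduces
    fullness to a Vandermonde system in the [b k]. *)
Lemma trig_sum_moments (K m : nat) (b p q : nat -> R) :
  (forall x y, sumN K (fun k => p k * cos (x + b k * y) + q k * sin (x + b k * y)) = 0) ->
  sumN K (fun k => b k ^ m * p k) = 0 /\ sumN K (fun k => b k ^ m * q k) = 0.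
Proof.
  intros H.
  assert (G : forall x y, sumN K (fun k => (b k ^ m * p k) * cos (x + b k * y) + (b k ^ m * q k) * sin (x + b k * y)) = 0).
  { induction m as [|m IH].
    - intros x y. rewrite <- (H x y). apply sumN_ext. intros; simpl; ring.
    - intros x y. rewrite <- (trig_sum_moment K b _ _ IH x y). apply sumN_ext. intros; simpl; ring. }
  split.
  - rewrite <- (G 0 0). apply sumN_ext. intros k _.
    rewrite Rmult_0_r, Rplus_0_r, cos_0, sin_0. ring.
  - rewrite <- (G (PI / 2) 0). apply sumN_ext. intros k _.
    rewrite Rmult_0_r, Rplus_0_r, cos_PI2, sin_PI2. ring.
Qed.

(** The three sums are [|psi|^2 = |psi_x|^2], [psi_x . psi_y] and [|psi_y|^2]. As [tau] multiplies
    the [k]-th wave by [1 - b_k^2], the condition on its square yields both [|tau| = 2h] and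
    [Lap tau + 2 tau = 4 h^2 psi]. *)
Lemma tw_cmc_pbh (K n : nat) (theta h : R) (c b : nat -> R) :
  S n = (2 * K)%nat -> 0 < h ->
  sumN K (fun k => c k * c k) = 1 -> sumN K (fun k => c k * (c k * b k)) = 0 ->
  sumN K (fun k => c k * b k * (c k * b k)) = 1 ->
  (forall k, (k < K)%nat -> (1 - b k ^ 2) ^ 2 = 4 * h ^ 2) ->
  (forall k, (k < K)%nat -> exists q : nat, b k * theta = INR q \/ b k * theta = - INR q) ->
  (forall k, (k < K)%nat -> c k <> 0) ->
  (forall p : nat -> R, (forall m, sumN K (fun k => b k ^ m * p k) = 0) -> forall k, (k < K)%nat -> p k = 0) ->
  cmc_pbh_torus n theta (tw c b 0) h.
Proof.
  intros HN Hh C1 C2 C3 Hb Hper Hc Hvan.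
  set (psi := tw c b 0).
  assert (Half : forall i, (i < S n)%nat -> (i / 2 < K)%nat).
  { intros i Hi. apply Nat.Div0.div_lt_upper_bound. lia. }
  assert (SI : sphere_isometric (S n) psi).
  { split; [exact (smoothA_V _ _ (smoothA_tw c b 0))|]. rewrite HN. unfold psi. split.
    - intros x y. now rewrite dotF_tw.
    - intros x y. rewrite dxV_tw, dyV_tw, !dotF_tw. auto. }
  assert (TT : forall x y, dotF (S n) (tau psi) (tau psi) x y = 4 * h ^ 2).
  { intros x y. unfold psi. rewrite tau_tw, HN, dotF_tw.
    rewrite (sumN_ext K _ (fun k => 4 * h ^ 2 * (c k * c k))); [rewrite sumN_scal, C1; ring|].
    intros k Hk. rewrite <- (Hb k Hk). ring. }
  split; [|split; [split|]].
  - destruct SI as (S1 & S2 & S3).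
    split; [exact S1|]. split; [|split; [exact S2|split; [exact S3|]]].
    + intros i x y Hi. unfold psi, tw, trig. destruct (Hper _ (Half i Hi)) as [q Hq]. split.
      * f_equal. set (d := if Nat.even i then 0 else 0 - PI / 2).
        replace (x + 2 * PI + b (i / 2)%nat * y + d) with (x + b (i / 2)%nat * y + d + 2 * PI * 1) by ring.
        apply (cos_period_signed _ _ 1). left. reflexivity.
      * f_equal. set (d := if Nat.even i then 0 else 0 - PI / 2).
        replace (x + b (i / 2)%nat * (y + 2 * PI * theta) + d)
          with (x + b (i / 2)%nat * y + d + 2 * PI * (b (i / 2)%nat * theta)) by ring.
        now apply (cos_period_signed _ _ q).
    + intros a Ha.
      assert (Z : forall x y, sumN K (fun k => (a (2 * k)%nat * c k) * cos (x + b k * y)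
                  + (a (2 * k + 1)%nat * c k) * sin (x + b k * y)) = 0).
      { intros x y. rewrite <- (Ha x y), HN, sumN_pairs. apply sumN_ext. intros k _.
        unfold psi. rewrite tw_even, tw_odd, Rplus_0_r. ring. }
      assert (Za : forall k, (k < K)%nat -> a (2 * k)%nat * c k = 0).
      { apply (Hvan (fun k => a (2 * k)%nat * c k)). intros m. apply (trig_sum_moments K m b _ _ Z). }
      assert (Zb : forall k, (k < K)%nat -> a (2 * k + 1)%nat * c k = 0).
      { apply (Hvan (fun k => a (2 * k + 1)%nat * c k)). intros m. apply (trig_sum_moments K m b _ _ Z). }
      intros i Hi. pose proof (Half i Hi) as Hk. specialize (Za _ Hk). specialize (Zb _ Hk). specialize (Hc _ Hk).
      apply Rmult_integral in Za. apply Rmult_integral in Zb.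
      pose proof (Nat.div_mod_eq i 2) as E. pose proof (Nat.mod_upper_bound i 2 ltac:(lia)) as L.
      destruct (Nat.eq_dec (i mod 2) 0) as [e|e].
      * rewrite e, Nat.add_0_r in E. rewrite E. tauto.
      * replace (i mod 2) with 1%nat in E by lia. rewrite E. tauto.
  - intros i x y Hi. rewrite (bitension_tau (S n) psi i x y SI), TT.
    unfold psi. rewrite tau_tw, Lap_tw. unfold tw, trig. rewrite <- (Hb _ (Half i Hi)). ring.
  - intros Hz.
    assert (Z : dotF (S n) (tau psi) (tau psi) 0 0 = 0).
    { transitivity (sumN (S n) (fun _ => 0)); [|apply sumN_zero]. apply sumN_ext. intros i Hi.
      assert (T0 : tau psi i 0 0 = 0) by (rewrite <- (tension_tau (S n) psi SI); exact (Hz i 0 0 Hi)).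
      rewrite T0. ring. }
    rewrite TT in Z. nra.
  - intros x y. rewrite (meancurv_norm_tau (S n) psi x y SI), TT.
    replace (/ 4 * (4 * h ^ 2)) with (h ^ 2) by field. apply sqrt_pow2. lra.
Qed.

Lemma torus_existence (n q1 q2 : nat) (theta h : R) :
  0 < theta -> (q1 < q2)%nat -> theta ^ 2 = (INR q1 ^ 2 + INR q2 ^ 2) / 2 ->
  h = (INR q2 ^ 2 - INR q1 ^ 2) / (2 * (INR q1 ^ 2 + INR q2 ^ 2)) ->
  (n = 5%nat \/ (n = 7%nat /\ (0 < q1)%nat)) ->
  exists psi, cmc_pbh_torus n theta psi h /\ 0 < h < 1.
Proof.
  intros Ht Hq Eth Eh Hn.
  pose proof (pos_INR q1) as Q1. pose proof (lt_INR _ _ Hq) as Q12.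
  pose proof (pow_lt theta 2 Ht) as Ht2.
  set (s1 := INR q1 / theta). set (s2 := INR q2 / theta).
  assert (E1 : s1 * theta = INR q1) by (unfold s1; field; lra).
  assert (E2 : s2 * theta = INR q2) by (unfold s2; field; lra).
  assert (P1 : 0 <= s1) by (apply Rmult_le_pos; [exact Q1 | apply Rlt_le, Rinv_0_lt_compat, Ht]).
  assert (P12 : s1 < s2) by (apply Rmult_lt_compat_r; [apply Rinv_0_lt_compat, Ht | exact Q12]).
  assert (Eh' : h = (INR q2 ^ 2 - INR q1 ^ 2) / (4 * theta ^ 2)).
  { rewrite Eh, Eth. field. nra. }
  assert (S1 : s1 ^ 2 = 1 - 2 * h).
  { apply (Rmult_eq_reg_r (theta ^ 2)); [|lra]. rewrite Eh'. 
    transitivity (INR q1 ^ 2); [rewrite <- E1; ring|]. field_simplify; [lra | lra]. }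
  assert (S2 : s2 ^ 2 = 1 + 2 * h).
  { apply (Rmult_eq_reg_r (theta ^ 2)); [|lra]. rewrite Eh'.
    transitivity (INR q2 ^ 2); [rewrite <- E2; ring|]. field_simplify; [lra | lra]. }
  assert (Hh : 0 < h) by nra.
  assert (Hh1 : h < 1) by nra.
  destruct Hn as [->|[-> Hq1]].
  (* Solution of [r3 + r4 = 1/2] and [s1 / 2 + s2 (r3 - r4) = 0], the balance for [r1 = 1/2],
     [r2 = 0]. *)
  - set (r3 := / 4 * (1 - s1 / s2)). set (r4 := / 4 * (1 + s1 / s2)).
    assert (L : 0 <= s1 / s2 < 1).
    { split; [apply Rmult_le_pos; [exact P1 | apply Rlt_le, Rinv_0_lt_compat; lra]|].
      apply Rlt_div_l; lra. }
    assert (R3 : 0 < r3) by (unfold r3; lra). assert (R4 : 0 < r4) by (unfold r4; lra).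
    pose proof (sqrt_sqrt (/ 2) ltac:(lra)) as W1. pose proof (sqrt_sqrt r3 ltac:(lra)) as W3.
    pose proof (sqrt_sqrt r4 ltac:(lra)) as W4.
    pose proof (sqrt_lt_R0 (/ 2) ltac:(lra)) as V1. pose proof (sqrt_lt_R0 r3 R3) as V3.
    pose proof (sqrt_lt_R0 r4 R4) as V4.
    assert (Bal : s1 / 2 + s2 * (r3 - r4) = 0) by (unfold r3, r4; field; lra).
    assert (Sum : r3 + r4 = / 2) by (unfold r3, r4; field; lra).
    set (c := fun k : nat => match k with 0%nat => sqrt (/ 2) | 1%nat => sqrt r3 | _ => sqrt r4 end).
    set (b := fun k : nat => match k with 0%nat => s1 | 1%nat => s2 | _ => - s2 end).
    exists (tw c b 0). split; [|lra].
    apply (tw_cmc_pbh 3); auto.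
    + simpl. lra.
    + simpl. transitivity (sqrt (/ 2) * sqrt (/ 2) * s1 + sqrt r3 * sqrt r3 * s2 - sqrt r4 * sqrt r4 * s2); [ring|].
      rewrite W1, W3, W4. lra.
    + simpl. transitivity (sqrt (/ 2) * sqrt (/ 2) * s1 ^ 2 + (sqrt r3 * sqrt r3 + sqrt r4 * sqrt r4) * s2 ^ 2); [ring|].
      rewrite W1, W3, W4, S1, S2, Sum. lra.
    + intros [|[|k]] _; simpl b; rewrite <- ?Rsqr_pow2, <- ?Rsqr_neg, ?Rsqr_pow2, ?S1, ?S2; ring.
    + intros [|[|k]] _; simpl b; [exists q1; left; lra | exists q2; left; lra | exists q2; right; lra].
    + intros [|[|k]] _; simpl c; lra.
    + intros p Hp. pose proof (Hp 0%nat) as M0. pose proof (Hp 1%nat) as M1. pose proof (Hp 2%nat) as M2.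
      simpl in M0, M1, M2.
      (* [s2^2] times the zeroth moment minus the second. *)
      assert (Z0 : (s2 ^ 2 - s1 ^ 2) * p 0%nat = 0) by nra.
      apply Rmult_integral in Z0. destruct Z0 as [Z0|Z0]; [nra|].
      assert (Z1 : s2 * (p 1%nat - p 2%nat) = 0) by nra.
      apply Rmult_integral in Z1. destruct Z1 as [Z1|Z1]; [lra|].
      intros [|[|[|k]]] Hk; try lia; lra.
  - assert (P1' : 0 < s1).
    { apply Rmult_lt_0_compat; [apply (lt_INR 0 q1 Hq1) | apply Rinv_0_lt_compat, Ht]. }
    (* Equal amplitudes, the member [w = 0] of the family: the balance holds by symmetry. *)
    set (c := fun k : nat => / 2).
    set (b := fun k : nat => match k with 0%nat => s1 | 1%nat => - s1 | 2%nat => s2 | _ => - s2 end).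
    exists (tw c b 0). split; [|lra].
    apply (tw_cmc_pbh 4); auto.
    + simpl. unfold c. field.
    + simpl. unfold c. field.
    + simpl. unfold c. transitivity (/ 2 * (s1 ^ 2 + s2 ^ 2)); [field|]. rewrite S1, S2. field.
    + intros [|[|[|k]]] _; simpl b; rewrite <- ?Rsqr_pow2, <- ?Rsqr_neg, ?Rsqr_pow2, ?S1, ?S2; ring.
    + intros [|[|[|k]]] _; simpl b; [exists q1; left; lra | exists q1; right; lra
        | exists q2; left; lra | exists q2; right; lra].
    + intros k _; unfold c; lra.
    + intros p Hp. pose proof (Hp 0%nat) as M0. pose proof (Hp 1%nat) as M1. pose proof (Hp 2%nat) as M2.
      pose proof (Hp 3%nat) as M3. simpl in M0, M1, M2, M3.
      (* Since the [b k] come in opposite pairs, even moments involve only the sums within a pair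
         and odd moments only the differences, leaving two systems of size two. *)
      assert (Z0 : (s2 ^ 2 - s1 ^ 2) * (p 0%nat + p 1%nat) = 0).
      { transitivity (s2 ^ 2 * (p 0%nat + p 1%nat + p 2%nat + p 3%nat)
          - (s1 ^ 2 * (p 0%nat + p 1%nat) + s2 ^ 2 * (p 2%nat + p 3%nat))); [ring|]. nra. }
      assert (Z1 : (s2 ^ 2 - s1 ^ 2) * (s1 * (p 0%nat - p 1%nat)) = 0).
      { transitivity (s2 ^ 2 * (s1 * (p 0%nat - p 1%nat) + s2 * (p 2%nat - p 3%nat))
          - (s1 ^ 3 * (p 0%nat - p 1%nat) + s2 ^ 3 * (p 2%nat - p 3%nat))); [ring|].
        replace (s1 * (p 0%nat - p 1%nat) + s2 * (p 2%nat - p 3%nat)) with 0 by lra.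
        replace (s1 ^ 3 * (p 0%nat - p 1%nat) + s2 ^ 3 * (p 2%nat - p 3%nat)) with 0 by lra. ring. }
      apply Rmult_integral in Z0. destruct Z0 as [Z0|Z0]; [nra|].
      apply Rmult_integral in Z1. destruct Z1 as [Z1|Z1]; [nra|].
      apply Rmult_integral in Z1. destruct Z1 as [Z1|Z1]; [lra|].
      assert (Z2 : s2 * (p 2%nat - p 3%nat) = 0) by (replace (p 0%nat) with 0 in * by lra; replace (p 1%nat) with 0 in * by lra; lra).
      apply Rmult_integral in Z2. destruct Z2 as [Z2|Z2]; [lra|].
      intros [|[|[|[|k]]]] Hk; try lia; lra.
Qed.

Theorem theorem3p1 (theta : R) (n : nat) (Htheta : 0 < theta) :
  (* existence / classification *)
  (forall h : R,
     (exists psi : map2, cmc_pbh_torus n theta psi h /\ 0 < h < 1) <->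
     (exists q1 q2 : nat, (q1 < q2)%nat /\
        theta ^ 2 = (INR q1 ^ 2 + INR q2 ^ 2) / 2 /\
        h = (INR q2 ^ 2 - INR q1 ^ 2) / (2 * (INR q1 ^ 2 + INR q2 ^ 2)) /\
        (n = 5%nat \/ (n = 7%nat /\ (0 < q1)%nat)))) /\
  (* explicit form, up to the choice of orthonormal basis of R^{n+1} and an isometry of R^2 *)
  (forall (psi : map2) (h : R), cmc_pbh_torus n theta psi h -> 0 < h < 1 ->
     exists (E : nat -> nat -> R) (a b c d c1 c2 : R),
       orthonormal_basis (S n) E /\ rigid2 a b c d /\
       ((n = 5%nat /\ 0 < h <= / 2 /\
         forall x y i, (i < S n)%nat ->
           (psi i (c1 + a * x + b * y) (c2 + c * x + d * y), 0) =
           psi_form E 1 2 h (R5 h) (R5' h) (mu5 h) (eta5 h) (x, y) i)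
        \/
        (n = 7%nat /\ 0 < h < / 2 /\
         exists w : R, - sqrt (1 - 2 * h) < w < sqrt (1 - 2 * h) /\
         forall x y i, (i < S n)%nat ->
           (psi i (c1 + a * x + b * y) (c2 + c * x + d * y), 0) =
           psi_form E 2 2 h (R7 h w) (R7' h w) (mu7 h) (eta7 h) (x, y) i))).
Proof.
  split.
  - intros h. split.
    + intros (psi & C & Hh). exact (torus_quantization n theta h psi Htheta C Hh).
    + intros (q1 & q2 & Hq & Eth & Eh & Hn). exact (torus_existence n q1 q2 theta h Htheta Hq Eth Eh Hn).
  - intros psi h C Hh. exact (torus_explicit n theta h psi Htheta C Hh).
Qed.
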